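(* Suppose $G$ is a locally compact Abelian group. Let $\Omega\subseteq G$ be a symmetric subset ($\Omega=-\Omega$) with $0\in\operatorname{int}\Omega$, and let $\rho,\sigma\in X'=M(G;\mathbb{R})$, where $X=C^{\infty,1}(G;\mathbb{R})$, $\sigma$ is strictly positive definite and $\rho$ is even. Write $\Omega^c:=G\setminus\Omega$. Let \[ \mathcal{F}_G^\sigma(\Omega):=\{ f\in C^{\infty,1}(G;\mathbb{R}) : f \text{ positive definite},\ f|_{\Omega^c}\le 0,\ \langle f,\sigma\rangle=1\}, \] and, for $\Theta\subseteq G$, let $\mathcal{M}_G(\Theta)$ be the set of all $\mu\in M(G;\mathbb{R})$ of the form $\mu=\nu-\kappa$ with $\nu,\kappa\in M(G;\mathbb{R})$, $\kappa\ge 0$, $\operatorname{supp}(\kappa)\subseteq\overline{\Theta}$, and $\nu$ of positive type. Consider the linear programming ''primal'' extremal problem \[ \alpha_\sigma^\rho(\Omega):=\inf\{\langle f,\rho\rangle : f\in\mathcal{F}_G^\sigma(\Omega)\}. \] Then its linear programming dual problem is \[ \omega_\sigma^\rho(\overline{\Omega^c}):=\sup\{ s\in\mathbb{R} : \rho-s\sigma\in\mathcal{M}_G(\Omega^c)\}, \] and there is no duality gap between the two problems, i.e. $\alpha_\sigma^\rho(\Omega)=\omega_\sigma^\rho(\overline{\Omega^c})$.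
   Context: Locally compact Abelian groups are Hausdorff and written additively with neutral element $0$. The space $X=C^{\infty,1}(G;\mathbb{R})$: choose a compactly generated, open and closed subgroup $G_0$ of $G$ and a complete set $\Lambda\subseteq G$ of representatives of $G/G_0$. In $G_0$ choose a discrete subgroup $L\cong\mathbb{Z}^d$ with $G_0/L$ compact and a relatively compact Borel set $B\subseteq G_0$ with $\overline{B}=-\overline{B}$ and boundary of Haar measure zero, such that every $g\in G_0$ is uniquely $g=\ell+b$ with $\ell\in L$, $b\in B$ (such a choice exists). Put $\|f\|_X:=\sum_{\ell\in L,\,m\in\Lambda}\|f|_{m+\ell+B}\|_\infty$ and $X:=\{f\in C(G;\mathbb{R}):\|f\|_X<\infty\}$, a Banach space. (If $G$ is compactly generated one takes $G_0=G$, $\Lambda=\{0\}$.) A (real) Radon measure is an element of the dual of $C_c(G;\mathbb{R})$ with its inductive limit topology; it is written $\psi=\psi^+-\psi^-$ with its (minimal) positive and negative parts $\psi^\pm$, which are identified with positive Radon–Borel measures, and $|\psi|=\psi^++\psi^-$. $\psi$ is translation bounded if for some compact neighborhood $K$ of $0$ one has $\sup_{x\in G}|\psi|(K+x)<\infty$. $M(G;\mathbb{R})$ is the space of real translation bounded Radon measures; it is identified with the topological dual $X'$ via $\langle f,\psi\rangle=\int_G f\,d\psi^+-\int_G f\,d\psi^-$, extended complex-linearly to complex-valued functions. A function $f:G\to\mathbb{C}$ is positive definite if $\sum_{k,l=1}^n c_k\overline{c_l}f(x_k-x_l)\ge0$ for all $n$, $c_k\in\mathbb{C}$, $x_k\in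 G$. A measure $\mu\in M(G;\mathbb{R})$ is of positive type (positive definite) if $\langle u\star\widetilde u,\mu\rangle\ge0$ for all $u\in C_c(G;\mathbb{C})$, where $\widetilde u(x)=\overline{u(-x)}$ and $\star$ is convolution with respect to Haar measure. $\mu$ is even if $\langle f(-\,\cdot),\mu\rangle=\langle f,\mu\rangle$ for all $f\in C_c(G;\mathbb{R})$. $\sigma\in M(G;\mathbb{R})$ is strictly positive definite if it is of positive type and $\langle f,\sigma\rangle>0$ for every nonzero positive definite $f\in X$. Conventions: $\inf\emptyset=\infty$, $\sup\emptyset=-\infty$. *)

(* Defs.v *)
From HB Require Import structures.
From mathcomp Require Import all_boot all_order all_algebra.
From mathcomp Require Import all_classical all_reals all_analysis.
From mathcomp.real_closed Require Import complex.

Set Implicit Arguments.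
Unset Strict Implicit.
Unset Printing Implicit Defensive.

Import Order.TTheory GRing.Theory Num.Theory.
Import numFieldNormedType.Exports.

Local Open Scope classical_set_scope.
Local Open Scope ring_scope.
Local Open Scope quotient_scope.

Definition pointed_group (G : topologicalZmodType) : Type := G.

HB.instance Definition _ (G : topologicalZmodType) :=
  Choice.copy (pointed_group G) G.
HB.instance Definition _ (G : topologicalZmodType) :=
  isPointed.Build (pointed_group G) (0 : G).

Definition borel (G : topologicalZmodType) : Type :=
  g_sigma_algebraType (@open G : set (set (pointed_group G))).

HB.instance Definition _ (G : topologicalZmodType) := Measurable.copy (borel G)
  (g_sigma_algebraType (@open G : set (set (pointed_group G)))).

Section Subgroups.
Context {G : topologicalZmodType}.
Implicit Types (H K L : set G).

Definition subgroup H := H 0 /\ forall x y, H x -> H y -> H (x - y).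

Definition compactly_generated H :=
  exists2 K, compact K & H = smallest subgroup K.

Definition boundary (A : set G) := closure A `\` interior A.

(* The quotient group is any quotient type of G whose fibres are the cosets
   of L; since H is saturated for L, the image of H carries the topology of
   H / L when H is open. *)
Definition cocompact_in H L :=
  exists Q : quotType G,
    (forall x y : G, \pi_Q x = \pi_Q y <-> L (x - y)) /\
    compact ([set \pi_Q x | x in H] : set (quotient_topology Q)).

Definition free_abelian_rank (d : nat) L :=
  exists e : {additive 'rV[int]_d -> G}, injective e /\ range e = L.

End Subgroups.

Section Measures.
Context {R : realType} {G : topologicalZmodType}.

Local Notation bmeasure := {measure set (borel G) -> \bar R}.

(* Positive Radon measures, with the regularity that makes the
   correspondence with positive functionals on C_c(G) bijective even when G
   is not sigma-compact. *)
Definition radon_borel (m : bmeasure) :=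
  [/\ forall K : set G, compact K -> (m K < +oo)%E,
      forall A : set (borel G), measurable A ->
        m A = ereal_inf [set m (U : set (borel G)) | U in
                 [set U : set G | open U /\ A `<=` U]] &
      forall U : set G, open U ->
        m U = ereal_sup [set m (K : set (borel G)) | K in
                 [set K : set G | compact K /\ K `<=` U]]].

Definition haar_measure (m : bmeasure) :=
  [/\ radon_borel m,
      forall (x : G) (A : set (borel G)), measurable A ->
        m [set (x + a : G) | a in A] = m A &
      m setT <> 0%E].

Definition tsupp (V : nmodType) (f : G -> V) : set G :=
  closure [set x | f x != 0].

Definition compactly_supported (V : nmodType) (f : G -> V) :=
  compact (tsupp f).

Definition in_Cc (f : G -> R) : Prop :=
  continuous f /\ compactly_supported f.

Definition in_CcC (u : G -> R[i]) : Prop :=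
  continuous (u : G -> R[i]^o) /\ compactly_supported u.

Definition Cc_pred : {pred G -> R} := fun f => `[< in_Cc f >].

Lemma Cc_submod_closed : submod_closed Cc_pred.
Proof.
split=> [|a f g /asboolP[cf sf] /asboolP[cg sg]]; apply/asboolP.
  split; first exact: cst_continuous.
  rewrite /compactly_supported /tsupp (_ : [set _ | _] = set0).
    by rewrite closure0; exact: compact0.
  by rewrite -subset0 => x /=; rewrite eqxx.
split.
  move=> x; apply: continuousD; last exact: cg.
  by apply: continuousM; [exact: cst_continuous|exact: cf].
apply: (@subclosed_compact _ _ (tsupp f `|` tsupp g)).
- exact: closed_closure.
- exact: compactU.
rewrite -closureU; apply: closureS => x /= fgx.
have [fx0|fx0] := eqVneq (f x) 0; last by left.
right; apply: contra_neq fgx => gx0.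
by rewrite /GRing.add /= /GRing.scale /= fx0 gx0 scaler0 addr0.
Qed.

HB.instance Definition _ :=
  GRing.isSubmodClosed.Build R (G -> R) Cc_pred Cc_submod_closed.

Record Cc := MkCc { Cc_fun :> G -> R ; Cc_funP : Cc_fun \in Cc_pred }.

HB.instance Definition _ := [isSub for Cc_fun].
HB.instance Definition _ := [Choice of Cc by <:].
HB.instance Definition _ := [SubChoice_isSubLmodule of Cc by <:].

(* For a linear functional, continuity for the inductive limit topology of
   C_c(G) means continuity for the sup norm on each space of functions
   supported in a fixed compact set. *)
Definition radon (psi : Cc -> R) :=
  linear psi /\
  forall K : set G, compact K -> exists C : R,
    forall (f : Cc) (e : R), tsupp f `<=` K ->
      (forall x, `|f x| <= e) -> `|psi f| <= C * e.

Definition represents (m : bmeasure * bmeasure) (psi : Cc -> R) :=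
  [/\ radon_borel m.1, radon_borel m.2 &
      forall f : Cc, psi f =
        \int[m.1]_x f (x : borel G) - \int[m.2]_x f (x : borel G)].

Definition is_jordan (m : bmeasure * bmeasure) (psi : Cc -> R) :=
  represents m psi /\
  forall m', represents m' psi ->
    forall A : set (borel G), measurable A ->
      (m.1 A <= m'.1 A)%E /\ (m.2 A <= m'.2 A)%E.

(* The pair (psi+, psi-), which exists and is unique for every psi in the
   dual of C_c(G); the default value is irrelevant. *)
Definition jordan (psi : Cc -> R) : bmeasure * bmeasure :=
  match pselect (exists m, is_jordan m psi) with
  | left h => projT1 (cid h)
  | right _ => (mzero : bmeasure, mzero : bmeasure)
  end.

Definition pos_part psi : bmeasure := (jordan psi).1.
Definition neg_part psi : bmeasure := (jordan psi).2.

Definition total_variation (psi : Cc -> R) (A : set G) : \bar R :=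
  (pos_part psi A + neg_part psi A)%E.

Definition translation_bounded (psi : Cc -> R) :=
  exists K : set G, [/\ compact K, nbhs (0 : G) K &
    (ereal_sup [set total_variation psi [set (k + x)%R | k in K] | x in [set: G]]
       < +oo)%E].

Definition tb_measures : set (Cc -> R) :=
  [set psi | radon psi /\ translation_bounded psi].

Definition pairing (f : G -> R) (psi : Cc -> R) : R :=
  \int[pos_part psi]_x f (x : borel G) - \int[neg_part psi]_x f (x : borel G).

Definition cpairing (f : G -> R[i]) (psi : Cc -> R) : R[i] :=
  Complex (pairing (fun x => complex.Re (f x)) psi)
          (pairing (fun x => complex.Im (f x)) psi).

Definition nonneg_measure (psi : Cc -> R) :=
  forall f : Cc, (forall x, 0 <= f x) -> 0 <= psi f.

Definition measure_supp (psi : Cc -> R) : set G :=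
  [set x | forall U : set G, open U -> U x -> (0 < total_variation psi U)%E].

Definition even_measure (psi : Cc -> R) :=
  forall f : Cc, pairing (fun x => f (- x)) psi = pairing f psi.

Definition convolution (haar : bmeasure) (u v : G -> R[i]) (x : G) : R[i] :=
  Complex (\int[haar]_(y in [set: borel G]) complex.Re (u y * v (x - (y : G))))
          (\int[haar]_(y in [set: borel G]) complex.Im (u y * v (x - (y : G)))).

Definition tilde (u : G -> R[i]) (x : G) : R[i] := conjc (u (- x)).

Definition positive_type (haar : bmeasure) (psi : Cc -> R) :=
  forall u : G -> R[i], in_CcC u -> 0 <= cpairing (convolution haar u (tilde u)) psi.

Definition positive_definite (f : G -> R[i]) :=
  forall (n : nat) (c : 'I_n -> R[i]) (x : 'I_n -> G),
    0 <= \sum_(k < n) \sum_(l < n) c k * conjc (c l) * f (x k - x l).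

Definition rpositive_definite (f : G -> R) :=
  positive_definite (fun x => real_complex R (f x)).

(* The auxiliary choices entering the norm of C^{infty,1}(G; R). *)
Definition tiling_data (haar : bmeasure) (G0 Lambda L B : set G) :=
  [/\ [/\ subgroup G0, open G0, closed G0 & compactly_generated G0],
      forall g, exists! m, Lambda m /\ G0 (g - m),
      [/\ subgroup L, L `<=` G0, isolated L = L,
          exists d, free_abelian_rank d L & cocompact_in G0 L],
      [/\ B `<=` G0, measurable (B : set (borel G)), precompact B,
          closure B = [set - b | b in closure B] & haar (boundary B) = 0%E] &
      forall g, G0 g -> exists! p : G * G,
        [/\ L p.1, B p.2 & g = p.1 + p.2]].

Definition norm_inf1 (Lambda L B : set G) (f : G -> R) : \bar R :=
  \esum_(p in L `*` Lambda)
    ereal_sup [set `|f (p.2 + p.1 + b)|%:E | b in B].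

Definition C_inf1 (Lambda L B : set G) : set (G -> R) :=
  [set f | continuous f /\ (norm_inf1 Lambda L B f < +oo)%E].

Section Problems.
Variables (haar : bmeasure) (Lambda L B : set G).

Definition strictly_positive_definite (sigma : Cc -> R) :=
  [/\ tb_measures sigma, positive_type haar sigma &
      forall f, C_inf1 Lambda L B f -> rpositive_definite f ->
        (exists x, f x != 0) -> 0 < pairing f sigma].

Definition admissible_cone (Omega : set G) : set (G -> R) :=
  [set f | [/\ C_inf1 Lambda L B f, rpositive_definite f &
               forall x, ~ Omega x -> f x <= 0]].

Definition calF (sigma : Cc -> R) (Omega : set G) : set (G -> R) :=
  admissible_cone Omega `&` [set f | pairing f sigma = 1].

Definition calM (Theta : set G) : set (Cc -> R) :=
  [set mu | tb_measures mu /\ exists nu kappa : Cc -> R,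
     [/\ tb_measures nu, tb_measures kappa & mu = nu - kappa] /\
     [/\ nonneg_measure kappa, measure_supp kappa `<=` closure Theta &
         positive_type haar nu]].

Definition alpha (rho sigma : Cc -> R) (Omega : set G) : \bar R :=
  ereal_inf [set (pairing f rho)%:E | f in calF sigma Omega].

(* The supports in calM lie in the closure, so this is the value at the closure
   of the complement of Omega. *)
Definition omega (rho sigma : Cc -> R) (Omega : set G) : \bar R :=
  ereal_sup [set s%:E | s in
    [set s : R | calM (~` Omega) (rho - (fun f => s * sigma f))]].

(* Constraints of the dual of the conic linear program
     minimise <f, rho> over f in C subject to <f, sigma> = 1,
   which is: maximise s subject to rho - s sigma in the dual cone of C. *)
Definition dual_cone (C : set (G -> R)) : set (Cc -> R) :=
  [set mu | tb_measures mu /\ forall f, C f -> 0 <= pairing f mu].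

Definition lp_dual_feasible (C : set (G -> R)) (rho sigma : Cc -> R) : set R :=
  [set s | dual_cone C (rho - (fun f => s * sigma f))].

End Problems.

End Measures.

Arguments Cc : clear implicits.

(* Main.v *)
(* Since <f, sigma> > 0 for every nonzero positive definite f in X, scaling
   reduces the absence of a gap to: an even mu in M(G) is nonnegative on the
   admissible cone if and only if mu = nu - kappa with nu of positive type,
   kappa >= 0 and supp kappa contained in the closure of the complement of
   Omega.

   Only if: for f in C_c(G) let p(f) be the infimum of mu(g) over the g in
   C_c(G) with g <= 0 off Omega and g - f_sym positive definite, where f_sym is
   the even part of f. The infimum is finite because f_sym is dominated off
   Omega by sums of functions h_a + h_(-a) - 2 h, whose negatives are positive
   definite when h is a positive definite bump. A linear functional nu <= p is
   nonnegative on positive definite functions, and nu <= mu on functions that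
   are nonpositive off Omega, so that kappa = nu - mu has the required
   properties; kappa is translation bounded by the same functions h_a.

   If: it suffices that a measure nu in M(G) of positive type is nonnegative on
   every positive definite f in X. By amenability f is the limit in X of
   f . (v * v~) / (v * v~)(0), and each f . (v * v~) is, by the Schur product
   theorem, a limit of functions u on which nu is nonnegative. *)

Require Import Defs.
From HB Require Import structures.
From mathcomp Require Import all_boot all_order all_algebra.
From mathcomp Require Import all_classical all_reals all_analysis.
From mathcomp.real_closed Require Import complex.
From mathcomp Require Import measurable_realfun.
From mathcomp Require Import zify lra ring.

Set Implicit Arguments.
Unset Strict Implicit.
Unset Printing Implicit Defensive.

Import Order.TTheory GRing.Theory Num.Theory.
Import numFieldNormedType.Exports.

Local Open Scope classical_set_scope.
Local Open Scope ring_scope.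

(** The pairing of f in X with a measure integrates against the two Jordan parts, and the parts of a
    difference of measures are not the differences of the parts, so even linearity of [pairing] in
    the measure needs an argument. The measures are therefore handled as functionals on C_c(G):
    translation boundedness becomes an estimate on functions supported in translates of a compact
    set, and [pairing f psi] is the limit of the values of psi at f times cutoffs governed by
    compact sets that depend on f alone. G need not be sigma-compact, but a function of finite norm
    vanishes off countably many tiles, so sequences of cutoffs suffice.

    The even part in the functional p makes p nonpositive at odd functions, hence nu even. Positive
    type against complex u demands this, as the imaginary part of the pairing of nu with u * u~ has
    to vanish; evenness of mu then gives the comparison of nu with mu. Bochner's theorem and the
    Fourier transform do not enter. *)

Class LCA (G : topologicalZmodType) : Prop := MkLCA {
  LCA_hausdorff : hausdorff_space G ;
  LCA_locally_compact : locally_compact [set: G] }.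

Lemma compact_finite_cover (T : topologicalType) (K : set T) (U : T -> set T) :
  compact K -> (forall x, K x -> nbhs x (U x)) ->
  exists s : seq T, (forall x, x \in s -> K x) /\
    forall y, K y -> exists2 x, x \in s & U x y.
Proof.
move=> cK KU; have [[x0 Kx0]|K0] := pselect (exists x, K x); last first.
  by exists [::]; split=> // y Ky; exfalso; apply: K0; exists y.
(* [compact_cover] concerns pointed spaces; a point of K becomes the base point, hence the separate
   treatment of empty K. *)
pose PT : ptopologicalType := HB.pack T (isPointed.Build T x0).
have cK' : @compact PT K by [].
move: cK'; rewrite compact_cover => /(_ T K (fun x => interior (U x))) [].
- by move=> i _; exact: open_interior.
- by move=> x Kx; exists x => //; exact: KU.
move=> D DK KD; exists (finmap.enum_fset D); split.
  by move=> x xD; have := DK x xD; rewrite inE.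
by move=> y /KD[x xD /interior_subset Uxy]; exists x.
Qed.

(** * Translations and compact neighbourhoods in a topological group *)

Section Topology.
Context {G : topologicalZmodType}.
Implicit Types (x y : G) (A K U : set G).

Lemma addl_continuous x : continuous (fun y : G => x + y).
Proof.
move=> y; apply: (@continuous_comp _ _ _ (fun y => (x, y))
  (fun z : G * G => z.1 + z.2)); last exact: add_continuous.
by apply: cvg_pair; [exact: cvg_cst|exact: cvg_id].
Qed.

Lemma addr_continuous x : continuous (fun y : G => y + x).
Proof.
by under eq_fun do rewrite addrC; exact: addl_continuous.
Qed.

Lemma subl_continuous x : continuous (fun y : G => x - y).
Proof.
by move=> y; apply: continuous_comp; [exact: opp_continuous|
  exact: addl_continuous].
Qed.

Lemma nbhs0_opp A : nbhs (0 : G) A -> nbhs (0 : G) [set u | A (- u)].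
Proof. by rewrite -{1}oppr0; exact: opp_continuous. Qed.

Lemma nbhs0_add A : nbhs (0 : G) A -> exists2 V : set G, nbhs (0 : G) V &
  forall u v, V u -> V v -> A (u + v).
Proof.
rewrite -{1}(addr0 0) => /(@add_continuous G (0, 0))[[V W] /= [V0 W0] VW].
exists (V `&` W); first exact: filterI.
by move=> u v [Vu _] [_ Wv]; apply: (VW (u, v)).
Qed.

Lemma nbhs0_sub A : nbhs (0 : G) A -> exists2 V : set G, nbhs (0 : G) V &
  forall u v, V u -> V v -> A (u - v).
Proof.
move=> /nbhs0_add[V V0 VA]; exists (V `&` [set u | V (- u)]).
  by apply: filterI => //; exact: nbhs0_opp.
by move=> u v [Vu _] [_ Vv]; exact: VA.
Qed.

Lemma compact_opp K : compact K -> compact [set - x | x in K].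
Proof.
move=> cK; apply: continuous_compact => //.
by apply: continuous_subspaceT; exact: opp_continuous.
Qed.

Lemma compact_addl x K : compact K -> compact [set x + y | y in K].
Proof.
move=> cK; apply: continuous_compact => //.
by apply: continuous_subspaceT; exact: addl_continuous.
Qed.

Lemma compact_addr x K : compact K -> compact [set y + x | y in K].
Proof.
move=> cK; apply: continuous_compact => //.
by apply: continuous_subspaceT; exact: addr_continuous.
Qed.

Lemma compact_add K A : compact K -> compact A ->
  compact [set z.1 + z.2 | z in K `*` A].
Proof.
move=> cK cA; apply: continuous_compact; last exact: compact_setX.
by apply: continuous_subspaceT; exact: add_continuous.
Qed.

Context {lcaG : LCA G}.

Lemma compact_closedG K : compact K -> closed K.
Proof. exact: compact_closed LCA_hausdorff. Qed.

(** A compact neighbourhood makes the Hausdorff space regular at x; a closed neighbourhood inside U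
    is then intersected with it. *)
Lemma compact_nbhs x U : nbhs x U ->
  exists K, [/\ compact K, nbhs x K & K `<=` U].
Proof.
move=> xU; have [C] := LCA_locally_compact I (x := x).
rewrite withinET => xC [cC clC].
have rx : {for x, regular_space G}.
  by apply: (compact_regular _ cC) => //; exact: LCA_hausdorff.
have [V xV VU] := rx U xU.
exists (closure V `&` C); split.
- by apply: (subclosed_compact _ cC) => //; apply: closedI => //;
    exact: closed_closure.
- by apply: filterI => //; apply: filterS xV; exact: subset_closure.
- by move=> y [/VU].
Qed.

End Topology.

(** * Urysohn functions with compact support and uniform continuity *)

Section Urysohn.
Context {R : realType} {G : topologicalZmodType} {lcaG : LCA G}.
Implicit Types (K U : set G) (f g : G -> R).

Lemma in_CcP f : in_Cc f <->
  continuous f /\ exists2 K, compact K & forall x, ~ K x -> f x = 0.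
Proof.
split=> [[cf sf]|[cf [K cK fK]]].
  split=> //; exists (tsupp f) => // x Kx; apply/eqP/negPn/negP => fx0.
  by apply: Kx; exact: subset_closure.
split=> //; apply: (subclosed_compact _ cK); first exact: closed_closure.
rewrite [K](closure_id K).1; last exact: compact_closedG.
by apply: closureS => x /=; apply: contra_neqP => /fK.
Qed.

Lemma tsupp_sub f K : compact K -> (forall x, ~ K x -> f x = 0) ->
  tsupp f `<=` K.
Proof.
move=> cK fK; rewrite [K](closure_id K).1; last exact: compact_closedG.
by apply: closureS => x /=; apply: contra_neqP => /fK.
Qed.

Lemma tsupp0 f x : ~ tsupp f x -> f x = 0.
Proof.
move=> fx; apply/eqP/negPn/negP => fx0; apply: fx.
exact: subset_closure.
Qed.

(** Finitely many bumps from complete regularity sum to more than 1/2 on an open set around K;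
    doubling and truncating at 1 gives the value 1 on that whole set. The open margin [W] is what
    keeps supports compact when a function is split by multiplication with f and 1 - f. *)
Lemma urysohn_Cc K U : compact K -> open U -> K `<=` U ->
  exists f, [/\ in_Cc f, forall x, 0 <= f x <= 1,
    exists2 W, open W & K `<=` W /\ forall x, W x -> f x = 1 &
    exists K', [/\ compact K', K' `<=` U & forall x, ~ K' x -> f x = 0]].
Proof.
move=> cK oU KU.
have loc (x : G) : exists p : set G * (G -> R), K x ->
    [/\ compact p.1, p.1 `<=` U, continuous p.2,
      forall y, 0 <= p.2 y <= 1 & p.2 x = 1] /\ forall y, ~ p.1 y -> p.2 y = 0.
  have [Kx|] := pselect (K x); last by exists (set0, cst 0).
  have xU : nbhs x U by rewrite nbhsE; exists U => //; split=> //; exact: KU.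
  have [C [cC xC CU]] := compact_nbhs xU.
  have /(@uniform_separatorP _ R)[f [cf f01 f0 f1]] :
      uniform_separator [set x] (~` interior C).
    apply: (@locally_compact_completely_regular G R LCA_locally_compact
      LCA_hausdorff); first exact/open_closedC/open_interior.
    by move/(_ xC).
  exists (C, fun y => 1 - f y) => _; split.
    split=> //=.
    - move=> y; apply: continuousB; [exact: cvg_cst|exact: cf].
    - move=> y; have /f01 /= : range f (f y) by exists y.
      by rewrite in_itv /= => /andP[a b]; apply/andP; split; lra.
    - have /f0 /= -> : (f @` [set x]) (f x) by exists x.
      by rewrite subr0.
  move=> y /= Cy; have /f1 /= -> : (f @` (~` interior C)) (f y).
    by exists y => // /interior_subset.
  by rewrite subrr.
have [p pP] := choice loc.
have [|s [sK Ks]] := @compact_finite_cover G K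
    (fun x => [set y | 1/2 < (p x).2 y]) cK.
  move=> x Kx; have [[_ _ cp _ px] _] := pP _ Kx.
  apply: (cp x [set r | 1/2 < r]); rewrite px.
   by apply: open_nbhs_nbhs; split => /=; [exact: open_gt|lra].
pose h y : R := \sum_(x <- s) (p x).2 y.
have h0 y : 0 <= h y.
  by rewrite /h big_seq; apply: sumr_ge0 => x /sK/pP[[_ _ _ /(_ y)/andP[]]].
have ch : continuous h.
  rewrite /h; elim: s sK {Ks h h0} => [|a s IH] sK.
    by under eq_fun do rewrite big_nil; exact: cst_continuous.
  under eq_fun do rewrite big_cons.
  move=> y; apply: continuousD.
    have /pP[[_ _ cp _ _] _] := sK a (mem_head _ _); exact: cp.
  by apply: IH => x xs; apply: sK; rewrite inE xs orbT.
have cf : continuous (fun y => Num.min 1 (2 * h y)).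
  move=> y; apply: (@continuous_min R G (cst 1) (fun y => 2 * h y));
    first exact: cvg_cst.
  by apply: continuousM; [exact: cvg_cst|exact: ch].
pose K' := \big[setU/set0]_(x <- s) (p x).1.
have cK' : compact K'.
  rewrite /K' big_seq; apply: bigsetU_compact => x.
  by move=> /sK/pP[[]].
have fK' y : ~ K' y -> Num.min 1 (2 * h y) = 0.
  move=> K'y; suff -> : h y = 0 by rewrite mulr0 /Num.min ltNge ler01.
  rewrite /h big_seq big1 // => x xs; have [_] := pP _ (sK _ xs); apply.
  by move=> px; apply: K'y; rewrite /K' (big_rem x) //=; left.
exists (fun y => Num.min 1 (2 * h y)); split.
- by apply/in_CcP; split=> //; exists K'.
- move=> y; rewrite le_min ler01 /= ge_min lexx /= andbT.
  by rewrite mulr_ge0.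
- exists [set y | 1/2 < h y].
    have -> : [set y | 1/2 < h y] = h @^-1` [set r | 1/2 < r] by [].
    apply: open_comp; last exact: open_gt.
    by move=> ? _; exact: ch.
  split=> [y Ky /=|y /= hy]; last by apply/min_idPl; lra.
  have [x xs /=] := Ks _ Ky; move/lt_le_trans; apply.
  rewrite /h (big_rem x) //= lerDl big_seq; apply: sumr_ge0 => z /mem_rem.
  by move=> /sK/pP[[_ _ _ /(_ y)/andP[]]].
- exists K'; split=> // y; rewrite /K' big_seq; elim/big_ind: _ => //.
    by move=> A B HA HB [].
  by move=> x /sK/pP[[_ + _ _ _] _]; apply.
Qed.

(** Compactness of K settles the case x in K and, with x + u and -u in place of x and u, the case x
    + u in K; otherwise both values vanish. *)
Lemma unif_cont f (e : R) : in_Cc f -> 0 < e ->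
  \forall u \near (0 : G), forall x, `|f (x + u) - f x| < e.
Proof.
move=> /in_CcP[cf [K cK fK]] e0.
have key (h : G -> G) : continuous h -> h 0 = 0 ->
    \forall u \near (0 : G), K `<=` [set x | `|f (x + h u) - f x| < e].
  move=> ch h0; move/compact_near_coveringP : cK; apply => x Kx.
  have : {for (x, 0 : G), continuous (fun z : G * G => `|f (z.1 + h z.2) - f z.1|)}.
    apply: continuous_comp; last exact: norm_continuous.
    apply: continuousB; last first.
      by apply: continuous_comp; [exact: cvg_fst|exact: cf].
    apply: (@continuous_comp _ _ _ (fun z : G * G => z.1 + h z.2) f); last exact: cf.
    apply: (@continuous_comp _ _ _ (fun z : G * G => (z.1, h z.2))
      (fun z : G * G => z.1 + z.2)); last exact: add_continuous.
    apply: cvg_pair; first exact: cvg_fst.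
    by apply: continuous_comp; [exact: cvg_snd|exact: ch].
  move=> /(_ [set r | r < e]) /=; rewrite /= h0 addr0 subrr normr0.
  by apply; apply: open_nbhs_nbhs; split=> //; exact: open_lt.
have cid : continuous (@id G) by move=> x; exact: cvg_id.
have k1 := key id cid erefl.
have k2 := key -%R (@opp_continuous G) (oppr0 G).
near=> u => x; have [Kx|Kx] := pselect (K x).
  by move: x Kx; near: u; exact: k1.
have [Kxu|Kxu] := pselect (K (x + u)).
  rewrite distrC -{1}(addrK u x); move: {x Kx} (x + u) Kxu.
  by near: u; exact: k2.
by rewrite !fK // subrr normr0.
Unshelve. all: by end_near. Qed.

End Urysohn.

(** * The function space C_c(G) and linear functionals on it *)

Section CcAlgebra.
Context {R : realType} {G : topologicalZmodType} {lcaG : LCA G}.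
Implicit Types (f g : G -> R) (psi : Cc R G -> R).

Lemma in_Cc0 : in_Cc (fun _ : G => 0 : R).
Proof.
apply/in_CcP; split; first exact: cst_continuous.
by exists set0 => //; exact: compact0.
Qed.

Lemma in_CcD f g : in_Cc f -> in_Cc g -> in_Cc (fun x => f x + g x).
Proof.
move=> /in_CcP[cf [K cK fK]] /in_CcP[cg [L cL gL]]; apply/in_CcP; split.
  by move=> x; apply: continuousD; [exact: cf|exact: cg].
exists (K `|` L); first exact: compactU.
by move=> x /not_orP[Kx Lx]; rewrite fK // gL // addr0.
Qed.

Lemma in_CcM f g : continuous f -> in_Cc g -> in_Cc (fun x => f x * g x).
Proof.
move=> cf /in_CcP[cg [K cK gK]]; apply/in_CcP; split.
  by move=> x; apply: continuousM; [exact: cf|exact: cg].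
by exists K => // x Kx; rewrite gK // mulr0.
Qed.

Lemma in_CcMr f g : in_Cc f -> continuous g -> in_Cc (fun x => f x * g x).
Proof.
by move=> Cf cg; under eq_fun do rewrite mulrC; exact: in_CcM.
Qed.

Lemma in_CcZ (a : R) f : in_Cc f -> in_Cc (fun x => a * f x).
Proof. by apply: in_CcM; exact: cst_continuous. Qed.

Lemma in_CcN f : in_Cc f -> in_Cc (fun x => - f x).
Proof.
by move=> /(in_CcZ (-1)); under eq_fun do rewrite mulN1r.
Qed.

Lemma in_CcB f g : in_Cc f -> in_Cc g -> in_Cc (fun x => f x - g x).
Proof. by move=> Cf /in_CcN; exact: in_CcD. Qed.

Lemma in_Cc_sum (I : Type) (s : seq I) (F : I -> G -> R) :
  (forall i, in_Cc (F i)) -> in_Cc (fun x => \sum_(i <- s) F i x).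
Proof.
move=> CF; elim: s => [|i s IH].
  by under eq_fun do rewrite big_nil; exact: in_Cc0.
by under eq_fun do rewrite big_cons; exact: in_CcD.
Qed.

Lemma in_Cc_max f g : in_Cc f -> in_Cc g -> in_Cc (fun x => Num.max (f x) (g x)).
Proof.
move=> /in_CcP[cf [K cK fK]] /in_CcP[cg [L cL gL]]; apply/in_CcP; split.
  by move=> x; apply: (@continuous_max R G f g); [exact: cf|exact: cg].
exists (K `|` L); first exact: compactU.
by move=> x /not_orP[Kx Lx]; rewrite fK // gL // maxxx.
Qed.

Lemma in_Cc_min f g : in_Cc f -> in_Cc g -> in_Cc (fun x => Num.min (f x) (g x)).
Proof.
move=> /in_CcP[cf [K cK fK]] /in_CcP[cg [L cL gL]]; apply/in_CcP; split.
  by move=> x; apply: (@continuous_min R G f g); [exact: cf|exact: cg].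
exists (K `|` L); first exact: compactU.
by move=> x /not_orP[Kx Lx]; rewrite fK // gL // minxx.
Qed.

Lemma in_Cc_norm f : in_Cc f -> in_Cc (fun x => `|f x|).
Proof.
move=> /in_CcP[cf [K cK fK]]; apply/in_CcP; split.
  by move=> x; apply: continuous_comp; [exact: cf|exact: norm_continuous].
by exists K => // x Kx; rewrite fK // normr0.
Qed.

Lemma in_Cc_shift f a : in_Cc f -> in_Cc (fun x => f (x + a)).
Proof.
move=> /in_CcP[cf [K cK fK]]; apply/in_CcP; split.
  by move=> x; apply: continuous_comp; [exact: addr_continuous|exact: cf].
exists [set y - a | y in K]; first exact: compact_addr.
by move=> x Kx; apply: fK => Kxa; apply: Kx; exists (x + a) => //; rewrite addrK.
Qed.

Lemma in_Cc_opp f : in_Cc f -> in_Cc (fun x => f (- x)).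
Proof.
move=> /in_CcP[cf [K cK fK]]; apply/in_CcP; split.
  by move=> x; apply: continuous_comp; [exact: opp_continuous|exact: cf].
exists [set - y | y in K]; first exact: compact_opp.
by move=> x Kx; apply: fK => Kxa; apply: Kx; exists (- x) => //; rewrite opprK.
Qed.

Lemma in_Cc_bounded f : in_Cc f -> exists2 M, 0 < M & forall x, `|f x| <= M.
Proof.
move=> /in_CcP[cf [K cK fK]].
have /compact_bounded[M [_ HM]] : compact [set f x | x in K].
  by apply: continuous_compact => //; exact: continuous_subspaceT.
exists (`|M| + 1); first by rewrite ltr_pwDr.
move=> x; have [Kx|Kx] := pselect (K x); last first.
  by rewrite fK // normr0 addr_ge0.
apply: HM; last by exists x.
by rewrite ltr_pwDr // ler_norm.
Qed.

Lemma CcP (f : Cc R G) : in_Cc f.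
Proof. exact/asboolP/Cc_funP. Qed.

Definition toCc f : Cc R G :=
  if pselect (f \in @Cc_pred R G) is left h then MkCc h else 0.

Lemma toCcE f : in_Cc f -> toCc f = f :> (G -> R).
Proof. by move=> /asboolP Cf; rewrite /toCc; case: pselect. Qed.

Lemma toCcK (f : Cc R G) : toCc f = f.
Proof. by apply/val_inj/toCcE/CcP. Qed.

(* Junk value psi 0 at functions outside C_c(G). *)
Definition ev psi f := psi (toCc f).

Lemma evE psi (f : Cc R G) : ev psi f = psi f.
Proof. by rewrite /ev toCcK. Qed.

Section Linear.
Context {psi : Cc R G -> R} (lpsi : linear psi).

Lemma evD f g : in_Cc f -> in_Cc g ->
  ev psi (fun x => f x + g x) = ev psi f + ev psi g.
Proof.
move=> Cf Cg; have := lpsi 1 (toCc f) (toCc g).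
rewrite [in RHS]/GRing.scale /= mul1r => <-; congr psi; apply: val_inj.
rewrite [LHS]toCcE; last exact: in_CcD.
by apply/funext => x; rewrite /= scale1r -[RHS]/(toCc f x + toCc g x) !toCcE.
Qed.

Lemma ev0 : ev psi (fun=> 0) = 0.
Proof.
have := evD in_Cc0 in_Cc0; under eq_fun do rewrite addr0.
by move=> h; lra.
Qed.

Lemma evZ (a : R) f : in_Cc f -> ev psi (fun x => a * f x) = a * ev psi f.
Proof.
move=> Cf; have := lpsi a (toCc f) (toCc (fun=> 0)).
rewrite [in RHS]/GRing.scale /= -!/(ev _ _) ev0 !addr0 => <-; congr psi; apply: val_inj.
rewrite [LHS]toCcE; last exact: in_CcZ.
apply/funext => x; rewrite /= -[RHS]/(a * toCc f x + toCc (fun=> 0) x).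
by rewrite !toCcE ?addr0 //; exact: in_Cc0.
Qed.

Lemma evN f : in_Cc f -> ev psi (fun x => - f x) = - ev psi f.
Proof.
by move=> Cf; rewrite -mulN1r -evZ //; under [in RHS]eq_fun do rewrite mulN1r.
Qed.

Lemma evB f g : in_Cc f -> in_Cc g ->
  ev psi (fun x => f x - g x) = ev psi f - ev psi g.
Proof. by move=> Cf Cg; rewrite evD ?evN //; exact: in_CcN. Qed.

Lemma ev_sum (I : Type) (s : seq I) (F : I -> G -> R) :
  (forall i, in_Cc (F i)) ->
  ev psi (fun x => \sum_(i <- s) F i x) = \sum_(i <- s) ev psi (F i).
Proof.
move=> CF; elim: s => [|i s IH].
  by rewrite big_nil; under eq_fun do rewrite big_nil; exact: ev0.
rewrite big_cons -IH -evD //; last exact: in_Cc_sum.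
by under eq_fun do rewrite big_cons.
Qed.

Lemma ev_ge0 f : nonneg_measure psi -> in_Cc f -> (forall x, 0 <= f x) ->
  0 <= ev psi f.
Proof. by move=> ppsi Cf f0; apply: ppsi => x; rewrite toCcE. Qed.

Lemma ev_le f g : nonneg_measure psi -> in_Cc f -> in_Cc g ->
  (forall x, f x <= g x) -> ev psi f <= ev psi g.
Proof.
move=> ppsi Cf Cg fg; rewrite -subr_ge0 -evB //.
by apply: ev_ge0 => //; [exact: in_CcB|move=> x; rewrite subr_ge0].
Qed.

End Linear.
End CcAlgebra.

Lemma ereal_sup_addr_le (R : realType) (T : Type) (P : set T) (F : T -> R)
    (c d : \bar R) : P !=set0 -> (0 <= c)%E ->
  (forall x, P x -> ((F x)%:E + c <= d)%E) ->
  (ereal_sup [set (F x)%:E | x in P] + c <= d)%E.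
Proof.
move=> [x0 Px0] c0 H; have [cfin|] := boolP (c \is a fin_num).
  rewrite -leeBrDr //; apply: ge_ereal_sup => _ [x Px <-].
  by rewrite leeBrDr //; exact: H.
rewrite fin_numE; case: c c0 H => [r||] // _ /(_ _ Px0) /= + _.
by rewrite leye_eq => /eqP ->; rewrite leey.
Qed.

(** * The outer measure of a positive functional *)

Section RieszContent.
Context {R : realType} {G : topologicalZmodType} {lcaG : LCA G}.
Implicit Types (f g : G -> R) (K U V A : set G).

Definition below U f := [/\ in_Cc f, forall x, 0 <= f x <= 1 &
  exists K, [/\ compact K, K `<=` U & forall x, ~ K x -> f x = 0]].

Definition riesz_content (psi : Cc R G -> R) U : \bar R :=
  ereal_sup [set (ev psi f)%:E | f in below U].

Definition riesz_outer (psi : Cc R G -> R) A : \bar R :=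
  ereal_inf [set riesz_content psi U | U in [set U | open U /\ A `<=` U]].

Lemma below0 U : below U (fun=> 0).
Proof.
split; [exact: in_Cc0|by move=> x; rewrite lexx ler01|].
by exists set0; split=> //; exact: compact0.
Qed.

Context {psi : Cc R G -> R} (lpsi : linear psi) (ppsi : nonneg_measure psi).
Local Notation lam := (riesz_content psi).
Local Notation mus := (riesz_outer psi).

Lemma content_ub U f : below U f -> ((ev psi f)%:E <= lam U)%E.
Proof. by move=> Uf; apply: ereal_sup_ubound; exists f. Qed.

Lemma content_ge0 U : (0 <= lam U)%E.
Proof. by rewrite -[0%E]/(0%:E) -(ev0 lpsi); apply/content_ub/below0. Qed.

Lemma content_le U V : U `<=` V -> (lam U <= lam V)%E.
Proof.
move=> UV; apply: ge_ereal_sup => _ [f [Cf f01 [K [cK KU fK]]] <-].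
apply: content_ub; split=> //; exists K; split=> //; exact: subset_trans UV.
Qed.

Lemma content0 : lam set0 = 0%E.
Proof.
apply/eqP; rewrite eq_le content_ge0 andbT; apply: ge_ereal_sup.
move=> _ [f [Cf f01 [K [cK KU fK]]] <-].
suff -> : f = fun=> 0 by rewrite ev0.
by apply/funext => x; apply: fK => /KU.
Qed.

(** A Urysohn function h supported in U and equal to 1 near the part of the support of f outside V
    splits f into h f, below U, and (1 - h) f, below V. *)
Lemma contentU U V : open U -> open V -> (lam (U `|` V) <= lam U + lam V)%E.
Proof.
move=> oU oV; apply: ge_ereal_sup => _ [f [Cf f01 [K [cK KUV fK]]] <-].
have cKV : compact (K `\` V).
  by apply: (compact_closedI cK); exact: open_closedC.
have [|h [Ch h01 [W oW [KW hW]] [L [cL LU hL]]]] := urysohn_Cc (R := R) cKV oU.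
  by move=> x [/KUV[]].
have -> : f = fun x => h x * f x + (f x - h x * f x).
  by apply/funext => x; rewrite addrC subrK.
have Chf : in_Cc (fun x => h x * f x) by apply: in_CcM => //; case: Ch.
rewrite evD //; last exact: in_CcB.
rewrite EFinD; apply: leeD; apply: content_ub.
  split=> //.
    move=> x; have /andP[? ?] := f01 x; have /andP[? ?] := h01 x.
    by rewrite mulr_ge0 //= mulr_ile1.
  by exists L; split=> // x Lx; rewrite hL // mul0r.
split; first exact: in_CcB.
  move=> x; have /andP[? ?] := f01 x; have /andP[? ?] := h01 x.
  by apply/andP; split; nra.
exists (K `\` W); split.
- by apply: (compact_closedI cK); exact: open_closedC.
- by move=> x [Kx Wx]; apply: contrapT => Vx; apply: Wx; exact: KW.
- move=> x /not_andP[Kx|/contrapT Wx]; first by rewrite fK // mulr0 subr0.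
  by rewrite hW // mul1r subrr.
Qed.

Lemma content_bigcup (F : (set G)^nat) : (forall n, open (F n)) ->
  (lam (\bigcup_n F n) <= \sum_(n <oo) lam (F n))%E.
Proof.
move=> oF; apply: ge_ereal_sup => _ [f [Cf f01 [K [cK KF fK]]] <-].
have /choice[N HN] (x : G) : exists n, K x -> F n x.
  have [Kx|] := pselect (K x); last by exists 0%N.
  by have [n _ Fn] := KF _ Kx; exists n.
have [|s [_ Ks]] := @compact_finite_cover G K (fun x => F (N x)) cK.
  by move=> x Kx; apply: open_nbhs_nbhs; split => //; exact: HN.
pose m := \max_(x <- s) (N x).+1.
have open_lt_bigU n : open (\big[setU/set0]_(i < n) F i).
  by elim/big_ind: _ => //; [exact: open0|exact: openU].
apply: (@le_trans _ _ (lam (\big[setU/set0]_(i < m) F i))).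
  apply: content_ub; split=> //; exists K; split=> // y Ky.
  have [x xs Fy] := Ks _ Ky; rewrite -bigcup_mkord; exists (N x) => //=.
  exact: (leq_bigmax_seq _ xs).
apply: (@le_trans _ _ (\sum_(0 <= i < m) lam (F i))%E); last first.
  by apply: nneseries_lim_ge => *; exact: content_ge0.
rewrite big_mkord; elim: m => [|m IH]; first by rewrite !big_ord0 content0.
rewrite !big_ord_recr /=.
apply: le_trans (contentU (open_lt_bigU m) (oF m)) _.
exact: leeD.
Qed.

Lemma outer_ge0 A : (0 <= mus A)%E.
Proof. by apply: le_ereal_inf_tmp => _ [U _ <-]; exact: content_ge0. Qed.

Lemma outer_le A B : A `<=` B -> (mus A <= mus B)%E.
Proof.
move=> AB; apply: ereal_inf_le_tmp => _ [U [oU BU] <-].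
by exists U => //; split=> //; exact: subset_trans BU.
Qed.

Lemma outer_ub A U : open U -> A `<=` U -> (mus A <= lam U)%E.
Proof. by move=> oU AU; apply: ereal_inf_lbound; exists U. Qed.

Lemma outer_open U : open U -> mus U = lam U.
Proof.
move=> oU; apply/eqP; rewrite eq_le outer_ub //=.
by apply: le_ereal_inf_tmp => _ [V [oV UV] <-]; exact: content_le.
Qed.

Lemma outer0 : mus set0 = 0%E.
Proof. by rewrite outer_open ?content0 //; exact: open0. Qed.

Lemma outer_sigma_subadditive : sigma_subadditive mus.
Proof.
move=> F; apply/lee_addgt0Pr => e e0.
have [[n Fn]|Ffin] := pselect (exists n, mus (F n) = +oo%E).
  rewrite (@eseries_pinfty _ _ xpredT n) //; last first.
    by move=> k _; rewrite gt_eqF // (lt_le_trans _ (outer_ge0 _)) // ltNye.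
  by rewrite addye // leey.
have /choice[U HU] n : exists U, [/\ open U, F n `<=` U &
    (lam U <= mus (F n) + (e / (2 ^ n.+1)%:R)%:E)%E].
  have fn : mus (F n) \is a fin_num.
    rewrite ge0_fin_numE ?outer_ge0 // ltey; apply/eqP => Fn.
    by apply: Ffin; exists n.
  have [|_ [U [oU FU] <-] /ltW lU] := lb_ereal_inf_adherent (e := e / (2 ^ n.+1)%:R) _ fn.
    by rewrite divr_gt0 // ltr0n expn_gt0.
  by exists U.
apply: le_trans (epsilon_trick _ _ (ltW e0)); last by move=> n; exact: outer_ge0.
apply: (@le_trans _ _ (lam (\bigcup_n U n))).
  apply: outer_ub; first by apply: bigcup_open => n _; have [] := HU n.
  by move=> x [n _ Fx]; exists n => //; have [_ + _] := HU n; apply.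
apply: le_trans (content_bigcup _) _; first by move=> n; have [] := HU n.
apply: lee_nneseries => [n _ _|n _]; first exact: content_ge0.
by have [] := HU n.
Qed.

(** For f supported in a compact K inside both sets, U minus K is open and contains U minus V, and f
    + g stays below U for every g below U minus K. The supremum is taken over g, then over f. *)
Lemma content_outer_split U V : open U -> open V ->
  (lam (U `&` V) + mus (U `\` V) <= lam U)%E.
Proof.
move=> oU oV; apply: ereal_sup_addr_le; [|exact: outer_ge0|].
  by exists (fun=> 0); exact: below0.
move=> f [Cf f01 [K [cK KUV fK]]].
have oUK : open (U `\` K).
  by apply: openI => //; apply: closed_openC; exact: compact_closedG.
apply: (@le_trans _ _ ((ev psi f)%:E + lam (U `\` K))%E).
  rewrite leeD2l // outer_ub // => x [Ux Vx]; split=> // /KUV[].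
  by move=> _ /Vx.
rewrite addeC; apply: ereal_sup_addr_le.
- by exists (fun=> 0); exact: below0.
- by rewrite lee_fin; apply: ev_ge0 => // x; have /andP[] := f01 x.
move=> g [Cg g01 [L [cL LUK gL]]].
rewrite -EFinD -(evD lpsi) //; apply: content_ub; split.
- exact: in_CcD.
- move=> x; have [Kx|Kx] := pselect (K x).
    by rewrite gL ?add0r // => /LUK[_ /(_ Kx)].
  by rewrite fK ?addr0.
- exists (K `|` L); split; first exact: compactU.
    by move=> x [/KUV[]//|/LUK[]].
  by move=> x /not_orP[Kx Lx]; rewrite fK // gL // addr0.
Qed.

Lemma outer_caratheodory V : open V -> caratheodory_measurable mus V.
Proof.
move=> oV A; apply/eqP; rewrite eq_le; apply/andP; split.
  pose F (n : nat) := if n is 0%N then A `&` V else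
    if n is 1%N then A `&` ~` V else set0.
  have := outer_sigma_subadditive F.
  have -> : \bigcup_n F n = A.
    apply/seteqP; split=> [x [[|[|n]] _ //= []]//|x Ax].
    by have [Vx|Vx] := pselect (V x); [exists 0%N|exists 1%N].
  move/le_trans; apply.
  have F0 n : (0 <= (mus (F n)))%E by exact: outer_ge0.
  rewrite (nneseries_split _ 2) // add0n big_nat_recl // big_nat1.
  by rewrite eseries0 ?adde0 //= => -[|[|n]] //= _ _; exact: outer0.
apply: le_ereal_inf_tmp => _ [U [oU AU] <-].
apply: le_trans (content_outer_split oU oV); apply: leeD; last first.
  by apply: outer_le => x [/AU].
apply: outer_ub; first exact: openI.
by move=> x [/AU].
Qed.

Lemma riesz_measure_exists :
  exists m : {measure set (borel G) -> \bar R}, forall A, m A = mus A.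
Proof.
pose mu : {outer_measure set (pointed_group G) -> \bar R} :=
  HB.pack (mus : set (pointed_group G) -> \bar R)
    (isOuterMeasure.Build R (pointed_group G) mus outer0 outer_ge0 outer_le
       outer_sigma_subadditive).
(* Borel sets are Caratheodory measurable because open sets are, and countable additivity is
   inherited from the Caratheodory sigma-algebra. *)
have sub (A : set (borel G)) : measurable A ->
    (measurable (A : set (caratheodory_type mu))).
  apply: smallest_sub => /=.
    split=> [|B mB|F mF].
    - exact: caratheodory_measurable_set0.
    - by rewrite setTD; exact: caratheodory_measurable_setC.
    - exact: caratheodory_measurable_bigcup.
  by move=> V oV; exact: outer_caratheodory.
have sadd : semi_sigma_additive (mus : set (borel G) -> \bar R).
  move=> F mF tF mUF.
  by apply: (@caratheodory_measure_sigma_additive R _ mu) => // *; exact: sub.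
by exists (HB.pack_for {measure set (borel G) -> \bar R}
  (mus : set (borel G) -> \bar R)
  (isMeasure.Build _ (borel G) R mus outer0 outer_ge0 sadd)).
Qed.

End RieszContent.

(** * Integration of C_c(G) and uniqueness of the representing functional *)

Section BorelIntegral.
Context {R : realType} {G : topologicalZmodType} {lcaG : LCA G}.
Implicit Types (f g : G -> R) (K U : set G).
Implicit Types m : {measure set (borel G) -> \bar R}.

Lemma borel_open U : open U -> measurable (U : set (borel G)).
Proof. by move=> oU; apply: sub_sigma_algebra. Qed.

Lemma borel_closed U : closed U -> measurable (U : set (borel G)).
Proof.
by move=> cU; rewrite -(setCK U); apply: measurableC; apply: borel_open;
  exact: closed_openC.
Qed.

Lemma borel_compact K : compact K -> measurable (K : set (borel G)).
Proof. by move=> cK; apply: borel_closed; exact: compact_closedG. Qed.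

Lemma borel_continuous f : continuous f ->
  measurable_fun [set: borel G] (f : borel G -> R).
Proof.
move=> /continuousP cf; apply: (measurability _ (RGenOpens.measurableE R)).
move=> _ [_ [a [b ->] <-]]; rewrite setTI; apply: borel_open.
exact/cf/interval_open.
Qed.

Section CompactFinite.
Context {m} (mfin : forall K, compact K -> (m K < +oo)%E).

Lemma integrable_Cc f : in_Cc f ->
  m.-integrable [set: borel G] (EFin \o (f : borel G -> R)).
Proof.
move=> Cf; have [cf [K cK fK]] := (in_CcP _).1 Cf.
have [M M0 fM] := in_Cc_bounded Cf.
apply/integrableP; split.
  by apply/measurable_EFinP; exact: borel_continuous.
apply: (@le_lt_trans _ _
    (\int[m]_(x in [set: borel G]) (M%:E * (\1_(K : set (borel G)) x)%:E))%E).
  apply: ge0_le_integral => //=.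
  - apply/measurable_EFinP; apply: measurableT_comp => //.
    exact: borel_continuous.
  - apply/measurable_EFinP; apply: measurable_funM => //.
    by apply: measurable_indic; exact: borel_compact.
  - move=> x _; rewrite -EFinM lee_fin indicE; have [Kx|Kx] := pselect (K x).
      by rewrite mem_set // mulr1.
    by rewrite memNset // mulr0 fK // normr0.
rewrite ge0_integralZl_EFin //; last 2 first.
- apply/measurable_EFinP; apply: measurable_indic; exact: borel_compact.
- exact: ltW.
rewrite integral_indic ?setIT //; last exact: borel_compact.
by rewrite lte_mul_pinfty ?lee_fin ?(ltW M0) //; exact: mfin.
Qed.

Lemma Rintegral_Cc_linear :
  linear (fun f : Cc R G => \int[m]_x (f : borel G -> R) x).
Proof.
move=> a f g /=; rewrite -[RHS]/(a * _ + _).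
rewrite -RintegralZl ?integrable_Cc //; last exact: CcP.
by rewrite -RintegralD ?integrable_Cc //; [apply/in_CcZ/CcP|exact: CcP].
Qed.

Lemma Rintegral_Cc_ge0 :
  nonneg_measure (fun f : Cc R G => \int[m]_x (f : borel G -> R) x).
Proof. by move=> f f0; apply: Rintegral_ge0. Qed.

Lemma Rintegral_Cc_le_measure f K : compact K -> in_Cc f ->
  (forall x, 0 <= f x <= 1) -> (forall x, ~ K x -> f x = 0) ->
  ((\int[m]_x (f : borel G -> R) x)%:E <= m K)%E.
Proof.
move=> cK Cf f01 fK; rewrite /Rintegral fineK; last first.
  by apply: integrable_fin_num => //; exact: integrable_Cc.
rewrite -[X in (_ <= m X)%E](setIT (K : set (borel G))).
rewrite -integral_indic //; last exact: borel_compact.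
apply: ge0_le_integral => //=.
- by move=> x _; rewrite lee_fin; have /andP[] := f01 x.
- by apply/measurable_EFinP; apply: borel_continuous; case: Cf.
- apply/measurable_EFinP; apply: measurable_indic; exact: borel_compact.
- move=> x _; rewrite lee_fin indicE; have [Kx|Kx] := pselect (K x).
    by rewrite mem_set //; have /andP[] := f01 x.
  by rewrite memNset // fK.
Qed.

Lemma measure_le_Rintegral_Cc f K : compact K -> in_Cc f ->
  (forall x, 0 <= f x) -> (forall x, K x -> 1 <= f x) ->
  (m K <= (\int[m]_x (f : borel G -> R) x)%:E)%E.
Proof.
move=> cK Cf f0 fK; rewrite /Rintegral fineK; last first.
  by apply: integrable_fin_num => //; exact: integrable_Cc.
rewrite -[X in (m X <= _)%E](setIT (K : set (borel G))).
rewrite -integral_indic //; last exact: borel_compact.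
apply: ge0_le_integral => //=.
- by apply/measurable_EFinP; apply: measurable_indic; exact: borel_compact.
- by apply/measurable_EFinP; apply: borel_continuous; case: Cf.
- move=> x _; rewrite lee_fin indicE; have [Kx|Kx] := pselect (K x).
    by rewrite mem_set //; exact: fK.
  by rewrite memNset.
Qed.

End CompactFinite.

(* A positive functional squeezed in this way is determined by the values of m
   on compact sets. *)
Definition squeezed m (psi : Cc R G -> R) :=
  (forall f K, compact K -> in_Cc f -> (forall x, 0 <= f x <= 1) ->
     (forall x, ~ K x -> f x = 0) -> ((ev psi f)%:E <= m K)%E) /\
  (forall f K, compact K -> in_Cc f -> (forall x, 0 <= f x) ->
     (forall x, K x -> 1 <= f x) -> (m K <= (ev psi f)%:E)%E).

Lemma squeezed_unique m (psi psi' : Cc R G -> R) :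
  (forall K, compact K -> (m K < +oo)%E) ->
  linear psi -> linear psi' -> squeezed m psi -> squeezed m psi' ->
  psi = psi'.
Proof.
move=> mfin lpsi lpsi' [up lo] [up' lo'].
pose D f := ev psi f - ev psi' f.
have DB f g : in_Cc f -> in_Cc g -> D (fun x => f x - g x) = D f - D g.
  by move=> Cf Cg; rewrite /D !evB //; ring.
have DZ a f : in_Cc f -> D (fun x => a * f x) = a * D f.
  by move=> Cf; rewrite /D !evZ // mulrBr.
have unit f : in_Cc f -> (forall x, 0 <= f x <= 1) -> D f = 0.
  move=> Cf f01; have [cf [K cK fK]] := (in_CcP _).1 Cf.
  pose Kj (n j : nat) := K `&` [set x | j%:R / n%:R <= f x].
  have cKj n j : compact (Kj n j).
    apply: (compact_closedI cK).
    have -> : [set x | j%:R / n%:R <= f x] = f @^-1` [set r | j%:R / n%:R <= r].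
      by [].
    by apply: closed_comp; [move=> x _; exact: cf|exact: closed_ge].
  pose a n j := fine (m (Kj n j)).
  have mE n j : m (Kj n j) = (a n j)%:E.
    by rewrite /a fineK // ge0_fin_numE //; exact: mfin.
  have bound n : (0 < n)%N -> n%:R * `|D f| <= a n 0%N.
    move=> n0; have n0' : 0 < n%:R :> R by rewrite ltr0n.
    pose g j x := Num.min (f x) (j%:R / n%:R).
    have Cg j : in_Cc (g j).
      apply/in_CcP; split; last first.
        exists K => // x Kx; rewrite /g fK //; apply/min_idPl.
        by rewrite divr_ge0.
      move=> x; apply: (@continuous_min R G f (cst (j%:R / n%:R))).
        exact: cf.
      exact: cvg_cst.
    pose h j x := n%:R * (g j.+1 x - g j x).
    have Ch j : in_Cc (h j) by apply: in_CcZ; exact: in_CcB.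
    have hK j x : ~ Kj n j x -> h j x = 0.
      move=> /not_andP[Kx|/negP].
        rewrite /h /g fK //; have := ler0n R j.
        by rewrite !(min_idPl _) ?divr_ge0 // subrr mulr0.
      rewrite -ltNge => /ltW fj; rewrite /h /g !(min_idPl _) ?subrr ?mulr0 //.
      by apply: (le_trans fj); rewrite ler_pM2r ?invr_gt0 // ler_nat.
    have jS j : j.+1%:R / n%:R = j%:R / n%:R + n%:R^-1 :> R.
      by rewrite -natr1 mulrDl mul1r.
    have h01 j x : 0 <= h j x <= 1.
      have nV : n%:R * n%:R^-1 = 1 :> R by rewrite mulfV // gt_eqF.
      have nV0 : 0 < n%:R^-1 :> R by rewrite invr_gt0.
      rewrite /h /g jS; set b := j%:R / n%:R; set c := n%:R^-1 in nV nV0 *.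
      have [fb|fb] := leP (f x) b; have [fc|fc] := leP (f x) (b + c);
        apply/andP; split; nra.
    have h1 j x : Kj n j.+1 x -> 1 <= h j x.
      move=> [Kx /=]; rewrite /h /g jS => fb.
      have nV : n%:R * n%:R^-1 = 1 :> R by rewrite mulfV // gt_eqF.
      have nV0 : 0 < n%:R^-1 :> R by rewrite invr_gt0.
      rewrite (min_idPr fb) (min_idPr _); last by lra.
      by rewrite addrC addKr nV.
    have hD j : `|D (h j)| <= a n j - a n j.+1.
      have := up _ _ (cKj n j) (Ch j) (h01 j) (hK j).
      have := up' _ _ (cKj n j) (Ch j) (h01 j) (hK j).
      have h0 x : 0 <= h j x by have /andP[] := h01 j x.
      have := lo _ _ (cKj n j.+1) (Ch j) h0 (h1 j).
      have := lo' _ _ (cKj n j.+1) (Ch j) h0 (h1 j).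
      by rewrite !mE !lee_fin /D ler_norml => *; apply/andP; split; lra.
    have ind k : n%:R * `|D (g k)| <= a n 0%N - a n k.
      elim: k => [|k IH].
        have -> : g 0%N = fun x => 0 * f x.
          apply/funext => x; rewrite /g !mul0r; apply/min_idPr.
          by have /andP[] := f01 x.
        by rewrite DZ // mul0r normr0 mulr0 subrr.
      have := hD k; rewrite DZ ?DB //; last exact: in_CcB.
      rewrite normrM ger0_norm ?ler0n // => hk.
      have : n%:R * `|D (g k.+1)| <= n%:R * `|D (g k)| +
          n%:R * `|D (g k.+1) - D (g k)|.
        rewrite -mulrDr ler_pM2l // -[X in `|X| <= _](subrK (D (g k))) addrC.
        exact: ler_normD.
      by lra.
    have gn : g n = f.
      apply/funext => x; rewrite /g divff ?gt_eqF //; apply/min_idPl.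
      by have /andP[] := f01 x.
    have := ind n; rewrite gn; suff : 0 <= a n n by lra.
    exact: fine_ge0.
  apply/eqP; rewrite -normr_eq0; apply/negPn/negP => Df0.
  have Dp : 0 < `|D f| by rewrite lt_def Df0 normr_ge0.
  pose A := fine (m K).
  have aA n : a n 0%N = A.
    rewrite /a /A /Kj; congr (fine (m _)); apply/seteqP; split=> [x []//|x Kx].
    by split=> //=; rewrite mul0r; have /andP[] := f01 x.
  have A0 : 0 <= A by exact: fine_ge0.
  have := bound (Num.bound (A / `|D f|)).+1 isT; rewrite aA.
  rewrite -ler_pdivlMr // leNgt => /negP; apply.
  have AD : 0 <= A / `|D f| by rewrite divr_ge0.
  apply: (lt_le_trans (archi_boundP AD)); by rewrite ler_nat.
have pos f : in_Cc f -> (forall x, 0 <= f x) -> D f = 0.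
  move=> Cf f0; have [M M0 fM] := in_Cc_bounded Cf.
  have := unit (fun x => M^-1 * f x) (in_CcZ _ Cf); rewrite DZ // => H.
  have {}H : M^-1 * D f = 0.
    apply: H => x; rewrite mulr_ge0 ?invr_ge0 ?(ltW M0) //=.
    by rewrite mulrC ler_pdivrMr // mul1r (le_trans (ler_norm _)).
  by move/eqP: H; rewrite mulf_eq0 invr_eq0 gt_eqF //= => /eqP.
apply/funext => f; rewrite -!evE; have Cf := CcP f.
suff : D f = 0 by rewrite /D => /eqP; rewrite subr_eq0 => /eqP.
have -> : (f : G -> R) =
    fun x => Num.max (f x) 0 - Num.max (- f x) 0.
  by apply/funext => x; rewrite !maxEle; case: ifP; case: ifP; lra.
have C1 : in_Cc (fun x => Num.max (f x) 0).
  by apply: in_Cc_max => //; exact: in_Cc0.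
have C2 : in_Cc (fun x => Num.max (- f x) 0).
  by apply: in_Cc_max; [exact: in_CcN|exact: in_Cc0].
by rewrite DB // !pos ?subrr // => x; rewrite le_max lexx orbT.
Qed.

End BorelIntegral.

(** * The Riesz-Markov representation theorem *)

Section RieszMarkov.
Context {R : realType} {G : topologicalZmodType} {lcaG : LCA G}.
Context {psi : Cc R G -> R} (lpsi : linear psi) (ppsi : nonneg_measure psi).
Implicit Types (f g : G -> R) (K U : set G).

(** For a < 1 the open set where f exceeds a contains K, and every function below it is at most f /
    a; then a tends to 1. *)
Lemma outer_lower f K : compact K -> in_Cc f -> (forall x, 0 <= f x) ->
  (forall x, K x -> 1 <= f x) -> (riesz_outer psi K <= (ev psi f)%:E)%E.
Proof.
move=> cK Cf f0 fK; have If0 : 0 <= ev psi f by exact: ev_ge0.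
have key (a : R) : 0 < a -> a < 1 -> (riesz_outer psi K <= (a^-1 * ev psi f)%:E)%E.
  move=> a0 a1; pose U := [set x | a < f x].
  have oU : open U.
    have -> : U = f @^-1` [set r | a < r] by [].
    by apply: open_comp; [move=> x _; case: Cf => cf _; exact: cf|exact: open_gt].
  apply: (le_trans (outer_ub oU _)).
    by move=> x Kx; rewrite /U /= (lt_le_trans a1) //; exact: fK.
  apply: ge_ereal_sup => _ [g [Cg g01 [L [cL LU gL]]] <-].
  rewrite lee_fin -evZ //; apply: ev_le => //; first exact: in_CcZ.
  move=> x; have [Lx|Lx] := pselect (L x); last first.
    by rewrite gL // mulr_ge0 // invr_ge0 ltW.
  have /andP[_ /le_trans] := g01 x; apply.
  by rewrite mulrC ler_pdivlMr // mul1r ltW //; exact: LU.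
apply/lee_addgt0Pr => e e0.
have I1 : 0 < ev psi f + 1 by lra.
(* Then psi f / a = psi f + e psi f / (psi f + 1), which is at most psi f + e; the summand 1 keeps a
   positive when psi f = 0. *)
pose a := (ev psi f + 1) / (ev psi f + 1 + e).
have a0 : 0 < a by rewrite divr_gt0 //; lra.
have a1 : a < 1 by rewrite /a ltr_pdivrMr; lra.
apply: (le_trans (key _ a0 a1)); rewrite -EFinD lee_fin.
rewrite /a invf_div mulrAC ler_pdivrMr //; nra.
Qed.

Lemma outer_upper f K : compact K -> in_Cc f -> (forall x, 0 <= f x <= 1) ->
  (forall x, ~ K x -> f x = 0) -> ((ev psi f)%:E <= riesz_outer psi K)%E.
Proof.
move=> cK Cf f01 fK; apply: le_ereal_inf_tmp => _ [U [oU KU] <-].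
by apply: content_ub; split=> //; exists K.
Qed.

(** Both psi and integration against the outer measure are squeezed by that measure, so
    [squeezed_unique] identifies them. The estimate on compact sets is kept as a conclusion for
    bounding Jordan parts. *)
Theorem riesz_markov : exists m : {measure set (borel G) -> \bar R},
  [/\ radon_borel m, forall f : Cc R G, psi f = \int[m]_x (f : borel G -> R) x,
    forall f K, compact K -> in_Cc f -> (forall x, 0 <= f x) ->
      (forall x, K x -> 1 <= f x) -> (m K <= (ev psi f)%:E)%E &
    forall U, open U -> m U = riesz_content psi U].
Proof.
have [m mE] := riesz_measure_exists lpsi ppsi.
have mfin K : compact K -> (m K < +oo)%E.
  move=> cK; have [f [Cf f01 [W oW [KW fW]] _]] := urysohn_Cc (R := R) cK openT
    (@subsetT _ _).
  rewrite mE; apply: (le_lt_trans (outer_lower (f := f) cK Cf _ _)).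
  - by move=> x; have /andP[] := f01 x.
  - by move=> x /KW/fW ->.
  - exact: ltry.
have mopen (U : set G) : open U -> m U = riesz_content psi U.
  by move=> oU; rewrite mE; exact: outer_open.
exists m; split=> //.
- split=> //.
    move=> A mA; rewrite mE; congr (ereal_inf _).
    by apply/seteqP; split=> x [U [oU AU] <-]; exists U => //; rewrite mopen.
  move=> U oU; apply/eqP; rewrite eq_le; apply/andP; split.
    rewrite mopen //; apply: ge_ereal_sup => _ [f [Cf f01 [K [cK KU fK]]] <-].
    apply: (@le_trans _ _ (m K)); first by rewrite mE; exact: outer_upper.
    by apply: ereal_sup_ubound; exists K.
  apply: ge_ereal_sup => _ [K [cK KU] <-]; apply: le_measure => //.
  - by rewrite inE; exact: borel_compact.
  - by rewrite inE; exact: borel_open.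
- move=> f; suff -> : psi = fun f : Cc R G => \int[m]_x (f : borel G -> R) x by [].
  apply: (@squeezed_unique R G _ m) => //.
  + exact: Rintegral_Cc_linear.
  + split=> [g K *|g K *]; rewrite mE; [exact: outer_upper|exact: outer_lower].
  + split=> g K cK Cg *.
      by rewrite /ev toCcE //; exact: Rintegral_Cc_le_measure.
    by rewrite /ev toCcE //; exact: measure_le_Rintegral_Cc.
- by move=> f K *; rewrite mE; exact: outer_lower.
Qed.

End RieszMarkov.

(** * Extension of functionals from the cone of nonnegative functions *)

Section ConeExtension.
Context {R : realType} {G : topologicalZmodType} {lcaG : LCA G}.
Implicit Types (f g : G -> R).
Context {p : (G -> R) -> R}.
Hypothesis pD : forall f g, in_Cc f -> in_Cc g -> (forall x, 0 <= f x) ->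
  (forall x, 0 <= g x) -> p (fun x => f x + g x) = p f + p g.
Hypothesis pZ : forall (a : R) f, in_Cc f -> 0 <= a -> (forall x, 0 <= f x) ->
  p (fun x => a * f x) = a * p f.

Definition cone_ext (q : (G -> R) -> R) (f : Cc R G) : R :=
  q (fun x => Num.max (f x) 0) - q (fun x => Num.max (- f x) 0).

(** From f+ + h = f- + g and additivity on the cone, the value does not depend on how f is written
    as a difference; linearity rests on this freedom. *)
Lemma cone_extE (f : Cc R G) g h : in_Cc g -> in_Cc h ->
  (forall x, 0 <= g x) -> (forall x, 0 <= h x) ->
  (forall x, f x = g x - h x) -> cone_ext p f = p g - p h.
Proof.
move=> Cg Ch g0 h0 fE; rewrite /cone_ext.
set a := fun x => Num.max (f x) 0; set b := fun x => Num.max (- f x) 0.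
have Cf := CcP f.
have Ca : in_Cc a by apply: in_Cc_max => //; exact: in_Cc0.
have Cb : in_Cc b by apply: in_Cc_max; [exact: in_CcN|exact: in_Cc0].
have a0 x : 0 <= a x by rewrite le_max lexx orbT.
have b0 x : 0 <= b x by rewrite le_max lexx orbT.
have abE : (fun x => a x + h x) = (fun x => b x + g x).
  apply/funext => x; have := fE x; rewrite /a /b !maxEle.
  by case: ifP; case: ifP; lra.
have := congr1 p abE; rewrite !pD //; lra.
Qed.

Lemma cone_ext_nneg f : in_Cc f -> (forall x, 0 <= f x) ->
  cone_ext p (toCc f) = p f.
Proof.
move=> Cf f0; rewrite (@cone_extE _ f (fun x => 0 * f x)) ?pZ ?mul0r ?subr0 //.
- exact: in_CcZ.
- by move=> x; rewrite mul0r.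
- by move=> x; rewrite toCcE // mul0r subr0.
Qed.

Lemma cone_ext_linear : linear (cone_ext p).
Proof.
move=> a f g; rewrite -[RHS]/(a * _ + _).
have Cf := CcP f; have Cg := CcP g.
set f1 := fun x => Num.max (f x) 0; set f2 := fun x => Num.max (- f x) 0.
set g1 := fun x => Num.max (g x) 0; set g2 := fun x => Num.max (- g x) 0.
have Cf1 : in_Cc f1 by apply: in_Cc_max => //; exact: in_Cc0.
have Cf2 : in_Cc f2 by apply: in_Cc_max; [exact: in_CcN|exact: in_Cc0].
have Cg1 : in_Cc g1 by apply: in_Cc_max => //; exact: in_Cc0.
have Cg2 : in_Cc g2 by apply: in_Cc_max; [exact: in_CcN|exact: in_Cc0].
have p1 (h : G -> R) x : 0 <= Num.max (h x) 0 by rewrite le_max lexx orbT.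
have p2 (h : G -> R) x : 0 <= Num.max (- h x) 0 by rewrite le_max lexx orbT.
have E (h : G -> R) x : h x = Num.max (h x) 0 - Num.max (- h x) 0.
  by rewrite !maxEle; case: ifP; case: ifP; lra.
rewrite {2 3}/cone_ext -/f1 -/f2 -/g1 -/g2.
have f10 x : 0 <= f1 x by exact: p1.
have f20 x : 0 <= f2 x by exact: p2.
have g10 x : 0 <= g1 x by exact: p1.
have g20 x : 0 <= g2 x by exact: p2.
(* A negative scalar exchanges positive and negative part, so u and v are the two parts of f in the
   order that makes the factor b nonnegative. *)
have lin (b : R) u v : 0 <= b -> in_Cc u -> in_Cc v ->
    (forall x, 0 <= u x) -> (forall x, 0 <= v x) ->
    (forall x, a * f x = b * u x - b * v x) ->
    cone_ext p (a *: f + g) = (b * p u + p g1) - (b * p v + p g2).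
  move=> b0 Cu Cv u0 v0 uv.
  have bu0 x : 0 <= b * u x by rewrite mulr_ge0.
  have bv0 x : 0 <= b * v x by rewrite mulr_ge0.
  have Cbu : in_Cc (fun x => b * u x) by exact: in_CcZ.
  have Cbv : in_Cc (fun x => b * v x) by exact: in_CcZ.
  rewrite -(pZ Cu) // -(pZ Cv) // -(pD Cbu Cg1) // -(pD Cbv Cg2) //.
  apply: cone_extE; [exact: in_CcD|exact: in_CcD|..];
    try by move=> x; rewrite addr_ge0.
  move=> x; rewrite -[LHS]/(a * f x + g x) uv {1}(E g x) /g1 /g2.
  by ring.
have [a0|/ltW a0] := leP 0 a.
  rewrite (lin a f1 f2) //; first by ring.
  by move=> x; rewrite {1}(E f x) mulrBr.
rewrite (lin (- a) f2 f1) ?oppr_ge0 //; first by ring.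
by move=> x; rewrite {1}(E f x) /f1 /f2; ring.
Qed.

End ConeExtension.

(** * The Jordan decomposition of a real Radon measure *)

Section Jordan.
Context {R : realType} {G : topologicalZmodType} {lcaG : LCA G}.
Implicit Types (f g : G -> R) (K U : set G) (psi : Cc R G -> R).
Local Notation bmeasure := {measure set (borel G) -> \bar R}.

Lemma radon_bound psi K : radon psi -> compact K -> exists2 C, 0 <= C &
  forall f e, in_Cc f -> (forall x, ~ K x -> f x = 0) ->
    (forall x, `|f x| <= e) -> `|ev psi f| <= C * e.
Proof.
move=> [_ /(_ K)] rpsi /[dup] cK /rpsi[C HC]; exists `|C| => // f e Cf fK fe.
have e0 : 0 <= e by apply: le_trans (fe 0).
apply: (@le_trans _ _ (C * e)); last by rewrite ler_wpM2r // ler_norm.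
by apply: HC; [rewrite toCcE //; exact: tsupp_sub|move=> x; rewrite toCcE].
Qed.

(** The Riesz-Kantorovich formula for the positive part of psi, meant for nonnegative f. *)
Definition pos_var psi f : R :=
  sup [set ev psi g | g in [set g | in_Cc g /\ forall x, 0 <= g x <= f x]].

Section PosVar.
Context {psi : Cc R G -> R} (rpsi : radon psi).
Let lpsi : linear psi := rpsi.1.

Lemma pos_var_has_sup f : in_Cc f -> (forall x, 0 <= f x) ->
  has_sup [set ev psi g | g in [set g | in_Cc g /\ forall x, 0 <= g x <= f x]].
Proof.
move=> Cf f0; split.
  exists (ev psi (fun=> 0)); exists (fun=> 0) => //; split; first exact: in_Cc0.
  by move=> x; rewrite lexx f0.
have [cf [K cK fK]] := (in_CcP _).1 Cf.
have [M M0 fM] := in_Cc_bounded Cf.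
have [C _ HC] := radon_bound rpsi cK.
exists (C * M) => _ [g [Cg gf] <-]; apply: (le_trans (ler_norm _)).
apply: HC => // x.
  move=> /fK fx; apply/eqP; have := gf x; rewrite fx.
  by move=> /andP[? ?]; rewrite eq_le; apply/andP.
have /andP[g0 gfx] := gf x; rewrite ger0_norm //.
by apply: (le_trans gfx); apply: le_trans (fM x); exact: ler_norm.
Qed.

Lemma pos_var_ub f g : in_Cc f -> in_Cc g -> (forall x, 0 <= g x <= f x) ->
  ev psi g <= pos_var psi f.
Proof.
move=> Cf Cg gf; apply: ub_le_sup; last by exists g.
apply: (pos_var_has_sup Cf _).2 => x.
by have /andP[g0 gfx] := gf x; exact: le_trans gfx.
Qed.

Lemma pos_var_le f (c : R) : in_Cc f -> (forall x, 0 <= f x) ->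
  (forall g, in_Cc g -> (forall x, 0 <= g x <= f x) -> ev psi g <= c) ->
  pos_var psi f <= c.
Proof.
move=> Cf f0 H; apply: ge_sup; first exact: (pos_var_has_sup Cf f0).1.
by move=> _ [g [Cg gf] <-]; exact: H.
Qed.

Lemma pos_varD f g : in_Cc f -> in_Cc g -> (forall x, 0 <= f x) ->
  (forall x, 0 <= g x) ->
  pos_var psi (fun x => f x + g x) = pos_var psi f + pos_var psi g.
Proof.
move=> Cf Cg f0 g0; have Cfg : in_Cc (fun x => f x + g x) by exact: in_CcD.
apply/eqP; rewrite eq_le; apply/andP; split.
  apply: pos_var_le => // [x|h Ch hfg]; first by rewrite addr_ge0.
  (* Riesz decomposition: when 0 <= h <= f + g, the remainder h - min(h, f) lies between 0 and g. *)
  have Cm : in_Cc (fun x => Num.min (h x) (f x)) by exact: in_Cc_min.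
  have -> : h = fun x => Num.min (h x) (f x) + (h x - Num.min (h x) (f x)).
    by apply/funext => x; rewrite addrC subrK.
  rewrite evD //; last exact: in_CcB.
  apply: lerD; apply: pos_var_ub => //; try exact: in_CcB.
    move=> x; have /andP[h0 _] := hfg x.
    by rewrite le_min h0 f0 /= ge_min lexx orbT.
  move=> x; have /andP[h0 hfgx] := hfg x; have := g0 x.
  by case: (leP (h x) (f x)) => ? ?; apply/andP; split; lra.
rewrite -lerBrDr; apply: pos_var_le => // f' Cf' f'f.
rewrite lerBrDl -lerBrDr; apply: pos_var_le => // g' Cg' g'g.
rewrite lerBrDl -evD //; apply: pos_var_ub => //; first exact: in_CcD.
move=> x; have /andP[? ?] := f'f x; have /andP[? ?] := g'g x.
by rewrite addr_ge0 // lerD.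
Qed.

Lemma pos_varZ (a : R) f : in_Cc f -> 0 <= a -> (forall x, 0 <= f x) ->
  pos_var psi (fun x => a * f x) = a * pos_var psi f.
Proof.
move=> Cf; rewrite le_eqVlt => /predU1P[<-|a0] f0.
  rewrite mul0r; apply/eqP; rewrite eq_le; apply/andP; split.
    apply: pos_var_le => [|x|g Cg g0]; [exact: in_CcZ|by rewrite mul0r|].
    suff -> : g = fun=> 0 by rewrite ev0.
    apply/funext => x; apply/eqP; rewrite eq_le andbC.
    by have := g0 x; rewrite mul0r.
  rewrite -[leLHS](ev0 lpsi); apply: pos_var_ub; [exact: in_CcZ|exact: in_Cc0|].
  by move=> x; rewrite mul0r lexx.
have half (b : R) h : 0 < b -> in_Cc h -> (forall x, 0 <= h x) ->
    pos_var psi (fun x => b * h x) <= b * pos_var psi h.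
  move=> b0 Ch h0; apply: pos_var_le => [|x|g Cg gbh]; first exact: in_CcZ.
    by rewrite mulr_ge0 // ltW.
  rewrite mulrC -ler_pdivrMr // mulrC -evZ //; apply: pos_var_ub => //.
    exact: in_CcZ.
  move=> x; have /andP[? ?] := gbh x.
  by rewrite mulr_ge0 ?invr_ge0 ?(ltW b0) //= ler_pdivrMl.
apply/eqP; rewrite eq_le half //=.
have aV0 : 0 < a^-1 by rewrite invr_gt0.
have aVK : (fun x => a^-1 * (a * f x)) = f.
  by apply/funext => x; rewrite mulrA mulVf ?gt_eqF // mul1r.
have := [elaborate half a^-1 (fun x => a * f x) aV0 (in_CcZ a Cf)
  (fun x => mulr_ge0 (ltW a0) (f0 x))].
by rewrite aVK ler_pdivlMl.
Qed.

Definition pos_func : Cc R G -> R := cone_ext (pos_var psi).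
Definition neg_func : Cc R G -> R := fun f : Cc R G => pos_func f - psi f.

Lemma pos_func_linear : linear pos_func.
Proof. by apply: cone_ext_linear; [exact: pos_varD|exact: pos_varZ]. Qed.

Lemma ev_pos_func f : in_Cc f -> (forall x, 0 <= f x) ->
  ev pos_func f = pos_var psi f.
Proof.
by move=> Cf f0; rewrite /ev /pos_func cone_ext_nneg //;
  [exact: pos_varD|exact: pos_varZ].
Qed.

Lemma pos_func_ge0 : nonneg_measure pos_func.
Proof.
move=> f f0; have Cf := CcP f; rewrite -evE ev_pos_func // -(ev0 lpsi).
by apply: pos_var_ub => //; [exact: in_Cc0|move=> x; rewrite lexx f0].
Qed.

Lemma neg_func_linear : linear neg_func.
Proof.
move=> a f g; rewrite /neg_func pos_func_linear lpsi -[RHS]/(a * _ + _).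
by rewrite -2![_ *: _]/(a * _); ring.
Qed.

Lemma neg_func_ge0 : nonneg_measure neg_func.
Proof.
move=> f f0; have Cf := CcP f; rewrite /neg_func subr_ge0 -!evE ev_pos_func //.
by apply: pos_var_ub => // x; rewrite f0 lexx.
Qed.

End PosVar.

(** Urysohn functions between compact and open sets compare the measures on open sets, by inner
    regularity; outer regularity carries the comparison to Borel sets. *)
Lemma measure_le_of_functional (m m' : bmeasure) :
  radon_borel m -> radon_borel m' ->
  (forall f, in_Cc f -> (forall x, 0 <= f x) ->
    \int[m]_x (f : borel G -> R) x <= \int[m']_x (f : borel G -> R) x) ->
  forall A : set (borel G), measurable A -> (m A <= m' A)%E.
Proof.
move=> [mfin mout min] [mfin' mout' _] mm'.
have mopen (U : set G) : open U -> (m (U : set (borel G)) <= m' (U : set (borel G)))%E.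
  move=> oU; rewrite min //; apply: ge_ereal_sup => _ [K [cK KU] <-].
  have [f [Cf f01 [W oW [KW fW]] [L [cL LU fL]]]] := urysohn_Cc (R := R) cK oU KU.
  have f0 x : 0 <= f x by have /andP[] := f01 x.
  apply: (le_trans (measure_le_Rintegral_Cc mfin cK Cf f0 _)).
    by move=> x /KW/fW ->.
  apply: (@le_trans _ _ (m' (L : set (borel G)))); last first.
    by apply: le_measure => //; rewrite inE;
      [exact: borel_compact|exact: borel_open].
  apply: (le_trans _ (Rintegral_Cc_le_measure mfin' cL Cf f01 fL)).
  by rewrite lee_fin; exact: mm'.
move=> A mA; rewrite mout' //; apply: le_ereal_inf_tmp => _ [U [oU AU] <-].
apply: le_trans (mopen _ oU); apply: le_measure => //; rewrite inE //.
exact: borel_open.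
Qed.

(** If psi = m1' - m2' with positive measures and 0 <= g <= f, then psi g <= m1' g <= m1' f, so the
    positive variation lies below m1'. Subtracting psi gives the comparison of the negative part
    with m2'. *)
Lemma is_jordan_exists psi : radon psi -> exists m, is_jordan m psi.
Proof.
move=> rpsi; have lpsi := rpsi.1.
have [m1 [r1 E1 _ _]] := riesz_markov (pos_func_linear rpsi) (pos_func_ge0 rpsi).
have [m2 [r2 E2 _ _]] := riesz_markov (neg_func_linear rpsi) (neg_func_ge0 rpsi).
exists (m1, m2); split.
  by split=> // f; rewrite /= -E1 -E2 /neg_func opprB addrC subrK.
move=> [m1' m2'] [/= r1' r2' E'].
have [fin1 _ _] := r1'; have [fin2 _ _] := r2'.
have le1 f : in_Cc f -> (forall x, 0 <= f x) ->
    pos_var psi f <= \int[m1']_x (f : borel G -> R) x.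
  move=> Cf f0; apply: pos_var_le => // g Cg gf.
  rewrite /ev E' toCcE //.
  have : 0 <= \int[m2']_x (g : borel G -> R) x.
    by apply: Rintegral_ge0 => x _; have /andP[] := gf x.
  have : \int[m1']_x (g : borel G -> R) x <= \int[m1']_x (f : borel G -> R) x.
    apply: le_Rintegral => //; try exact: integrable_Cc.
    by move=> x _; have /andP[] := gf x.
  by lra.
have E1' f : in_Cc f -> (forall x, 0 <= f x) ->
    \int[m1]_x (f : borel G -> R) x = pos_var psi f.
  by move=> Cf f0; rewrite -ev_pos_func // /ev E1 toCcE.
move=> A mA; split; apply: measure_le_of_functional => // f Cf f0.
  by rewrite E1' //; exact: le1.
have := E' (toCc f); have := E2 (toCc f); rewrite /neg_func !toCcE // => <- ->.
rewrite -/(ev _ _) ev_pos_func //; have := le1 _ Cf f0; lra.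
Qed.

Lemma jordanP psi : radon psi -> is_jordan (jordan psi) psi.
Proof.
move=> /is_jordan_exists ex; rewrite /jordan; case: pselect => // h.
exact: (projT2 (cid h)).
Qed.

Section JordanTheory.
Context {psi : Cc R G -> R} (rpsi : radon psi).

Lemma pos_part_radon : radon_borel (pos_part psi).
Proof. by have [[]] := jordanP rpsi. Qed.

Lemma neg_part_radon : radon_borel (neg_part psi).
Proof. by have [[]] := jordanP rpsi. Qed.

Lemma pos_part_fin K : compact K -> (pos_part psi K < +oo)%E.
Proof. by have [+ _ _] := pos_part_radon; apply. Qed.

Lemma neg_part_fin K : compact K -> (neg_part psi K < +oo)%E.
Proof. by have [+ _ _] := neg_part_radon; apply. Qed.

Lemma pairing_Cc f : in_Cc f -> pairing f psi = ev psi f.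
Proof.
by move=> Cf; have [[_ _ E] _] := jordanP rpsi; rewrite /ev E toCcE.
Qed.

(** Minimality of the Jordan pair turns any expression of psi as a difference of positive
    functionals into upper bounds for both parts. *)
Lemma pos_neg_part_le (psi1 psi2 : Cc R G -> R) :
  linear psi1 -> linear psi2 -> nonneg_measure psi1 -> nonneg_measure psi2 ->
  (forall f : Cc R G, psi f = psi1 f - psi2 f) ->
  forall f K, compact K -> in_Cc f -> (forall x, 0 <= f x) ->
    (forall x, K x -> 1 <= f x) ->
    (pos_part psi K <= (ev psi1 f)%:E)%E /\ (neg_part psi K <= (ev psi2 f)%:E)%E.
Proof.
move=> l1 l2 p1 p2 E f K cK Cf f0 fK.
have [m1 [r1 E1 H1 _]] := riesz_markov l1 p1.
have [m2 [r2 E2 H2 _]] := riesz_markov l2 p2.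
have [_ min] := jordanP rpsi.
have [|le1 le2] := min (m1, m2) _ (K : set (borel G)) (borel_compact cK).
  by split=> // g; rewrite E E1 E2.
by split; [apply: (le_trans le1); exact: H1|apply: (le_trans le2); exact: H2].
Qed.

End JordanTheory.
End Jordan.

(** * Translation boundedness in terms of functionals *)

Section TranslationBounded.
Context {R : realType} {G : topologicalZmodType} {lcaG : LCA G}.
Implicit Types (f g : G -> R) (K U : set G) (psi : Cc R G -> R).

(** The positive part contributes at most [pos_var psi f] <= c and the negative part at most
    [pos_var psi f] - psi f <= 2 c, whence the factor 3. *)
Lemma total_variation_le psi K f (c : R) : radon psi -> compact K -> in_Cc f ->
  (forall x, 0 <= f x) -> (forall x, K x -> 1 <= f x) ->
  (forall g, in_Cc g -> (forall x, 0 <= g x <= f x) -> `|ev psi g| <= c) ->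
  (Defs.total_variation psi K <= (3 * c)%:E)%E.
Proof.
move=> rpsi cK Cf f0 fK H; have lpsi := rpsi.1.
have E (h : Cc R G) : psi h = pos_func (psi := psi) h - neg_func (psi := psi) h.
  by rewrite /neg_func opprB addrC subrK.
have [le1 le2] := pos_neg_part_le rpsi (pos_func_linear rpsi)
  (neg_func_linear rpsi) (pos_func_ge0 rpsi) (neg_func_ge0 rpsi) E cK Cf f0 fK.
have pc : pos_var psi f <= c.
  by apply: pos_var_le => // g Cg gf; apply: le_trans (H _ Cg gf); exact: ler_norm.
have fc : `|ev psi f| <= c by apply: H => // x; rewrite f0 lexx.
apply: (le_trans (leeD le1 le2)); rewrite -EFinD lee_fin.
rewrite {2}/ev /neg_func -!/(ev _ _) ev_pos_func //.
by move: fc; rewrite ler_norml => /andP[]; lra.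
Qed.

Lemma ev_le_total_variation psi K f (e : R) : radon psi -> compact K ->
  in_Cc f -> (forall x, ~ K x -> f x = 0) -> (forall x, `|f x| <= e) ->
  ((`|ev psi f|)%:E <= e%:E * Defs.total_variation psi K)%E.
Proof.
move=> rpsi cK Cf fK fe.
have key (m : {measure set (borel G) -> \bar R}) :
    (forall K, compact K -> (m K < +oo)%E) ->
    ((`|\int[m]_x (f : borel G -> R) x|)%:E <= e%:E * m K)%E.
  move=> mfin; have i := [elaborate integrable_Cc mfin Cf].
  have mf := borel_continuous Cf.1.
  have mI : measurable_fun [set: borel G] (\1_(K : set (borel G)) : borel G -> R).
    by apply: measurable_indic; exact: borel_compact.
  rewrite EFin_normr_Rintegral //.
  apply: (@le_trans _ _ (\int[m]_(x in [set: borel G]) `|(f x)%:E|)%E).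
    by apply: le_abse_integral => //; apply/measurable_EFinP.
  apply: (@le_trans _ _
    (\int[m]_(x in [set: borel G]) (e%:E * (\1_(K : set (borel G)) x)%:E))%E).
    apply: ge0_le_integral => //=.
    - by apply/measurable_EFinP; apply: measurableT_comp.
    - by apply/measurable_EFinP; apply: measurable_funM.
    - move=> x _; rewrite -EFinM lee_fin indicE; have [Kx|Kx] := pselect (K x).
        by rewrite mem_set // mulr1.
      by rewrite memNset // mulr0 fK // normr0.
  rewrite ge0_integralZl_EFin //; last 2 first.
  - by apply/measurable_EFinP.
  - exact: le_trans (fe 0).
  by rewrite integral_indic ?setIT //; exact: borel_compact.
rewrite -(pairing_Cc rpsi Cf) /pairing /Defs.total_variation.
rewrite ge0_muleDr; [|exact: measure_ge0|exact: measure_ge0].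
apply: (@le_trans _ _ (`|\int[pos_part psi]_x (f : borel G -> R) x|%:E +
  `|\int[neg_part psi]_x (f : borel G -> R) x|%:E)%E).
  by rewrite -EFinD lee_fin ler_normB.
by apply: leeD; apply: key; [exact: pos_part_fin|exact: neg_part_fin].
Qed.

(** Translation boundedness without Jordan parts: one constant per compact K serves all functions
    supported in the translates K + x. In this form it visibly passes to linear combinations. *)
Definition uniformly_bounded psi := forall K, compact K -> exists2 C : R, 0 <= C &
  forall x f (e : R), in_Cc f -> (forall y, ~ K (y - x) -> f y = 0) ->
    (forall y, `|f y| <= e) -> `|ev psi f| <= C * e.

Lemma total_variation_subadditive psi (s : seq G) (F : G -> set G) A :
  measurable (A : set (borel G)) ->
  (forall x, measurable (F x : set (borel G))) ->
  (forall y, A y -> exists2 x, x \in s & F x y) ->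
  (Defs.total_variation psi A <= \sum_(x <- s) Defs.total_variation psi (F x))%E.
Proof.
move=> mA mF AF.
have key (m : {measure set (borel G) -> \bar R}) :
    (m A <= \sum_(x <- s) m (F x))%E.
  apply: (@le_trans _ _ (m (\big[setU/set0]_(x <- s) (F x : set (borel G))))).
    apply: le_measure; rewrite ?inE //.
      by apply: bigsetU_measurable.
    move=> y /AF[x xs Fy]; rewrite (big_rem x) //=; by left.
  elim: {AF} s => [|x s IH]; first by rewrite !big_nil measure0.
  rewrite !big_cons; apply: (le_trans (measureU2 _ _ _)) => //.
    by apply: bigsetU_measurable.
  exact: leeD.
by rewrite /Defs.total_variation big_split; apply: leeD.
Qed.

(** Finitely many translates of the reference neighbourhood [K0] cover a given compact set, so a
    bound on the translates of one neighbourhood gives bounds for all compact sets. *)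
Lemma total_variation_translates psi K : radon psi -> translation_bounded psi ->
  compact K -> exists2 C : R, 0 <= C &
  forall x, (Defs.total_variation psi [set (k + x)%R | k in K] <= C%:E)%E.
Proof.
move=> rpsi [K0 [cK0 nK0 bK0]] cK.
have TV0 A : (0 <= Defs.total_variation psi A)%E.
  by rewrite /Defs.total_variation adde_ge0.
set S := ereal_sup _ in bK0.
have HS x : (Defs.total_variation psi [set (k + x)%R | k in K0] <= S)%E.
  by apply: ereal_sup_ubound; exists x.
have Sfin : S \is a fin_num.
  by rewrite ge0_fin_numE //; apply: le_trans (HS 0).
have [|s [_ sK]] := @compact_finite_cover G K
   (fun x => [set y | K0 (y - x)]) cK.
  by move=> x Kx; apply: (@addr_continuous G (- x) x K0); rewrite /= subrr.
pose c := fine S; have SE : S = c%:E by rewrite /c fineK.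
exists ((size s)%:R * c).
  by rewrite mulr_ge0 // fine_ge0 // (le_trans (TV0 _) (HS 0)).
move=> x.
have mT y L : compact L -> measurable ([set (k + y)%R | k in L] : set (borel G)).
  by move=> cL; apply: borel_compact; exact: compact_addr.
apply: (le_trans (@total_variation_subadditive psi s
  (fun z => [set (k + (z + x))%R | k in K0]) _ (mT _ _ cK) (fun z => mT _ _ cK0) _)).
  move=> _ [k Kk <-]; have [z zs K0k] := sK _ Kk.
  by exists z => //; exists (k - z) => //; rewrite addrA subrK.
apply: (@le_trans _ _ (\sum_(z <- s) S)%E); first by apply: lee_sum.
rewrite SE; elim: s {sK} => [|z s IH]; first by rewrite big_nil mul0r.
by rewrite big_cons /= -nat1r mulrDl mul1r EFinD leeD2l.
Qed.

Lemma tb_measuresP psi :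
  tb_measures psi <-> linear psi /\ uniformly_bounded psi.
Proof.
split=> [[rpsi tpsi]|[lpsi bpsi]].
  split=> [|K cK]; first exact: rpsi.1.
  have [C C0 HC] := total_variation_translates rpsi tpsi cK.
  exists C => // x f e Cf fK fe.
  have e0 : 0 <= e by exact: le_trans (fe 0).
  rewrite -lee_fin mulrC EFinM.
  apply: (@le_trans _ _ (e%:E * Defs.total_variation psi [set (k + x)%R | k in K])%E).
    apply: ev_le_total_variation => //; first exact: compact_addr.
    move=> y yK; apply: fK => Ky; apply: yK; exists (y - x) => //.
    by rewrite subrK.
  by apply: lee_wpmul2l; rewrite ?lee_fin.
have rpsi : radon psi.
  split=> // K /bpsi[C C0 HC]; exists C => f e fK fe.
  rewrite -evE; apply: (HC 0) => //; first exact: CcP.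
  by move=> y; rewrite subr0 => yK; apply: tsupp0 => /fK.
split=> //.
have [K [cK nK _]] := @compact_nbhs G _ 0 setT (filterT).
have [f [Cf f01 [W oW [KW fW]] [L [cL LU fL]]]] := urysohn_Cc (R := R) cK openT
  (@subsetT _ _).
have [C C0 HC] := bpsi _ cL.
exists K; split=> //; apply: (@le_lt_trans _ _ (3 * (C * 1))%:E); last exact: ltry.
apply: ge_ereal_sup => _ [x _ <-].
apply: (@total_variation_le psi _ (fun y => f (y + - x))) => //.
- exact: compact_addr.
- exact: in_Cc_shift.
- by move=> y; have /andP[] := f01 (y - x).
- by move=> _ [k Kk <-]; rewrite addrK fW //; exact: KW.
- move=> g Cg gf; apply: (HC x) => //.
    move=> y yL; have := gf y; rewrite fL // => ?.
    by apply/eqP; rewrite eq_le andbC.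
  move=> y; have /andP[g0 gfy] := gf y; rewrite ger0_norm //.
  by apply: (le_trans gfy); have /andP[] := f01 (y - x).
Qed.

Lemma tb_measuresB psi psi' (a : R) : tb_measures psi -> tb_measures psi' ->
  tb_measures (psi - (fun f : Cc R G => a * psi' f)).
Proof.
move=> /tb_measuresP[l b] /tb_measuresP[l' b']; apply/tb_measuresP; split.
  move=> c f g; rewrite /= -[LHS]/(psi _ - a * psi' _) l l'.
  rewrite -[RHS]/(c * (psi f - a * psi' f) + (psi g - a * psi' g)).
  by rewrite -2![_ *: _]/(c * _); ring.
move=> K cK; have [C C0 HC] := b _ cK; have [C' C'0 HC'] := b' _ cK.
exists (C + `|a| * C'); first by rewrite addr_ge0 // mulr_ge0.
move=> x f e Cf fK fe; rewrite mulrDl.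
apply: (le_trans (ler_normB _ _)); apply: lerD; first exact: (HC x).
by rewrite normrM -mulrA ler_wpM2l //; exact: (HC' x).
Qed.

End TranslationBounded.

(** * The Haar integral and correlations of functions *)

Section HaarFunctional.
Context {R : realType} {G : topologicalZmodType} {lcaG : LCA G}.
Context {haar : {measure set (borel G) -> \bar R}} (haarP : haar_measure haar).
Implicit Types (f g u v w : G -> R) (K U : set G).

Definition hint (m : {measure set (borel G) -> \bar R}) : Cc R G -> R :=
  fun f : Cc R G => \int[m]_x (f : borel G -> R) x.

Local Notation I := (ev (hint haar)).

Lemma haar_fin K : compact K -> (haar K < +oo)%E.
Proof. by have [[+ _ _] _ _] := haarP; apply. Qed.

Lemma hint_linear : linear (hint haar).
Proof. exact: (Rintegral_Cc_linear haar_fin). Qed.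

Lemma hint_ge0 : nonneg_measure (hint haar).
Proof. exact: Rintegral_Cc_ge0. Qed.

Lemma hintE f : in_Cc f -> I f = \int[haar]_x (f : borel G -> R) x.
Proof. by move=> Cf; rewrite /ev /hint toCcE. Qed.

Lemma hint_squeezed : squeezed haar (hint haar).
Proof.
split=> [f K cK Cf *|f K cK Cf *]; rewrite hintE //.
  exact: (Rintegral_Cc_le_measure haar_fin cK).
exact: (measure_le_Rintegral_Cc haar_fin cK).
Qed.

Lemma haar_addr K (a : G) : compact K ->
  haar [set (x + a)%R | x in K] = haar K.
Proof.
move=> cK; have [_ inv _] := haarP.
rewrite -(inv a K (borel_compact cK)); congr (haar _).
by apply/seteqP; split=> _ [x Kx <-]; exists x => //; rewrite addrC.
Qed.

(** Translates of compact sets have equal Haar measure, so the translated integral is squeezed by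
    [haar] too and uniqueness applies. *)
Lemma hint_shift f (a : G) : in_Cc f -> I (fun x => f (x + a)) = I f.
Proof.
pose J := fun f : Cc R G => I (fun x => f (x + a)).
suff JE : J = hint haar.
  by move=> Cf; rewrite -[in RHS]JE [RHS]/ev /J toCcE.
have evJ g : in_Cc g -> ev J g = I (fun x => g (x + a)).
  by move=> Cg; rewrite {1}/ev /J toCcE.
have off K g x : (forall x, ~ K x -> g x = 0) ->
    ~ [set (x - a)%R | x in K] x -> g (x + a) = 0.
  by move=> gK Kx; apply: gK => Kxa; apply: Kx; exists (x + a) => //; rewrite addrK.
apply: (squeezed_unique haar_fin) hint_squeezed.
- move=> c h g; rewrite /J /= -[RHS]/(c * I _ + I _).
  have Cfa : in_Cc (fun x => h (x + a)) by apply: in_Cc_shift; exact: CcP.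
  have Cga : in_Cc (fun x => g (x + a)) by apply: in_Cc_shift; exact: CcP.
  rewrite -(evZ hint_linear) // -(evD hint_linear) //.
  exact: in_CcZ.
- exact: hint_linear.
have [up lo] := hint_squeezed.
split=> g K cK Cg g0 gK; rewrite evJ // -(haar_addr (- a) cK).
  apply: up => //; [exact: compact_addr|exact: in_Cc_shift|].
  by move=> x; exact: off.
apply: lo => //; [exact: compact_addr|exact: in_Cc_shift|].
by move=> _ [x Kx <-]; rewrite subrK; exact: gK.
Qed.

(** If U were null, so would be every compact set, which finitely many translates of U cover; inner
    regularity would then make Haar measure vanish. *)
Lemma haar_open_gt0 U (x : G) : open U -> U x -> (0 < haar U)%E.
Proof.
move=> oU Ux; rewrite lt0e measure_ge0 andbT; apply/eqP => U0.
have [[_ _ inn] inv] := haarP; apply; rewrite inn; last exact: openT.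
apply/eqP; rewrite eq_le; apply/andP; split; last first.
  by apply: ereal_sup_ubound; exists set0; [split=> //; exact: compact0|].
apply: ge_ereal_sup => _ [K [cK _] <-].
have nU : nbhs x U by apply: open_nbhs_nbhs.
have [|s [_ Ks]] := @compact_finite_cover G K (fun y => [set z | U (z + (x - y))]) cK.
  move=> y Ky; apply: (@addr_continuous G (x - y) y U).
  by rewrite /= addrCA subrr addr0.
have E y : [set z | U (z + (x - y))] = [set (y - x + z)%R | z in U].
  apply/seteqP; split=> [z Uz|_ [z Uz <-]] /=.
    by exists (z + (x - y)) => //; rewrite addrCA -opprB addNr addr0.
  by rewrite addrAC -(opprB y x) addrN add0r.
have mE y : measurable ([set z | U (z + (x - y))] : set (borel G)).
  apply: borel_open.
  have -> : [set z | U (z + (x - y))] = (fun z => z + (x - y)) @^-1` U by [].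
  by apply: open_comp => // z _; exact: addr_continuous.
apply: (@le_trans _ _ (haar (\big[setU/set0]_(y <- s)
    ([set z | U (z + (x - y))] : set (borel G))))).
  apply: le_measure; rewrite ?inE //.
  - exact: borel_compact.
  - exact: bigsetU_measurable.
  - by move=> y /Ks[z zs Uz]; rewrite (big_rem z) //=; left.
elim: {Ks} s => [|y s IH]; first by rewrite big_nil measure0.
rewrite big_cons; apply: (le_trans (measureU2 _ _ _)) => //.
  exact: bigsetU_measurable.
rewrite -[leRHS]adde0; apply: leeD => //.
rewrite (E y) -U0 le_eqVlt; apply/orP; left; apply/eqP.
exact: (inv (y - x) U (borel_open oU)).
Qed.

Lemma hint_gt0 f (x : G) : in_Cc f -> (forall x, 0 <= f x) -> 0 < f x -> 0 < I f.
Proof.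
move=> Cf f0 fx.
have : nbhs x [set y | f x / 2 < f y].
  apply: (Cf.1 x [set r | f x / 2 < r]); apply: open_nbhs_nbhs.
  by split; [exact: open_gt|rewrite /=; lra].
move=> /compact_nbhs[K [cK xK KU]].
have c0 : 0 < 2 / f x by rewrite divr_gt0.
have Cg : in_Cc (fun y => 2 / f x * f y) by exact: in_CcZ.
have := hint_squeezed.2 _ _ cK Cg _ _; rewrite (evZ hint_linear) //.
have hK : (0 < haar K)%E.
  apply: (lt_le_trans (haar_open_gt0 (@open_interior _ K) xK)).
  apply: le_measure; rewrite ?inE; [|exact: borel_compact|exact: interior_subset].
  by apply: borel_open; exact: open_interior.
move=> H; have : (haar K <= (2 / f x * I f)%:E)%E.
  apply: H => [y|y /KU /= fy]; first by rewrite mulr_ge0 // ltW.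
  by rewrite mulrAC ler_pdivlMr // mul1r; lra.
by move=> /(lt_le_trans hK); rewrite lte_fin pmulr_rgt0.
Qed.

Lemma hint_norm_le f g : in_Cc f -> in_Cc g -> (forall x, `|f x| <= g x) ->
  `|I f| <= I g.
Proof.
move=> Cf Cg fg; rewrite ler_norml -(evN hint_linear) //.
apply/andP; split; apply: (ev_le hint_linear hint_ge0) => //;
  try exact: in_CcN; by move=> x; have := fg x; rewrite ler_norml => /andP[].
Qed.

(* [hcorr m u v] is the convolution of u with the reflection of v. *)
Definition hcorr (m : {measure set (borel G) -> \bar R}) u v (x : G) :=
  ev (hint m) (fun y => u (x + y) * v y).

Local Notation corr := (hcorr haar).

Lemma in_Cc_corr_integrand u v (x : G) : in_Cc u -> in_Cc v ->
  in_Cc (fun y => u (x + y) * v y).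
Proof.
move=> Cu; apply: in_CcM => y.
by apply: continuous_comp; [exact: addl_continuous|exact: Cu.1].
Qed.

Lemma corr_supp u v K U x : (forall y, ~ K y -> u y = 0) ->
  (forall y, ~ U y -> v y = 0) -> ~ [set z.1 + z.2 | z in K `*` [set - y | y in U]] x ->
  corr u v x = 0.
Proof.
move=> uK vU KUx; rewrite /hcorr.
have -> : (fun y => u (x + y) * v y) = (fun=> 0); last exact: (ev0 hint_linear).
apply/funext => y; have [Uy|/vU ->] := pselect (U y); last by rewrite mulr0.
have [Kxy|/uK ->] := pselect (K (x + y)); last by rewrite mul0r.
exfalso; apply: KUx; exists (x + y, - y) => /=; last by rewrite addrK.
by split=> //=; exists y.
Qed.

Lemma corr_near u u' v v' (d : R) x x' : in_Cc u -> in_Cc v -> in_Cc u' ->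
  (forall y, `|u (x + y) - u' (x' + y)| <= d) ->
  `|corr u v x - corr u' v x'| <= d * I (fun y => `|v y|).
Proof.
move=> Cu Cv Cu' ud; rewrite -(evB hint_linear); [|exact: in_Cc_corr_integrand..].
rewrite -(evZ hint_linear); last exact: in_Cc_norm.
apply: hint_norm_le.
- by apply: in_CcB; exact: in_Cc_corr_integrand.
- by apply: in_CcZ; exact: in_Cc_norm.
- by move=> y; rewrite -mulrBl normrM ler_wpM2r.
Qed.

Lemma in_Cc_corr u v : in_Cc u -> in_Cc v -> in_Cc (corr u v).
Proof.
move=> Cu Cv; have [cu [K cK uK]] := (in_CcP _).1 Cu.
have [cv [L cL vL]] := (in_CcP _).1 Cv.
apply/in_CcP; split; last first.
  exists [set z.1 + z.2 | z in K `*` [set - y | y in L]].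
    by apply: compact_add => //; exact: compact_opp.
  by move=> x; exact: corr_supp.
move=> x; apply/cvgrPdist_le => e e0.
set J := I (fun y => `|v y|).
have J0 : 0 <= J by apply: (ev_ge0 hint_ge0 (in_Cc_norm Cv)).
have d0 : 0 < e / (J + 1) by rewrite divr_gt0 //; lra.
have H := unif_cont Cu d0.
have : nbhs x [set y | forall z, `|u (z + (y - x)) - u z| < e / (J + 1)].
  apply: (@addr_continuous G (- x) x
    [set h | forall z, `|u (z + h) - u z| < e / (J + 1)]).
  rewrite /= subrr; exact: H.
apply: filterS => y uy.
apply: (le_trans (@corr_near _ u _ v (e / (J + 1)) _ _ Cu Cv Cu _)).
  move=> z; rewrite distrC ltW //; have := uy (x + z).
  by rewrite (_ : x + z + (y - x) = y + z) // addrC addrA subrK.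
rewrite -/J mulrAC ler_pdivrMr; nra.
Qed.

Lemma corr_shift u v (a b x : G) : in_Cc u -> in_Cc v ->
  corr (fun y => u (y + a)) (fun y => v (y + b)) x = corr u v (x + a - b).
Proof.
move=> Cu Cv; rewrite /hcorr.
have C1 : in_Cc (fun y => u (x + a - b + y) * v y) by exact: in_Cc_corr_integrand.
rewrite -(hint_shift b C1); congr ev; apply/funext => y.
by congr (u _ * _); rewrite (addrC y b) addrA subrK addrAC.
Qed.

Lemma corrN u v x : in_Cc u -> in_Cc v -> corr u v (- x) = corr v u x.
Proof.
move=> Cu Cv; rewrite /hcorr.
have C1 : in_Cc (fun y => u (- x + y) * v y) by exact: in_Cc_corr_integrand.
rewrite -(hint_shift x C1); congr ev; apply/funext => y.
by rewrite mulrC (addrC y x) addKr.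
Qed.

Lemma corr_sum (n m : nat) (c : 'I_n -> R) (d : 'I_m -> R)
    (u : 'I_n -> G -> R) (v : 'I_m -> G -> R) x :
  (forall i, in_Cc (u i)) -> (forall i, in_Cc (v i)) ->
  corr (fun y => \sum_(i < n) c i * u i y) (fun y => \sum_(j < m) d j * v j y) x =
  \sum_(i < n) \sum_(j < m) c i * d j * corr (u i) (v j) x.
Proof.
move=> Cu Cv; rewrite /hcorr.
transitivity (I (fun y => \sum_(i < n) \sum_(j < m)
    c i * d j * (u i (x + y) * v j y))).
  congr ev; apply/funext => y; rewrite mulr_suml; apply: eq_bigr => i _.
  by rewrite mulr_sumr; apply: eq_bigr => j _; ring.
have C1 i j : in_Cc (fun y => u i (x + y) * v j y) by exact: in_Cc_corr_integrand.
rewrite (ev_sum hint_linear); last first.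
  by move=> i; apply: in_Cc_sum => j; exact: in_CcZ.
apply: eq_bigr => i _; rewrite (ev_sum hint_linear); last by move=> j; exact: in_CcZ.
by apply: eq_bigr => j _; rewrite (evZ hint_linear).
Qed.

(** The form is the integral of the square of the function y |-> sum_i c_i v(y + x_i). *)
Lemma corr_psd v (n : nat) (c : 'I_n -> R) (x : 'I_n -> G) : in_Cc v ->
  0 <= \sum_(i < n) \sum_(j < n) c i * c j * corr v v (x i - x j).
Proof.
move=> Cv; pose u i y := v (y + x i).
have Cu i : in_Cc (u i) by exact: in_Cc_shift.
rewrite (_ : \sum_(i < n) _ =
  corr (fun y => \sum_(i < n) c i * u i y) (fun y => \sum_(i < n) c i * u i y) 0).
  have Cs : in_Cc (fun y => \sum_(i < n) c i * u i y).
    by apply: (@in_Cc_sum _ _ _ _ _ (fun i y => c i * u i y)) => i; exact: in_CcZ.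
  apply: (ev_ge0 hint_ge0 (in_Cc_corr_integrand _ Cs Cs)).
  by move=> y; rewrite add0r -expr2 sqr_ge0.
rewrite corr_sum //; apply: eq_bigr => i _; apply: eq_bigr => j _.
by rewrite corr_shift // add0r.
Qed.

(** The product of two values of v is at most half the sum of their squares, and both squares have
    the same integral by invariance. *)
Lemma corr_le0 v x : in_Cc v -> `|corr v v x| <= corr v v 0.
Proof.
move=> Cv; have Cvv y : in_Cc (fun z => v (y + z) * v z) by exact: in_Cc_corr_integrand.
have Cvx : in_Cc (fun y => v (y + x) * v (y + x)).
  by apply: in_CcM; [case: (in_Cc_shift x Cv)|exact: in_Cc_shift].
have Cv0 : in_Cc (fun y => v (0 + y) * v y) by exact: Cvv.
have E : I (fun y => v (y + x) * v (y + x)) = corr v v 0.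
  have := hint_shift x Cv0; rewrite /hcorr => <-; congr ev; apply/funext => y.
  by rewrite add0r.
have -> : corr v v 0 = I (fun y => 2^-1 * (v (y + x) * v (y + x) + v (0 + y) * v y)).
  rewrite (evZ hint_linear) ?(evD hint_linear) // ?E; last exact: in_CcD.
  by rewrite /hcorr; lra.
apply: hint_norm_le => //; first by apply: in_CcZ; exact: in_CcD.
move=> y; rewrite add0r (addrC x).
have := sqr_ge0 (v (y + x) - v y); have := sqr_ge0 (v (y + x) + v y).
by rewrite !expr2 ler_norml => ? ?; apply/andP; split; lra.
Qed.

End HaarFunctional.

(** * Polynomial growth and amenability *)

Lemma exp_beats_poly (R : realType) (q A B : R) (r : nat) :
  1 < q -> 0 < A -> exists k, B * ((k.*2).+1%:R) ^+ r < A * q ^+ k.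
Proof.
move=> q1 A0; pose d := q - 1.
have d0 : 0 < d by rewrite /d; lra.
have bern j : j%:R * d <= q ^+ j.
  suff : 1 + j%:R * d <= q ^+ j by lra.
  elim: j => [|j IH]; first by rewrite mul0r expr0 addr0.
  have qE : q = 1 + d by rewrite /d; lra.
  rewrite exprS -nat1r; have := ler0n R j => j0.
  apply: (@le_trans _ _ (q * (1 + j%:R * d))); last by rewrite ler_pM2l //; lra.
  rewrite {1}qE; nra.
(* With k = j (r + 1), the bound [bern] gives q^k >= (j d)^(r + 1), while 2 k + 1 <= j c. The
   exponential side has one more factor j, and [T] is the threshold beyond which this factor
   wins. *)
pose c : R := (r.*2 + 3)%:R.
have c0 : 0 <= c by exact: ler0n.
pose T := `|B| * c ^+ r / (A * d ^+ r.+1).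
have D0 : 0 < A * d ^+ r.+1 by rewrite mulr_gt0 // exprn_gt0.
have T0 : 0 <= T.
  by apply: divr_ge0; [rewrite mulr_ge0 // exprn_ge0|exact: ltW].
pose j := (Num.bound T).+1.
have Tj : T < j%:R by apply: (lt_le_trans (archi_boundP T0)); rewrite ler_nat.
have j0 : 0 < j%:R :> R by rewrite ltr0n.
exists (j * r.+1)%N.
have h1 : (((j * r.+1).*2).+1)%:R <= j%:R * c :> R.
  rewrite /c -natrM ler_nat /j; nia.
apply: (@le_lt_trans _ _ (`|B| * (j%:R * c) ^+ r)).
  apply: (@le_trans _ _ (`|B| * (((j * r.+1).*2).+1)%:R ^+ r)).
    by rewrite ler_wpM2r ?exprn_ge0 // ler_norm.
  by rewrite ler_wpM2l // lerXn2r ?nnegrE ?mulr_ge0.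
apply: (@lt_le_trans _ _ (A * (j%:R * d) ^+ r.+1)).
  rewrite !exprMn (exprS j%:R) mulrCA mulrA.
  rewrite (_ : A * _ = j%:R ^+ r * (j%:R * (A * d ^+ r.+1))); last by ring.
  by rewrite -mulrA ltr_pM2l ?exprn_gt0 // -ltr_pdivrMr.
have qj0 : 0 <= q ^+ j by apply: exprn_ge0; lra.
have jd0 : 0 <= j%:R * d by rewrite mulr_ge0 // ltW.
by rewrite ler_pM2l // exprM lerXn2r ?nnegrE.
Qed.

Section Folner.
Context {R : realType} {G : topologicalZmodType} {lcaG : LCA G}.
Context {haar : {measure set (borel G) -> \bar R}} (haarP : haar_measure haar).
Local Notation I := (ev (hint haar)).
Local Notation corr := (hcorr haar).

Fixpoint iter_sum (K : set G) (n : nat) : set G :=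
  if n is n'.+1 then [set z.1 + z.2 | z in iter_sum K n' `*` K] else [set 0].

Lemma compact_iter_sum K n : compact K -> compact (iter_sum K n).
Proof.
move=> cK; elim: n => [|n IH] /=; first exact: compact_set1.
exact: compact_add.
Qed.

(** Finitely many translates K + z cover K + K. Since G is commutative, a sum of n of the elements z
    is determined by multiplicities between 0 and n, so (n + 1)^r translates of K cover the (n +
    1)-fold sums. *)
Lemma iter_sum_growth K : compact K -> nbhs (0 : G) K ->
  exists (r : nat) (F : 'I_r -> G), forall n x, iter_sum K n.+1 x ->
    exists m : {ffun 'I_r -> 'I_n.+1}, K (x - \sum_i F i *+ m i).
Proof.
move=> cK nK; have cKK := compact_add cK cK.
have [|s [_ sK]] := @compact_finite_cover G _ (fun z => [set y | K (y - z)]) cKK.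
  by move=> z _; apply: (@addr_continuous G (- z) z K); rewrite /= subrr.
exists (size s), (fun i => nth 0 s i); elim=> [|n IH] x.
  move=> [[_ k] [/= -> Kk] <-]; exists [ffun=> ord0].
  by rewrite big1 => [|i _]; rewrite ?ffunE // subr0 add0r.
move=> [[p k] [/= pP Kk] <-]; have [m Km] := IH _ pP.
have [z zs Kz] : exists2 z, z \in s & K (p - \sum_i nth 0 s (i : 'I_(size s)) *+ m i + k - z).
  by apply: sK; exists (p - \sum_i nth 0 s (i : 'I_(size s)) *+ m i, k).
have iz : (index z s < size s)%N by rewrite index_mem.
pose iz' := Ordinal iz.
have lt1 i : (m i + (i == iz') < n.+2)%N.
  by rewrite -addn1 -(addn1 n.+1) addnAC leq_add ?leq_b1 // addn1.
exists [ffun i => Ordinal (lt1 i)].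
rewrite (_ : \sum_i _ = \sum_i nth 0 s (i : 'I_(size s)) *+ m i + z).
  by rewrite opprD addrA (addrAC p).
transitivity (\sum_i (nth 0 s (i : 'I_(size s)) *+ m i +
    nth 0 s i *+ (i == iz'))).
  by apply: eq_bigr => i _; rewrite ffunE /= mulrnDr.
rewrite big_split /=; congr (_ + _); rewrite (bigD1 iz') //= eqxx mulr1n.
rewrite nth_index // big1 ?addr0 // => i /negPf ->.
by rewrite mulr0n.
Qed.

(* Amenability of G, from the polynomial growth of n |-> n K: the functions
   v_n lie between the indicators of n K and (n + 1) K, so their integrals
   cannot grow exponentially. *)
Lemma folner K (e : R) : compact K -> 0 < e < 1 -> exists v : G -> R,
  [/\ in_Cc v, forall x, 0 <= v x, 0 < corr v v 0 &
      forall x, K x -> (1 - e) * corr v v 0 <= corr v v x].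
Proof.
move=> cK /andP[e0 e1].
have [N [cN nN _]] := @compact_nbhs G _ 0 setT (filterT).
(* Adding a neighbourhood of 0 puts [P n] into the interior of [P n.+1], which makes room for the
   Urysohn functions [v n]. *)
pose L := K `|` N.
have cL : compact L by exact: compactU.
have nL : nbhs (0 : G) L by apply: filterS nN; right.
have L0 : L 0 := nbhs_singleton nL.
pose P := iter_sum L.
have cP n : compact (P n) by exact: compact_iter_sum.
have Pint n : P n `<=` interior (P n.+1).
  move=> x Px; rewrite /interior.
  have : nbhs x [set y | L (y - x)].
    by apply: (@addr_continuous G (- x) x L); rewrite /= subrr.
  by apply: filterS => y Ly; exists (x, y - x) => //=; rewrite addrC subrK.
have P0 n : P n 0.
  elim: n => [|n IH] //; exists (0, 0) => //=; by rewrite addr0.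
have /choice[v Hv] n : exists v : G -> R, [/\ in_Cc v, forall x, 0 <= v x <= 1,
    forall x, P n x -> v x = 1 & forall x, ~ P n.+1 x -> v x = 0].
  have [v [Cv v01 [W oW [PW vW]] [M [cM MU vM]]]] :=
    urysohn_Cc (R := R) (cP n) (@open_interior _ _) (@Pint n).
  exists v; split=> // [x /PW/vW//|x Px].
  by apply: vM => /MU/interior_subset.
have Cv n : in_Cc (v n) by have [] := Hv n.
have v0 n x : 0 <= v n x by have [_ /(_ x)/andP[]] := Hv n.
have v1 n x : v n x <= 1 by have [_ /(_ x)/andP[]] := Hv n.
have vP n x : P n x -> v n x = 1 by have [_ _ + _] := Hv n; apply.
have vN n x : ~ P n.+1 x -> v n x = 0 by have [_ _ _] := Hv n; apply.
have c0 n : 0 < corr (v n) (v n) 0.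
  rewrite /hcorr; apply: (hint_gt0 haarP (x := 0)).
  - exact: in_Cc_corr_integrand.
  - by move=> x; rewrite mulr_ge0.
  - by rewrite add0r vP // mulr1.
pose a n := I (v n).
have a0 n : 0 < a n by apply: (hint_gt0 haarP (x := 0)) => //; rewrite vP.
(* [v n] vanishes off [P n.+1]; for y in this set, both y and x + y lie in [P n.+2], where [v n.+2]
   equals 1. *)
have low n x : K x -> a n <= corr (v n.+2) (v n.+2) x.
  move=> Kx; apply: (ev_le (hint_linear haarP) hint_ge0) => //.
    exact: in_Cc_corr_integrand.
  move=> y; have [Py|Py] := pselect (P n.+1 y); last first.
    by rewrite vN // mulr_ge0.
  have Py2 : P n.+2 y by exists (y, 0) => //=; rewrite addr0.
  have Pxy2 : P n.+2 (x + y).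
    by exists (y, x) => //=; [split=> //=; left|rewrite addrC].
  by rewrite (vP n.+2 y Py2) (vP n.+2 (x + y) Pxy2) mulr1.
have up n : corr (v n) (v n) 0 <= a n.
  apply: (ev_le (hint_linear haarP) hint_ge0) => //.
    exact: in_Cc_corr_integrand.
  by move=> y; rewrite -[leRHS]mul1r ler_wpM2r.
apply: contrapT => H.
(* If no v works, then in particular [v n.+2] fails, and the integrals grow by the factor 1 / (1 -
   e) every two indices; hence the doubled index below. *)
have step n : a n <= (1 - e) * a n.+2.
  apply: contrapT => /negP; rewrite -ltNge => an; apply: H; exists (v n.+2).
  split=> // x Kx; apply: le_trans (low n x Kx); apply: le_trans (ltW an).
  by rewrite ler_pM2l ?up //; lra.
have [r [F HF]] := iter_sum_growth cL nL.
(* The support of [v n] is covered by (n + 1)^r translates of L, and the corresponding translates of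
   [v 1] equal 1 there. *)
have grow n : a n <= n.+1%:R ^+ r * a 1%N.
  pose w (m : {ffun 'I_r -> 'I_n.+1}) x := v 1%N (x - \sum_i F i *+ m i).
  have Cw m : in_Cc (w m) by exact: in_Cc_shift.
  apply: (@le_trans _ _ (I (fun x => \sum_(m <- index_enum {ffun 'I_r -> 'I_n.+1}) w m x))).
    apply: (ev_le (hint_linear haarP) hint_ge0) => //; first exact: in_Cc_sum.
    move=> x; have [Px|Px] := pselect (P n.+1 x); last first.
      by rewrite vN //; apply: sumr_ge0 => m _; exact: v0.
    have [m Lm] := HF _ _ Px; rewrite (bigD1 m) //=.
    have -> : w m x = 1.
      by rewrite /w vP //; exists (0, x - \sum_i F i *+ m i) => //=; rewrite add0r.
    rewrite (le_trans (v1 _ _)) // lerDl; apply: sumr_ge0 => m' _; exact: v0.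
  rewrite (ev_sum (hint_linear haarP)) //.
  rewrite (eq_bigr (fun=> a 1%N)); last by move=> m _; rewrite (hint_shift haarP).
  rewrite big_const iter_addr_0 -[leLHS]mulr_natl.
  rewrite (eq_card (B := {: {ffun 'I_r -> 'I_n.+1}})) //.
  by rewrite card_ffun !card_ord natrX.
have q1 : 1 < (1 - e)^-1 by rewrite invf_gt1 //; lra.
have exp k : a 0%N * (1 - e)^-1 ^+ k <= a k.*2.
  elim: k => [|k IH]; first by rewrite mulr1.
  rewrite exprSr mulrA ler_pdivrMr; last by lra.
  by apply: (le_trans IH); rewrite doubleS mulrC; exact: step.
have [k Hk] := exp_beats_poly (a 1%N) r q1 (a0 0%N).
have := lt_le_trans Hk (le_trans (exp k) (grow k.*2)).
by rewrite (mulrC (a 1%N)) ltxx.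
Qed.

End Folner.

(** * The Schur product theorem *)

Section Schur.
Context {R : realType} {n : nat}.
Implicit Types M N : 'I_n -> 'I_n -> R.

Definition psd M := forall c : 'I_n -> R, 0 <= \sum_i \sum_j c i * c j * M i j.

Lemma sum_delta (p : 'I_n) (F : 'I_n -> R) : \sum_j (j == p)%:R * F j = F p.
Proof.
rewrite (bigD1 p) //= eqxx mul1r big1 ?addr0 // => j /negPf ->.
by rewrite mul0r.
Qed.

Lemma quad_shift M p (t : R) (c : 'I_n -> R) : (forall i j, M i j = M j i) ->
  \sum_i \sum_j (c i + (i == p)%:R * t) * (c j + (j == p)%:R * t) * M i j =
  \sum_i \sum_j c i * c j * M i j + 2 * t * (\sum_j c j * M p j) + t ^+ 2 * M p p.
Proof.
move=> sM.
have inner i (b : R) : \sum_j b * (c j + (j == p)%:R * t) * M i j =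
    b * (\sum_j c j * M i j) + b * t * M i p.
  rewrite -(sum_delta p (fun j => b * t * M i j)) mulr_sumr -big_split.
  by apply: eq_bigr => j _ /=; ring.
under eq_bigr => i _ do rewrite inner.
have -> : \sum_i \sum_j c i * c j * M i j = \sum_i c i * \sum_j c j * M i j.
  by apply: eq_bigr => i _; rewrite mulr_sumr; apply: eq_bigr => j _; ring.
have E : \sum_j c j * M p j = \sum_i c i * M i p.
  by apply: eq_bigr => i _; rewrite sM.
transitivity (\sum_i (c i * (\sum_j c j * M i j) + t * (c i * M i p) +
   (i == p)%:R * (t * (\sum_j c j * M i j) + t ^+ 2 * M i p))).
  by apply: eq_bigr => i _; ring.
rewrite !big_split /= sum_delta -mulr_sumr -E; ring.
Qed.

Lemma quad_delta M p : \sum_i \sum_j (i == p)%:R * (j == p)%:R * M i j = M p p.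
Proof.
rewrite -[RHS](sum_delta p (M^~ p)); apply: eq_bigr => i _.
by rewrite -(sum_delta p (M i)) mulr_sumr; apply: eq_bigr => j _; ring.
Qed.

Lemma psd_diag M p : psd M -> 0 <= M p p.
Proof. by move=> /(_ (fun i => (i == p)%:R)); rewrite quad_delta. Qed.

Lemma psd_row0 M p i : (forall i j, M i j = M j i) -> psd M -> M p p = 0 ->
  M p i = 0.
Proof.
move=> sM pM Mp; apply/eqP/negPn/negP => Mpi.
(* Chosen so that the form takes the value -1 at e_i + t e_p. *)
pose t := - (M i i + 1) / (2 * M p i).
have := pM (fun j => (j == i)%:R + (j == p)%:R * t).
rewrite quad_shift // Mp mulr0 addr0 sum_delta quad_delta.
have -> : M i i + 2 * t * M p i = -1 by rewrite /t; field.
by rewrite ler0N1.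
Qed.

(* Schur's product theorem, by eliminating one pivot of M at a time. *)
Lemma schur_product M N : (forall i j, M i j = M j i) -> psd M -> psd N ->
  0 <= \sum_i \sum_j M i j * N i j.
Proof.
move=> sM pM pN.
suff : forall k M, (forall i j, M i j = M j i) -> psd M ->
    (forall i j : 'I_n, (k <= i)%N -> M i j = 0) ->
    0 <= \sum_i \sum_j M i j * N i j.
  by move=> /(_ n M sM pM); apply => i j; rewrite leqNgt ltn_ord.
elim=> [|k IH] {pM sM M} M sM pM zM.
  by rewrite big1 // => i _; rewrite big1 // => j _; rewrite zM ?mul0r.
have [kn|nk] := ltnP k n; last first.
  by apply: IH => // i j ki; have := ltn_ord i; rewrite ltnNge (leq_trans nk).
pose p := Ordinal kn.
have [Mp|Mp] := eqVneq (M p p) 0.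
  apply: IH => // i j; rewrite leq_eqVlt => /predU1P[ki|]; last exact: zM.
  by rewrite (_ : i = p); [exact: psd_row0|apply: val_inj].
have Mp0 : 0 <= M p p by exact: psd_diag.
(* The Schur complement of the pivot. The rank one matrix removed from M pairs with N to a positive
   multiple of the quadratic form of N at row p of M. *)
pose M' i j := M i j - M p i * M p j / M p p.
have E : \sum_i \sum_j M i j * N i j = \sum_i \sum_j M' i j * N i j +
    (M p p)^-1 * \sum_i \sum_j M p i * M p j * N i j.
  rewrite mulr_sumr -big_split; apply: eq_bigr => i _.
  rewrite mulr_sumr -big_split; apply: eq_bigr => j _.
  by rewrite /M' /=; ring.
rewrite E addr_ge0 //; last by rewrite mulr_ge0 ?invr_ge0.
apply: IH => [i j|c|i j]; first by rewrite /M' sM; ring.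
- pose s := \sum_j c j * M p j.
  (* This shift of coordinate p minimises the form of M in that coordinate, and the minimum is the
     form of [M']. *)
  have := pM (fun i => c i + (i == p)%:R * - (s / M p p)).
  rewrite quad_shift // -/s -addrA.
  have -> : \sum_i \sum_j c i * c j * M' i j =
      \sum_i \sum_j c i * c j * M i j - s * s / M p p.
    have -> : s * s / M p p = \sum_i \sum_j c i * c j * (M p i * M p j / M p p).
      rewrite {1}/s !mulr_suml; apply: eq_bigr => i _.
      by rewrite mulrAC mulr_sumr; apply: eq_bigr => j _; ring.
    rewrite -sumrB; apply: eq_bigr => i _; rewrite -sumrB; apply: eq_bigr => j _.
    by rewrite /M'; ring.
  suff -> : 2 * - (s / M p p) * s + (- (s / M p p)) ^+ 2 * M p p = - (s * s / M p p).
    by [].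
  by field.
- rewrite leq_eqVlt => /predU1P[ki|ki]; last first.
    by rewrite /M' zM // (sM p i) zM // !mul0r subrr.
  rewrite (_ : i = p); last exact: val_inj.
  by rewrite /M' mulrAC mulfV // mul1r subrr.
Qed.

End Schur.

(** * Measures of positive type against products of positive definite functions *)

Section PositiveType.
Context {R : realType} {G : topologicalZmodType} {lcaG : LCA G}.
Context {haar : {measure set (borel G) -> \bar R}} (haarP : haar_measure haar).
Local Notation I := (ev (hint haar)).
Local Notation corr := (hcorr haar).
Implicit Types (f g u v w F : G -> R) (K U : set G).

Let lI : linear (hint haar) := hint_linear haarP.

Lemma in_Cc_lincomb2 (n : nat) (c : 'I_n -> 'I_n -> R) (E : 'I_n -> 'I_n -> G -> R) :
  (forall i j, in_Cc (E i j)) ->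
  in_Cc (fun z => \sum_i \sum_j c i j * E i j z).
Proof.
move=> CE; apply: (@in_Cc_sum _ _ _ _ _ (fun i z => \sum_j c i j * E i j z)) => i.
by apply: (@in_Cc_sum _ _ _ _ _ (fun j z => c i j * E i j z)) => j; exact: in_CcZ.
Qed.

Lemma ev_lincomb2 (psi : Cc R G -> R) (n : nat) (c : 'I_n -> 'I_n -> R)
    (E : 'I_n -> 'I_n -> G -> R) : linear psi -> (forall i j, in_Cc (E i j)) ->
  ev psi (fun z => \sum_i \sum_j c i j * E i j z) =
  \sum_i \sum_j c i j * ev psi (E i j).
Proof.
move=> lpsi CE; rewrite (@ev_sum _ _ _ _ lpsi _ _ (fun i z => \sum_j c i j * E i j z)).
  apply: eq_bigr => i _.
  rewrite (@ev_sum _ _ _ _ lpsi _ _ (fun j z => c i j * E i j z)).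
    by apply: eq_bigr => j _; rewrite (evZ lpsi).
  by move=> j; exact: in_CcZ.
move=> i; apply: (@in_Cc_sum _ _ _ _ _ (fun j z => c i j * E i j z)) => j.
exact: in_CcZ.
Qed.

Lemma continuous_subl f (z : G) : continuous f -> continuous (fun y => f (z - y)).
Proof.
by move=> cf y; apply: continuous_comp; [exact: subl_continuous|exact: cf].
Qed.

Lemma continuous_addl f (z : G) : continuous f -> continuous (fun y => f (z + y)).
Proof.
by move=> cf y; apply: continuous_comp; [exact: addl_continuous|exact: cf].
Qed.

(** A partition of unity subordinate to translates of U, weighted by v, has the coefficients as its
    integrals. Points and coefficients are chosen before F, so one discrete measure serves every F
    with small oscillation over U. *)
Lemma riemann_sum v K U : in_Cc v -> (forall x, 0 <= v x) -> compact K ->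
  (forall x, ~ K x -> v x = 0) -> nbhs (0 : G) U ->
  exists (n : nat) (x : 'I_n -> G) (c : 'I_n -> R),
    [/\ forall i, 0 <= c i, forall i, K (x i) &
      forall F (e : R), continuous F ->
        (forall y y', U (y - y') -> `|F y - F y'| <= e) ->
        `|I (fun y => v y * F y) - \sum_i c i * F (x i)| <= e * I v].
Proof.
move=> Cv v0 cK vK nU.
have /choice[h Hh] (x : G) : exists h : G -> R, [/\ in_Cc h, forall y, 0 <= h y,
    h x = 1 & forall y, ~ U (y - x) -> h y = 0].
  pose U' := (fun y => y - x) @^-1` (interior U).
  have oU' : open U'.
    by apply: open_comp; [move=> y _; exact: addr_continuous|exact: open_interior].
  have [|h [Ch h01 [W oW [KW hW]] [L [cL LU hL]]]] :=
      urysohn_Cc (R := R) (@compact_set1 _ x) oU'.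
    by move=> _ ->; rewrite /U' /= subrr.
  exists h; split=> //.
  - by move=> y; have /andP[] := h01 y.
  - by apply: hW; exact: KW.
  - by move=> y yU; apply: hL => /LU/interior_subset.
have [|s [sK Ks]] := @compact_finite_cover G K (fun x => [set y | 2^-1 < h x y]) cK.
  move=> x _; have [Ch _ hx _] := Hh x.
  apply: (Ch.1 x [set r | 2^-1 < r]); rewrite hx; apply: open_nbhs_nbhs.
  by split=> /=; [exact: open_gt|lra].
pose x (i : 'I_(size s)) := nth 0 s i.
pose H y := \sum_i h (x i) y.
have Ch i : in_Cc (h i) by have [] := Hh i.
have h0 i y : 0 <= h i y by have [_ + _ _] := Hh i; apply.
have cH : continuous H.
  have : in_Cc H by exact: in_Cc_sum.
  by case.
(* On K the sum [H] exceeds 1/2, so division by m is exact normalisation there; elsewhere the floor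
   1/2 keeps m positive while v vanishes. *)
pose m y := Num.max (H y) 2^-1.
have m0 y : 0 < m y by rewrite lt_max orbC invr_gt0 ltr0n.
have cm : continuous (fun y => (m y)^-1).
  move=> y; apply: continuousV; first by rewrite gt_eqF.
  by apply: (@continuous_max R G H (cst 2^-1)); [exact: cH|exact: cvg_cst].
pose p i y := v y * (h (x i) y * (m y)^-1).
have Cp i : in_Cc (p i).
  apply: in_CcMr => // y.
  by apply: (@continuousM R G (h (x i)) (fun y => (m y)^-1));
    [case: (Ch (x i)) => + _; apply|exact: cm].
have p0 i y : 0 <= p i y.
  by rewrite mulr_ge0 // mulr_ge0 // invr_ge0 ltW.
have sump y : \sum_i p i y = v y.
  have [Ky|Ky] := pselect (K y); last first.
    by rewrite vK // big1 // => i _; rewrite /p vK // mul0r.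
  rewrite -mulr_sumr -mulr_suml -/(H y) /m; suff Hy : 2^-1 < H y.
    by rewrite (max_idPl (ltW Hy)) mulfV ?mulr1 // gt_eqF // (lt_trans _ Hy).
  have [z zs /= hz] := Ks _ Ky; apply: (lt_le_trans hz).
  have iz : (index z s < size s)%N by rewrite index_mem.
  rewrite /H (bigD1 (Ordinal iz)) //= /x /= nth_index // lerDl.
  by apply: sumr_ge0 => i _.
exists (size s), x, (fun i => I (p i)); split.
- by move=> i; apply: ev_ge0 => //; exact: hint_ge0.
- by move=> i; apply: sK; exact: mem_nth.
move=> F e cF Fe.
have CpF i : in_Cc (fun y => p i y * F y) by exact: in_CcMr.
have CpFx i : in_Cc (fun y => F (x i) * p i y) by exact: in_CcZ.
have -> : I (fun y => v y * F y) = \sum_i I (fun y => p i y * F y).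
  rewrite -(ev_sum lI) //; congr ev; apply/funext => y.
  by rewrite -mulr_suml sump.
have -> : I v = \sum_i I (p i).
  by rewrite -(ev_sum lI) //; congr ev; apply/funext => y.
rewrite mulr_sumr -sumrB; apply: (le_trans (ler_norm_sum _ _ _)).
apply: ler_sum => i _; rewrite mulrC -!(evZ lI) // -(evB lI) //.
apply: (hint_norm_le haarP); [exact: in_CcB|exact: in_CcZ|move=> y].
have -> : p i y * F y - F (x i) * p i y = p i y * (F y - F (x i)) by ring.
rewrite normrM (ger0_norm (p0 i y)) mulrC.
have [Uy|Uy] := pselect (U (y - x i)); first by rewrite ler_wpM2r // Fe.
have -> : p i y = 0.
  by rewrite /p; have [_ _ _ ->] := Hh (x i); rewrite ?mul0r ?mulr0.
by rewrite !mulr0.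
Qed.

(** Complex coefficients force a real positive definite function to be even; real ones do not, so
    evenness is a clause of its own. *)
Definition rpd f := (forall x, f (- x) = f x) /\
  forall n (c : 'I_n -> R) (x : 'I_n -> G),
    0 <= \sum_i \sum_j c i * c j * f (x i - x j).

Context {nu : Cc R G -> R} (rnu : radon nu).
Hypothesis pnu : forall u, in_Cc u -> 0 <= ev nu (corr u u).

(* f . (v * v~) is a limit of the functions
   sum_ij c_i c_j f(x_i - x_j) (w_i * w_j~), where sum_i c_i delta_{x_i}
   approximates v dx and w_i is a bump at x_i; on these nu is nonnegative by
   Schur's theorem. *)
Lemma pos_type_mul_corr f v : continuous f -> rpd f -> in_Cc v ->
  (forall x, 0 <= v x) -> 0 <= ev nu (fun x => f x * corr v v x).
Proof.
move=> cf [fN fpd] Cv v0; have lnu := rnu.1.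
have [_ [K cK vK]] := (in_CcP _).1 Cv.
pose Kd := [set z.1 + z.2 | z in K `*` [set - y | y in K]].
have cKd : compact Kd by apply: compact_add => //; exact: compact_opp.
have [N0 [cN0 nN0 _]] := @compact_nbhs G _ 0 setT (filterT).
pose Kb := [set z.1 + z.2 | z in Kd `*` N0].
have cKb : compact Kb by exact: compact_add.
have KdKb : Kd `<=` Kb.
  move=> x Kx; exists (x, 0); rewrite /= ?addr0 //; split=> //=.
  exact: nbhs_singleton nN0.
have [chi [Cchi chi01 [W oW [KW chiW]] _]] := urysohn_Cc (R := R) cKb openT
  (@subsetT _ _).
(* f itself need not be uniformly continuous; [ft] is, and it agrees with f on [Kb], which contains
   all the supports involved. *)
pose ft x := f x * chi x.
have Cft : in_Cc ft by exact: in_CcM.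
have ftE x : Kb x -> ft x = f x by move=> /KW/chiW; rewrite /ft => ->; rewrite mulr1.
have [Mf Mf0 ftM] := in_Cc_bounded Cft.
have Ccv : in_Cc (corr v v) by exact: in_Cc_corr.
have [Mc Mc0 cM] := in_Cc_bounded Ccv.
have [C C0 HC] := radon_bound rnu cKb.
pose g x := f x * corr v v x.
have Cg : in_Cc g by exact: in_CcM.
have cv0 x : ~ Kd x -> corr v v x = 0 by exact: corr_supp.
have gE x : g x = ft x * corr v v x.
  have [Kx|/cv0] := pselect (Kd x); first by rewrite /g ftE //; exact: KdKb.
  by rewrite /g => ->; rewrite !mulr0.
set Iv := I v.
have Iv0 : 0 <= Iv by apply: ev_ge0 => //; exact: hint_ge0.
(* In units of the tolerance d, [A] bounds the error of [T] against v * v~, and [B] that of the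
   approximant u against f . (v * v~). *)
pose A := Iv * (Iv + 1) + Iv.
have A0 : 0 <= A by rewrite /A; nra.
pose B := Mf * A + Mc + A.
have B0 : 0 <= B by rewrite /B; nra.
suff claim (d : R) : 0 < d -> d <= 1 -> exists u, [/\ in_Cc u,
    forall x, ~ Kb x -> u x = 0, 0 <= ev nu u & forall x, `|g x - u x| <= d * B].
  apply/ler_addgt0Pl => e e0.
  pose d := Num.min 1 (e / (C * B + 1)).
  have CB1 : 0 < C * B + 1 by nra.
  have d0 : 0 < d by rewrite lt_min ltr01 divr_gt0.
  have d1 : d <= 1 by rewrite ge_min lexx.
  have de : d * (C * B + 1) <= e.
    by rewrite -ler_pdivlMr // ge_min lexx orbT.
  have [u [Cu uK u0 gu]] := claim d d0 d1.
  have : `|ev nu g - ev nu u| <= C * (d * B).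
    rewrite -(evB lnu) //; apply: HC => //; first exact: in_CcB.
    by move=> x Kx; rewrite uK // /g cv0 ?mulr0 ?subrr // => /KdKb.
  by rewrite ler_norml => /andP[+ _]; rewrite -/g; nra.
move=> d0 d1.
have n1 : nbhs (0 : G) [set h | forall y, `|ft (y + h) - ft y| < d].
  exact: unif_cont.
have n2 : nbhs (0 : G) [set h | forall y, `|v (y + h) - v y| < d].
  exact: unif_cont.
have [V nV VN] := nbhs0_sub (filterI (filterI n1 n2) nN0).
have [|w [Cw w01 [W' oW' [W'0 wW']] [L [cL LV wL]]]] :=
    urysohn_Cc (R := R) (@compact_set1 _ (0 : G)) (@open_interior _ V).
  by move=> _ ->.
have w0 x : 0 <= w x by have /andP[] := w01 x.
have wV x : ~ V x -> w x = 0 by move=> Vx; apply: wL => /LV/interior_subset.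
have w00 : w 0 = 1 by apply: wW'; exact: W'0.
pose e := corr w w.
have Ce : in_Cc e by exact: in_Cc_corr.
have e0 x : 0 <= e x.
  apply: (ev_ge0 hint_ge0); first exact: in_Cc_corr_integrand.
  by move=> y; rewrite mulr_ge0.
have eV x : e x != 0 -> [/\ forall y, `|ft (y + x) - ft y| < d,
    forall y, `|v (y + x) - v y| < d & N0 x].
  move=> ex; suff [[z1 z2] [/= z1V [z3 z3V <-]] <-] :
      [set z.1 + z.2 | z in V `*` [set - y | y in V]] x.
    by have [[? ?] ?] := VN _ _ z1V z3V.
  by apply: contra_neqP ex; exact: corr_supp.
have eN x : e (- x) = e x by exact: corrN.
have e00 : 0 < e 0.
  apply: (hint_gt0 haarP (x := 0)).
  - exact: in_Cc_corr_integrand.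
  - by move=> y; rewrite mulr_ge0.
  - by rewrite addr0 w00 mulr1.
have eS a b z : corr (fun y => w (y + a)) (fun y => w (y + b)) z = e (z + a - b).
  exact: corr_shift.
clearbody e.
set Ie := I e.
have Ie0 : 0 < Ie by exact: (hint_gt0 haarP (x := 0)).
have dIe0 : 0 < d * Ie by rewrite mulr_gt0.
have n3 : nbhs (0 : G) [set h | forall y, `|e (y + h) - e y| < d * Ie].
  exact: unif_cont.
have [n [x [c [c0 xK rs]]]] := riemann_sum Cv v0 cK vK (filterI n3 n2).
have sumc : \sum_i c i = Iv.
  (* A constant function has oscillation 0, so the coefficients add up exactly to the integral of
     v. *)
  have : `|I (fun y => v y * 1) - \sum_i c i * 1| <= 0 * Iv.
    apply: (rs (fun=> 1)); first exact: cst_continuous.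
    by move=> y y' _; rewrite subrr normr0.
  have -> : (fun y => v y * 1) = v by apply/funext => y; rewrite mulr1.
  under eq_bigr do rewrite mulr1.
  by rewrite mul0r normr_le0 subr_eq0 => /eqP.
have xKd i j : Kd (x i - x j).
  by exists (x i, - x j) => //=; split=> //=; exists (x j).
pose E i j z := e (z - (x i - x j)).
have CE i j : in_Cc (E i j) by exact: in_Cc_shift.
pose u z := Ie^-1 * \sum_i \sum_j c i * c j * f (x i - x j) * E i j z.
(* [T] is [u] without the values of f: a discretised v * v~ mollified by e. As [E i j] is
   concentrated near x_i - x_j, replacing f(x_i - x_j) by [ft z] costs at most d. *)
pose T z := Ie^-1 * \sum_i \sum_j c i * c j * E i j z.
have uT z : `|u z - ft z * T z| <= d * T z.
  have -> : u z - ft z * T z = Ie^-1 * \sum_i \sum_j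
      c i * c j * (E i j z * (f (x i - x j) - ft z)).
    rewrite /u /T mulrCA -mulrBr mulr_sumr -sumrB; congr (_ * _).
    apply: eq_bigr => i _; rewrite mulr_sumr -sumrB; apply: eq_bigr => j _.
    by ring.
  rewrite /T mulrCA normrM ger0_norm ?invr_ge0 ?ler_pM2l ?invr_gt0 ?(ltW Ie0) //.
  rewrite mulr_sumr; apply: (le_trans (ler_norm_sum _ _ _)); apply: ler_sum => i _.
  rewrite mulr_sumr; apply: (le_trans (ler_norm_sum _ _ _)); apply: ler_sum => j _.
  rewrite normrM ger0_norm ?mulr_ge0 // [leRHS]mulrCA ler_wpM2l ?mulr_ge0 //.
  rewrite normrM ger0_norm ?e0 // mulrC.
  have [->|/eV[H _ _]] := eqVneq (E i j z) 0; first by rewrite !mulr0.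
  rewrite ler_wpM2r ?e0 // ltW // -ftE; last exact: KdKb.
  rewrite distrC; have := H (x i - x j).
  by rewrite (_ : x i - x j + (z - (x i - x j)) = z) // addrC subrK.
have step2 z : `|I (fun y => v y * e (z - y)) - v z * Ie| <= d * Ie.
  have C1 : in_Cc (fun y => v y * e (z - y)).
    by apply: in_CcMr => //; apply: continuous_subl; exact: Ce.1.
  have C2 : in_Cc (fun y => v (y + z) * e y).
    by apply: in_CcMr; [exact: in_Cc_shift|exact: Ce.1].
  rewrite -(hint_shift haarP z C1).
  rewrite (_ : (fun y => v (y + z) * e (z - (y + z))) = fun y => v (y + z) * e y).
    have Cve : in_Cc (fun y => v z * e y) by exact: in_CcZ.
    rewrite -(evZ lI (v z) Ce) -(evZ lI d Ce) -(evB lI C2 Cve).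
    apply: (hint_norm_le haarP); [exact: in_CcB|exact: in_CcZ|].
    move=> y; rewrite -mulrBl normrM (ger0_norm (e0 _)).
    have [->|/eV[_ H _]] := eqVneq (e y) 0; first by rewrite !mulr0.
    by rewrite ler_wpM2r // (addrC y z) ltW.
  by apply/funext => y; rewrite (addrC y z) opprD addNKr eN.
have step2' z j : `|Ie^-1 * (\sum_i c i * E i j z) - v (z + x j)| <= d * Iv + d.
  have cF : continuous (fun y => e (z + x j - y)).
    by apply: continuous_subl; exact: Ce.1.
  have h2 := rs _ (d * Ie) cF; have {}h2 := h2 _; have h1 := step2 (z + x j).
  set J := I _ in h1 h2; have ES : \sum_i c i * e (z + x j - x i) = \sum_i c i * E i j z.
    by apply: eq_bigr => i _; rewrite /E opprB addrA.
  rewrite ES in h2; set S := \sum_i _ in h2 *.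
  have {}h2 : `|J - S| <= d * Ie * Iv.
    apply: h2 => y y' [/(_ (z + x j - y)) + _].
    by rewrite addrA subrK distrC => /ltW.
  have -> : Ie^-1 * S - v (z + x j) = Ie^-1 * (S - v (z + x j) * Ie).
    by rewrite mulrBr mulrCA mulVf ?mulr1 // gt_eqF.
  rewrite normrM ger0_norm ?invr_ge0 ?(ltW Ie0) // mulrC ler_pdivrMr //.
  move: h1 h2; rewrite !ler_norml => /andP[? ?] /andP[? ?].
  by apply/andP; split; lra.
have step3 z : `|corr v v z - \sum_j c j * v (z + x j)| <= d * Iv.
  have cF : continuous (fun y => v (z + y)).
    by apply: continuous_addl; exact: Cv.1.
  have -> : corr v v z = I (fun y => v y * v (z + y)).
    by rewrite /hcorr; congr ev; apply/funext => y; rewrite mulrC.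
  apply: (rs _ d cF) => y y' [_ /(_ (z + y'))].
  by rewrite (_ : z + y' + (y - y') = z + y) ?(addrC y) ?addrA ?addrK // => /ltW.
have Tc z : `|T z - corr v v z| <= d * A.
  have -> : T z = \sum_j c j * (Ie^-1 * \sum_i c i * E i j z).
    rewrite /T exchange_big mulr_sumr; apply: eq_bigr => j _.
    by rewrite mulrCA; congr (_ * _); rewrite mulr_sumr; apply: eq_bigr => i _; ring.
  have h : `|\sum_j c j * (Ie^-1 * \sum_i c i * E i j z) - \sum_j c j * v (z + x j)|
      <= (d * Iv + d) * Iv.
    rewrite -sumrB -{2}sumc mulr_sumr; apply: (le_trans (ler_norm_sum _ _ _)).
    apply: ler_sum => j _; rewrite -mulrBr normrM ger0_norm // mulrC.
    by rewrite ler_wpM2r.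
  have := step3 z; move: h; rewrite /A !ler_norml => /andP[? ?] /andP[? ?].
  by apply/andP; split; lra.
have CuI : in_Cc (fun z => \sum_i \sum_j c i * c j * f (x i - x j) * E i j z).
  exact: (in_Cc_lincomb2 (fun i j => c i * c j * f (x i - x j)) CE).
have Cu : in_Cc u by exact: in_CcZ.
exists u; split=> //.
- move=> z Kz; rewrite /u big1 ?mulr0 // => i _; rewrite big1 // => j _.
  suff -> : E i j z = 0 by rewrite mulr0.
  apply: contra_notP Kz => /eqP/eV[_ _ N0z].
  by exists (x i - x j, z - (x i - x j)) => //=; rewrite addrC subrK.
- have -> : ev nu u = Ie^-1 * \sum_i \sum_j f (x i - x j) *
      (c i * c j * ev nu (E i j)).
    rewrite (evZ lnu _ CuI).
    rewrite (ev_lincomb2 (fun i j => c i * c j * f (x i - x j)) lnu CE).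
    by congr (_ * _); apply: eq_bigr => i _; apply: eq_bigr => j _; ring.
  rewrite mulr_ge0 ?invr_ge0 ?(ltW Ie0) //.
  apply: (@schur_product _ _ (fun i j => f (x i - x j))).
  + by move=> i j; rewrite -(fN (x i - x j)) opprB.
  + by move=> b; exact: fpd.
  (* The second factor in Schur's theorem is the Gram form nu(W * W~) for W = sum_i b_i c_i w(. -
     x_i), nonnegative by hypothesis on nu. *)
  move=> b; pose wi i y := w (y + - x i).
  have Cwi i : in_Cc (wi i) by exact: in_Cc_shift.
  have Cs : in_Cc (fun y => \sum_i (b i * c i) * wi i y).
    by apply: (@in_Cc_sum _ _ _ _ _ (fun i y => b i * c i * wi i y)) => i; exact: in_CcZ.
  have := pnu Cs; rewrite (_ : corr _ _ =
    fun z => \sum_i \sum_j (b i * c i) * (b j * c j) * E i j z); last first.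
    apply/funext => z; rewrite (corr_sum haarP (fun i => b i * c i)
      (fun i => b i * c i) z Cwi Cwi).
    apply: eq_bigr => i _; apply: eq_bigr => j _; congr (_ * _).
    by rewrite eS /E opprB opprK addrAC addrA.
  rewrite (ev_lincomb2 (fun i j => b i * c i * (b j * c j)) lnu CE).
  by congr (0 <= _); apply: eq_bigr => i _; apply: eq_bigr => j _; ring.
- move=> z; rewrite gE.
  have := Tc z; have := uT z; have := ftM z; have := cM z.
  set t := T z; set k := corr v v z; set a := ft z => hk ha hu ht.
  have h1 : `|a * (k - t)| <= Mf * (d * A).
    by rewrite normrM ler_pM // distrC.
  have h2 : a * k - u z = a * (k - t) - (u z - a * t) by ring.
  rewrite h2; apply: (le_trans (ler_normB _ _)); apply: (le_trans (lerD h1 hu)).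
  have dA : d * A <= A by rewrite ler_piMl.
  have tM : t <= Mc + A.
    by move: hk ht; rewrite !ler_norml => /andP[_ ?] /andP[_ ?]; lra.
  have : d * t <= d * (Mc + A) by rewrite ler_pM2l.
  by rewrite /B; lra.
Qed.

End PositiveType.

(** * Tiles and the norm of X *)

Section AmalgamSpace.
Context {R : realType} {G : topologicalZmodType} {lcaG : LCA G}.
Context {haar : {measure set (borel G) -> \bar R}}.
Context {G0 Lambda L B : set G} (dataP : tiling_data haar G0 Lambda L B).
Implicit Types (f g phi : G -> R) (K : set G) (p : G * G).

Definition tile (A : set G) p : set G := [set (p.2 + p.1 + b)%R | b in A].

Definition tile_sup f p : \bar R := ereal_sup [set `|f (p.2 + p.1 + b)|%:E | b in B].

Lemma borel_shift (A : set G) (c : G) : measurable (A : set (borel G)) ->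
  measurable ([set x | A (x + c)] : set (borel G)).
Proof.
move=> mA; suff : measurable_fun [set: borel G] ((fun x => x + c) : borel G -> borel G).
  by move=> /(_ measurableT A mA); rewrite setTI.
apply: (@measurability _ _ (borel G) (borel G) _ _ (@open G) erefl).
move=> _ [U oU <-]; rewrite setTI; apply: borel_open.
by apply: open_comp => // x _; exact: addr_continuous.
Qed.

Lemma tileE (A : set G) p : tile A p = [set x | A (x + - (p.2 + p.1))].
Proof.
apply/seteqP; split=> [_ [b Bb <-]|x Ax] /=; first by rewrite addrC addKr.
by exists (x - (p.2 + p.1)) => //; rewrite addrC subrK.
Qed.

Lemma tile_measurable p : measurable (tile B p : set (borel G)).
Proof.
have [_ _ _ [_ mB _ _ _] _] := dataP.
by rewrite tileE; exact: borel_shift.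
Qed.

Lemma tile_compact p : compact (tile (closure B) p).
Proof.
have [_ _ _ [_ _ pB _ _] _] := dataP.
by apply: compact_addl; rewrite -precompactE.
Qed.

Lemma tile_cover (x : G) : exists2 p, (L `*` Lambda) p & tile B p x.
Proof.
have [_ HL _ _ HB] := dataP.
have [m [[Lm G0m] _]] := HL x; have [[l b] [[/= Ll Bb E] _]] := HB _ G0m.
exists (l, m) => //; exists b => //=.
by rewrite -addrA -E addrC subrK.
Qed.

Lemma tile_sup_ge0 f p : (0 <= tile_sup f p)%E.
Proof.
have [_ _ [b Bb _]] := tile_cover 0.
apply: (@le_trans _ _ `|f (p.2 + p.1 + b)|%:E); first by rewrite lee_fin.
by apply: ereal_sup_ubound; exists b.
Qed.

Lemma tile_sup_ub f p x : tile B p x -> (`|f x|%:E <= tile_sup f p)%E.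
Proof. by move=> [b Bb <-]; apply: ereal_sup_ubound; exists b. Qed.

(** Isolation at 0 gives a neighbourhood W such that W - W meets L in 0 only, so every translate of
    W contains at most one point of L. *)
Lemma discrete_compact_finite K : compact K -> finite_set (L `&` K).
Proof.
have [_ _ [sL _ iL _ _] _ _] := dataP => cK.
have : isolated L 0 by rewrite iL; exact: sL.1.
move=> [_ [V nV VL]]; have [W nW WV] := nbhs0_sub nV.
have [|s [_ Ks]] := @compact_finite_cover G K (fun x => [set y | W (y - x)]) cK.
  by move=> x _; apply: (@addr_continuous G (- x) x W); rewrite /= subrr.
apply: (@sub_finite_set _ _ (\bigcup_(x in [set` s]) (L `&` [set y | W (y - x)]))).
  by move=> y [Ly /Ks[x xs Wy]]; exists x.
apply: bigcup_finite => // x _.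
have [[y0 [Ly0 Wy0]]|nex] := pselect (exists y, L y /\ W (y - x)); last first.
  apply: (@sub_finite_set _ _ set0) => // y [Ly Wy]; apply: nex; by exists y.
apply: (@sub_finite_set _ _ [set y0]) => // y [Ly Wy] /=.
have : (V `&` L) (y - y0).
  split; last exact: sL.2.
  by rewrite (_ : y - y0 = (y - x) - (y0 - x)); [exact: WV|rewrite opprB addrA subrK].
by rewrite VL => /= /eqP; rewrite subr_eq0 => /eqP.
Qed.

(** K meets finitely many cosets of the open subgroup G0; for each representative m, the lattice
    part is confined to the compact set (K - m) - closure B. *)
Lemma tiles_finite K : compact K ->
  finite_set [set p | (L `*` Lambda) p /\ exists2 x, tile B p x & K x].
Proof.
move=> cK; have [[sG0 oG0 _ _] HL [_ LG0 _ _ _] [BG0 _ pB _ _] _] := dataP.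
have G0D x y : G0 x -> G0 y -> G0 (x + y).
  move=> Gx Gy; rewrite -(opprK y); apply: sG0.2 => //.
  by rewrite -sub0r; apply: sG0.2 => //; exact: sG0.1.
have /choice[rep repP] (x : G) : exists m, Lambda m /\ G0 (x - m).
  by have [m [? _]] := HL x; exists m.
have [|s [_ Ks]] := @compact_finite_cover G K (fun x => [set y | G0 (y - x)]) cK.
  move=> x _; apply: (@addr_continuous G (- x) x G0); rewrite /= subrr.
  by apply: open_nbhs_nbhs; split=> //; exact: sG0.1.
have repE x m b l : Lambda m -> L l -> B b -> G0 (m + l + b - x) -> m = rep x.
  move=> Lm Ll Bb Gx; have [m' [[_ _] um]] := HL x.
  rewrite -(um _ (repP x)); apply/esym/um; split=> //.
  rewrite (_ : x - m = (l + b) - (m + l + b - x)).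
    by apply: sG0.2 => //; apply: G0D; [exact: LG0|exact: BG0].
  by rewrite opprB [RHS]addrC -(addrA m) opprD (addrA x) subrK.
pose M : set G := [set rep x | x in [set` s]].
have finM : finite_set M by exact: finite_image.
pose KM m : set G :=
  [set z.1 + z.2 | z in [set (x - m)%R | x in K] `*` [set - b | b in closure B]].
apply: (@sub_finite_set _ _ (\bigcup_(m in M) ((L `&` KM m) `*` [set m]))).
  move=> [l m] [/= [Ll Lm] [_ [b Bb <-] /=]] Kx.
  have [x xs /= Gx] := Ks _ Kx.
  exists m; first by exists x => //; rewrite (repE x m b l).
  split=> //=; split=> //; exists (m + l + b - m, - b) => /=.
    split=> /=; first by exists (m + l + b).
    by exists b => //; exact: subset_closure.
  by rewrite addrAC addrK addrAC addrN add0r.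
apply: bigcup_finite => // m _; apply: finite_setX; last exact: finite_set1.
apply: discrete_compact_finite; apply: compact_add; first exact: compact_addr.
by apply: compact_opp; rewrite -precompactE.
Qed.

Lemma Cc_amalgam f : in_Cc f -> C_inf1 Lambda L B f.
Proof.
move=> Cf; have [cf [K cK fK]] := (in_CcP _).1 Cf; split=> //.
have [M M0 fM] := in_Cc_bounded Cf.
have Mp p : (tile_sup f p <= M%:E)%E.
  by apply: ge_ereal_sup => _ [b _ <-]; rewrite lee_fin.
have [s sE] := (finite_seqP _).1 (tiles_finite cK).
rewrite /norm_inf1 (_ : (fun p => _) = tile_sup f) //.
apply: (@le_lt_trans _ _ ((size s)%:R * M)%:E); last exact: ltry.
apply: ge_ereal_sup => _ [A [finA AL] <-].
have [t tE] := (finite_seqP _).1 finA.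
rewrite (@fsbigE _ _ _ _ _ (undup t)) ?undup_uniq //; last 2 first.
- by move=> x /=; rewrite mem_undup tE.
- by move=> i; rewrite tE /= mem_undup => ->.
apply: (@le_trans _ _ (\sum_(i <- undup t | i \in s) tile_sup f i)%E).
  rewrite big_mkcond [leRHS]big_mkcond; apply: lee_sum => i _.
  case: ifPn => [/set_mem Ai|_]; last by case: ifP => // _; exact: tile_sup_ge0.
  case: ifPn => // /negP its; rewrite le_eqVlt; apply/orP; left; apply/eqP.
  rewrite /tile_sup; have [_ _ [b0 Bb0 _]] := tile_cover 0.
  apply/eqP; rewrite eq_le tile_sup_ge0 andbT; apply: ge_ereal_sup => _ [b Bb <-].
  rewrite lee_fin fK ?normr0 // => Kx; apply: its.
  suff : [set` s] i by [].
  by rewrite -sE; split; [exact: AL|exists (i.2 + i.1 + b) => //; exists b].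
apply: (@le_trans _ _ (\sum_(i <- undup t | i \in s) M%:E)%E); first exact: lee_sum.
pose r := [seq i <- undup t | i \in s]; rewrite -big_filter -/r.
apply: (@le_trans _ _ ((size r)%:R * M)%:E).
  elim: r => [|i r IH]; first by rewrite big_nil mul0r.
  by rewrite big_cons /= -nat1r mulrDl mul1r EFinD leeD2l.
rewrite lee_fin ler_wpM2r ?(ltW M0) // ler_nat; apply: uniq_leq_size.
  by rewrite filter_uniq // undup_uniq.
by move=> i; rewrite mem_filter => /andP[].
Qed.

(** Lambda may be uncountable, but the norm is nearly attained on finite sets of tiles. A tile on
    which f is nonzero cannot be missed by all of them, since its contribution would exceed the
    remaining deficit. *)
Lemma amalgam_exhaust f : C_inf1 Lambda L B f ->
  exists (t : nat -> seq (G * G)) (S : R),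
   [/\ forall n m p, (n <= m)%N -> p \in t n -> p \in t m,
       forall n, (\sum_(p <- t n) tile_sup f p <= S%:E)%E &
       forall x, f x != 0 -> exists n, exists2 p, p \in t n & tile B p x].
Proof.
move=> [cf]; rewrite /norm_inf1 (_ : (fun p => _) = tile_sup f) //.
set E := esum _ _ => Efin.
have E0 : (0 <= E)%E by apply: esum_ge0 => p _; exact: tile_sup_ge0.
have EE : E = (fine E)%:E by rewrite fineK // ge0_fin_numE.
have sub (s : seq (G * G)) : uniq s -> {subset s <= L `*` Lambda} ->
    (\sum_(p <- s) tile_sup f p <= E)%E.
  move=> us sL; apply: ereal_sup_ubound; exists [set` s].
    by split; [exact: finite_seq|move=> p /= /sL; rewrite inE].
  by rewrite -fsbig_seq.
have /choice[s Hs] (n : nat) : exists s : seq (G * G), [/\ uniq s,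
    {subset s <= L `*` Lambda} & (E - (n.+1%:R^-1)%:E < \sum_(p <- s) tile_sup f p)%E].
  have n0 : 0 < n.+1%:R^-1 :> R by rewrite invr_gt0.
  have Ef : E \is a fin_num by rewrite ge0_fin_numE.
  have [_ [A [finA AL] <-] lt] := ub_ereal_sup_adherent n0 Ef.
  have [r rE] := (finite_seqP _).1 finA.
  exists (undup r); split; first exact: undup_uniq.
    by move=> p; rewrite mem_undup inE => pr; apply: AL; rewrite rE.
  rewrite fsbig_seq ?undup_uniq // (_ : [set` undup r] = A) //.
  by rewrite rE; apply/seteqP; split=> p /=; rewrite mem_undup.
pose t n := undup (flatten [seq s k | k <- iota 0 n.+1]).
have tP n p : reflect (exists2 k, (k <= n)%N & p \in s k) (p \in t n).
  rewrite mem_undup; apply: (iffP flatten_mapP) => -[k kn pk]; exists k => //.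
    by move: kn; rewrite mem_iota add0n ltnS.
  by rewrite mem_iota add0n ltnS.
exists t, (fine E); split.
- by move=> n m p nm /tP[k kn pk]; apply/tP; exists k => //; exact: leq_trans nm.
- move=> n; rewrite -EE; apply: sub; first exact: undup_uniq.
  by move=> p /tP[k _ pk]; have [_ sL _] := Hs k; exact: sL.
move=> x fx; have [p Lp px] := tile_cover x.
have [|nex] := pselect (exists k, p \in s k).
  by move=> [k pk]; exists k, p => //; apply/tP; exists k.
have fx0 : 0 < `|f x| by rewrite normr_gt0.
(* Now 1 / (n + 1) < |f x|, so adding the tile p to [s n] would push the sum above the norm. *)
exfalso; pose n := Num.bound (`|f x|^-1).
have [us sL lt] := Hs n.
have : (\sum_(q <- p :: s n) tile_sup f q <= E)%E.
  apply: sub => /=; first by rewrite us andbT; apply/negP => pn; apply: nex; exists n.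
  by move=> q; rewrite in_cons => /predU1P[->|/sL//]; exact: mem_set.
rewrite big_cons => le1.
have : (`|f x|%:E + (E - (n.+1%:R^-1)%:E) < E)%E.
  by apply: lt_le_trans le1; apply: lee_ltD => //; exact: tile_sup_ub.
rewrite EE -EFinB -EFinD lte_fin => h.
have : `|f x|^-1 < n.+1%:R.
  by apply: (lt_le_trans (archi_boundP _)); rewrite ?invr_ge0 // ler_nat.
have n0 : 0 < n.+1%:R :> R by rewrite ltr0n.
rewrite -(ltr_pM2l fx0) mulfV ?gt_eqF // => h1.
have : n.+1%:R^-1 * 1 < n.+1%:R^-1 * (`|f x| * n.+1%:R) by rewrite ltr_pM2l ?invr_gt0.
rewrite mulr1 mulrCA mulVf ?mulr1 ?gt_eqF // => h2.
move: h; rewrite addrCA gtrDl subr_lt0 => /(lt_trans h2).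
by rewrite ltxx.
Qed.

End AmalgamSpace.

(** * Integrals of functions in X *)

Section AmalgamPairing.
Context {R : realType} {G : topologicalZmodType} {lcaG : LCA G}.
Context {haar : {measure set (borel G) -> \bar R}}.
Context {G0 Lambda L B : set G} (dataP : tiling_data haar G0 Lambda L B).
Implicit Types (f g phi : G -> R) (K : set G) (p : G * G).

(** Local supremum times mass of the tile, summed over finitely many tiles, bounds the integral of
    |f| by S C; monotone convergence along the exhaustion finishes, as f vanishes outside it. *)
Lemma amalgam_integrable (m : {measure set (borel G) -> \bar R}) (C : R) f :
  (forall p, (m (tile B p) <= C%:E)%E) -> C_inf1 Lambda L B f ->
  m.-integrable [set: borel G] (EFin \o (f : borel G -> R)).
Proof.
move=> mC Xf; have [t [S [tmon tS tx]]] := amalgam_exhaust dataP Xf.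
have mf := borel_continuous Xf.1.
have mT p : measurable (tile B p : set (borel G)) by exact: (tile_measurable dataP).
have s0 p : (0 <= tile_sup (B := B) f p)%E by exact: (tile_sup_ge0 dataP).
have sfin n p : p \in t n -> tile_sup (B := B) f p \is a fin_num.
  move=> pt; rewrite ge0_fin_numE //; apply: (le_lt_trans _ (ltry S)).
  apply: le_trans (tS n); rewrite (big_rem p) //= leeDl //.
  by apply: sume_ge0.
pose A n : set (borel G) := \big[setU/set0]_(p <- t n) tile B p.
have mA n : measurable (A n) by exact: bigsetU_measurable.
have inA n x : A n x <-> exists2 p, p \in t n & tile B p x.
  rewrite /A; split.
    elim: (t n) => [|p s IH]; first by rewrite big_nil.
    rewrite big_cons => -[Tp|/IH[q qs Tq]]; first by exists p => //; rewrite mem_head.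
    by exists q => //; rewrite inE qs orbT.
  by move=> [p pt Tp]; rewrite (big_rem p) //=; left.
have ndA : nondecreasing_seq A.
  move=> n k nk; rewrite subsetEset => x /inA[p pt Tp]; apply/inA.
  by exists p => //; exact: tmon pt.
have mabs : measurable_fun [set: borel G] (fun x => `|(f x)%:E|)%E.
  by apply/measurable_EFinP; apply: measurableT_comp.
have bound n : (\int[m]_(x in A n) `|(f x)%:E| <= (S * C)%:E)%E.
  pose h x : \bar R := (\sum_(p <- t n) (fine (tile_sup (B := B) f p))%:E *
    (\1_(tile B p : set (borel G)) x)%:E)%E.
  have mh (p : G * G) : measurable_fun [set: borel G]
      (fun x => (fine (tile_sup (B := B) f p))%:E * (\1_(tile B p : set (borel G)) x)%:E)%E.
    by apply/measurable_EFinP; apply: measurable_funM.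
  have h0 (p : G * G) (x : borel G) :
      (0 <= (fine (tile_sup (B := B) f p))%:E * (\1_(tile B p : set (borel G)) x)%:E)%E.
    by rewrite mule_ge0 // lee_fin ?fine_ge0.
  apply: (@le_trans _ _ (\int[m]_(x in A n) h x)%E).
    apply: ge0_le_integral => //.
    - exact: measurable_funTS.
    - apply: measurable_funTS; exact: emeasurable_sum.
    - move=> x /inA[p pt Tp]; rewrite /h (big_rem p) //=.
      apply: (@le_trans _ _ (fine (tile_sup (B := B) f p))%:E).
        by rewrite fineK ?(sfin n) //; exact: tile_sup_ub.
      rewrite indicE mem_set // mule1 leeDl //.
      by apply: sume_ge0 => q _; exact: h0.
  apply: (@le_trans _ _ (\int[m]_(x in [set: borel G]) h x)%E).
    apply: ge0_subset_integral => //; first exact: emeasurable_sum.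
    by move=> x _; apply: sume_ge0 => p _; exact: h0.
  rewrite ge0_integral_sum //.
  apply: (@le_trans _ _ (\sum_(p <- t n) tile_sup (B := B) f p * C%:E)%E).
    rewrite big_seq [leRHS]big_seq; apply: lee_sum => p pt.
    rewrite ge0_integralZl_EFin //; last 2 first.
    - by apply/measurable_EFinP.
    - exact: fine_ge0.
    rewrite integral_indic // setIT fineK ?(sfin n) //.
    by apply: lee_wpmul2l.
  have C0 : 0 <= C.
    by rewrite -lee_fin; apply: le_trans (mC (0, 0)).
  rewrite -ge0_sume_distrl // EFinM.
  by apply: lee_wpmul2r => //; rewrite lee_fin.
apply/integrableP; split; first exact/measurable_EFinP.
apply: (@le_lt_trans _ _ (S * C)%:E); last exact: ltry.
have -> : (\int[m]_(x in [set: borel G]) `|(EFin \o f) x| =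
    \int[m]_(x in \bigcup_n A n) `|(f x)%:E|)%E.
  rewrite [RHS]integral_mkcond; apply: eq_integral => x _ /=.
  rewrite patchE; case: ifPn => // /negP Ax.
  have [->|/tx[n ptx]] := eqVneq (f x) 0; first by rewrite normr0.
  by exfalso; apply: Ax; apply/mem_set; exists n => //; apply/inA.
have cv := @ge0_nondecreasing_set_cvg_integral _ _ _ A (fun x => `|(f x)%:E|)%E m
  ndA mA (fun n => measurable_funTS mabs) (fun n x _ => abse_ge0 _).
rewrite -(cvg_lim _ cv) //; apply: lime_le; first by apply/cvg_ex; eexists; exact: cv.
by apply: nearW => n; exact: bound.
Qed.

(** Dominated convergence with |f| as majorant. The sets K n are fixed before psi, so that one
    sequence of cutoffs can serve several measures; values near 1 are allowed on K n because the
    normalised functions v * v~ are controlled only up to a small error. *)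
Lemma amalgam_approx f : C_inf1 Lambda L B f -> exists K : nat -> set G,
  (forall n, compact (K n)) /\
  forall psi (phi : nat -> G -> R), tb_measures psi ->
    (forall n, [/\ in_Cc (phi n), forall x, 0 <= phi n x <= 1 &
       forall x, K n x -> 1 - n.+1%:R^-1 <= phi n x]) ->
    (fun n => ev psi (fun x => f x * phi n x)) @ \oo --> pairing f psi.
Proof.
move=> Xf; have [t [S [tmon tS tx]]] := amalgam_exhaust dataP Xf.
have cf := Xf.1.
exists (fun n => \big[setU/set0]_(p <- t n) tile (closure B) p); split.
  by move=> n; apply: bigsetU_compact => p _; exact: (tile_compact dataP).
move=> psi phi tbpsi Hphi; have [rpsi tpsi] := tbpsi.
have [_ _ _ [_ _ pB _ _] _] := dataP.
have cB : compact (closure B) by rewrite -precompactE.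
have [C C0 HC] := total_variation_translates rpsi tpsi cB.
have Cphi n : in_Cc (phi n) by have [] := Hphi n.
have Cfphi n : in_Cc (fun x => f x * phi n x) by exact: in_CcM.
have phi01 n x : 0 <= phi n x <= 1 by have [_ + _] := Hphi n; apply.
have lim x : (fun n => f x * phi n x) @ \oo --> f x.
  have [fx0|/tx[n0 [p pt Tp]]] := eqVneq (f x) 0.
    by rewrite fx0; under eq_fun do rewrite mul0r; exact: cvg_cst.
  rewrite -[X in _ --> X]mulr1; apply: cvgM; first exact: cvg_cst.
  apply: (@squeeze_cvgr _ _ _ _ (fun n => 1 - n.+1%:R^-1) (fun=> 1)).
  - exists n0 => // n /= n0n; have /andP[_ ->] := phi01 n x; rewrite andbT.
    have [_ _] := Hphi n; apply.
    have pn : p \in t n by exact: tmon pt.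
    rewrite (big_rem p) //=; left; have [b Bb <-] := Tp.
    by exists b => //; exact: subset_closure.
  - rewrite -[X in _ --> X]subr0; apply: cvgB; first exact: cvg_cst.
    exact: cvg_harmonic.
  - exact: cvg_cst.
have main (m : {measure set (borel G) -> \bar R}) :
    (forall p, (m (tile B p) <= C%:E)%E) ->
    (fun n => \int[m]_x ((f x * phi n x) : R)) @ \oo --> \int[m]_x (f : borel G -> R) x.
  move=> mC; have i := amalgam_integrable mC Xf.
  have mf := borel_continuous cf.
  rewrite /Rintegral.
  have ifin : (\int[m]_x (f x)%:E)%E \is a fin_num by apply: integrable_fin_num.
  have mphi n : measurable_fun [set: borel G] (fun x => (f x * phi n x)%:E).
    by apply/measurable_EFinP; apply: borel_continuous; case: (Cfphi n).
  have mE : measurable_fun [set: borel G] (fun x => (f x)%:E).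
    exact/measurable_EFinP.
  have lE : {ae m, forall x, [set: borel G] x ->
      (fun n => (f x * phi n x)%:E) @ \oo --> (f x)%:E}.
    by apply: aeW => x _; apply: cvg_EFin; [exact: nearW|exact: lim].
  have dom : {ae m, forall x n, [set: borel G] x ->
      (`|(f x * phi n x)%:E| <= `|(f x)%:E|)%E}.
    apply: aeW => x n _; rewrite lee_fin normrM.
    have /andP[p0 p1] := phi01 n x; rewrite (ger0_norm p0).
    by rewrite -[leRHS]mulr1 ler_wpM2l.
  have ia : m.-integrable [set: borel G] (fun x => `|(f x)%:E|)%E.
    exact: integrable_abse.
  have [_ _] := dominated_convergence measurableT mphi mE lE ia dom.
  by move=> cv; apply: fine_cvg; rewrite fineK.
have TVp p : (Defs.total_variation psi (tile B p) <= C%:E)%E.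
  apply: le_trans (HC (p.2 + p.1)).
  have sub : tile B p `<=` [set (k + (p.2 + p.1))%R | k in closure B].
    by move=> _ [b Bb <-]; exists b; [exact: subset_closure|rewrite addrC].
  have mc : measurable ([set (k + (p.2 + p.1))%R | k in closure B] : set (borel G)).
    by apply: borel_compact; exact: compact_addr.
  by apply: leeD; apply: le_measure; rewrite ?inE //; exact: (tile_measurable dataP).
have c1 := main (pos_part psi) _; have c2 := main (neg_part psi) _.
rewrite /pairing (_ : (fun n => _) = fun n =>
  (\int[pos_part psi]_x ((f x * phi n x) : R)) - \int[neg_part psi]_x ((f x * phi n x) : R)).
  apply: cvgB; [apply: c1|apply: c2] => p; apply: le_trans (TVp p).
    by rewrite /Defs.total_variation leeDl.
  by rewrite /Defs.total_variation leeDr.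
by apply/funext => n; rewrite -(pairing_Cc rpsi (Cfphi n)).
Qed.

End AmalgamPairing.

(** * A Hahn-Banach theorem for sublinear functionals *)

Section HahnBanach.
Context {R : realType} {V : lmodType R}.
Implicit Types (p q : V -> R) (x y : V).

Definition sublinear p := (forall x y, p (x + y) <= p x + p y) /\
  (forall (a : R) x, 0 < a -> p (a *: x) <= a * p x).

Lemma sublinear0 p : sublinear p -> 0 <= p 0.
Proof. by move=> [pD _]; have := pD 0 0; rewrite addr0; lra. Qed.

Lemma sublinearZ p (a : R) x : sublinear p -> 0 < a -> a * p x <= p (a *: x).
Proof.
move=> [_ pZ] a0; have aV0 : 0 < a^-1 by rewrite invr_gt0.
have := pZ _ (a *: x) aV0; rewrite scalerA mulVf ?gt_eqF // scale1r => h.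
by rewrite -ler_pdivlMl.
Qed.

Lemma sublinear_opp p x : sublinear p -> - p (- x) <= p x.
Proof.
by move=> sp; have := sp.1 x (- x); rewrite subrr; have := sublinear0 sp; lra.
Qed.

(** The choice t = 1 gives q (x + y) - q y as an upper bound, so a q equal to all its tilts is
    superadditive. *)
Definition tilt q y x : R := inf [set q (x + t *: y) - t * q y | t in [set t : R | 0 <= t]].

Lemma tilt_lb q y x (t : R) : sublinear q -> 0 <= t ->
  - q (- x) <= q (x + t *: y) - t * q y.
Proof.
move=> sq; rewrite le_eqVlt => /predU1P[<-|t0].
  by rewrite scale0r addr0 mul0r subr0; exact: sublinear_opp.
have := sq.1 (x + t *: y) (- x); rewrite addrAC subrr add0r.
by have := sublinearZ y sq t0; lra.
Qed.

Lemma tilt_le q y x (t : R) : sublinear q -> 0 <= t ->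
  tilt q y x <= q (x + t *: y) - t * q y.
Proof.
move=> sq t0; apply: ge_inf; last by exists t.
by exists (- q (- x)) => _ [s s0 <-]; exact: tilt_lb.
Qed.

Lemma le_tilt q y x (c : R) :
  (forall t, 0 <= t -> c <= q (x + t *: y) - t * q y) -> c <= tilt q y x.
Proof.
move=> H; apply: lb_le_inf; last by move=> _ [t t0 <-]; exact: H.
by exists (q (x + 0 *: y) - 0 * q y), 0 => //=.
Qed.

Lemma tilt_sublinear q y : sublinear q -> sublinear (tilt q y).
Proof.
move=> sq; split=> [x x'|a x a0].
  rewrite -lerBlDr; apply: le_tilt => t t0; rewrite lerBlDr -lerBlDl.
  apply: le_tilt => t' t'0; rewrite lerBlDl.
  apply: (le_trans (tilt_le y _ sq (addr_ge0 t0 t'0))).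
  have := sq.1 (x + t *: y) (x' + t' *: y).
  by rewrite addrACA -scalerDl; lra.
rewrite -ler_pdivrMl //; apply: le_tilt => t t0; rewrite ler_pdivrMl //.
apply: (le_trans (tilt_le y _ sq (mulr_ge0 (ltW a0) t0))).
by have := sq.2 a (x + t *: y) a0; rewrite scalerDr scalerA; lra.
Qed.

(* A sublinear functional that is minimal below p is linear: it coincides with
   each of its tilts. *)
Lemma hahn_banach p : sublinear p ->
  exists nu : V -> R, linear nu /\ forall x, nu x <= p x.
Proof.
move=> sp; pose T := {q : V -> R | sublinear q /\ forall x, q x <= p x}.
(* The order is reversed: a maximal element for [Rl] is a minimal sublinear functional below p. *)
pose Rl (s t : T) := `[< forall x, sval t x <= sval s x >].
have [|||A totA|[q [sq qp]] /= qmin] := @Zorn T Rl.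
- by move=> t; apply/asboolP.
- move=> r s t /asboolP rs /asboolP st; apply/asboolP => x.
  exact: le_trans (st x) (rs x).
- move=> [s Ps] [t Pt] /asboolP /= st /asboolP /= ts.
  apply: eq_exist; apply/funext => x.
  by apply/eqP; rewrite eq_le ts st.
- have [[s0 As0]|A0] := pselect (exists s, A s); last first.
    exists (exist _ p (conj sp (fun x => lexx (p x)))) => s As.
    by exfalso; apply: A0; exists s.
  (* The infimum of the chain is finite because every member is at least -p(-x). For subadditivity,
     the smaller of two members serves both arguments. *)
  pose r x := inf [set sval s x | s in A].
  have rl x s : A s -> r x <= sval s x.
    move=> As; apply: ge_inf; last by exists s.
    exists (- p (- x)) => _ [[q [sq qp]] _ <-] /=.
    by apply: le_trans (sublinear_opp x sq); rewrite lerN2.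
  have lr x (c : R) : (forall s, A s -> c <= sval s x) -> c <= r x.
    move=> H; apply: lb_le_inf; first by exists (sval s0 x), s0.
    by move=> _ [s As <-]; exact: H.
  have sr : sublinear r.
    split=> [x y|a x a0].
      rewrite -lerBlDr; apply: (lr) => s As; rewrite lerBlDr -lerBlDl.
      apply: lr => t At; rewrite lerBlDl.
      have [s' [As' s's s't]] : exists s', [/\ A s', sval s' x <= sval s x &
          sval s' y <= sval t y].
        have [/asboolP H|/asboolP H] := totA _ _ As At.
          by exists t; split=> //; exact: H.
        by exists s; split=> //; exact: H.
      apply: (le_trans (rl _ _ As')); have [[qD _] _] := svalP s'.
      by apply: (le_trans (qD x y)); exact: lerD.
    rewrite -ler_pdivrMl //; apply: lr => s As; rewrite ler_pdivrMl //.
    apply: (le_trans (rl _ _ As)); have [[_ qZ] _] := svalP s.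
    exact: qZ.
  have rp x : r x <= p x.
    by apply: (le_trans (rl _ _ As0)); have [_ +] := svalP s0; apply.
  exists (exist _ r (conj sr rp)) => s As; apply/asboolP => x; exact: rl.
have qE y : tilt q y = q.
  have tp x : tilt q y x <= q x.
    by have := tilt_le y x sq (lexx 0); rewrite scale0r addr0 mul0r subr0.
  have st : sublinear (tilt q y) /\ forall x, tilt q y x <= p x.
    split; first exact: tilt_sublinear.
    by move=> x; exact: le_trans (tp x) (qp x).
  have E : exist _ (tilt q y) st = exist _ q (conj sq qp) :> T.
    by apply: qmin; apply/asboolP.
  by have := congr1 sval E.
have qD x y : q (x + y) = q x + q y.
  apply/eqP; rewrite eq_le sq.1 /=.
  have := tilt_le y x sq ler01; rewrite qE scale1r mul1r.
  by rewrite lerBrDr.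
have q0 : q 0 = 0 by have := qD 0 0; rewrite addr0; lra.
have qN x : q (- x) = - q x by have := qD x (- x); rewrite subrr q0; lra.
have qZp (a : R) x : 0 < a -> q (a *: x) = a * q x.
  by move=> a0; apply/eqP; rewrite eq_le sq.2 // sublinearZ.
exists q; split=> // a x y; rewrite qD; congr (_ + _).
rewrite -[RHS]/(a * q x); have [a0|a0|->] := ltgtP a 0.
- by rewrite -[a]opprK scaleNr qN qZp ?oppr_gt0 // !mulNr.
- exact: qZp.
- by rewrite scale0r mul0r.
Qed.

End HahnBanach.

(** * Reduction from complex to real test functions and coefficients *)

Section ComplexBridge.
Context {R : realType} {G : topologicalZmodType} {lcaG : LCA G}.
Context {haar : {measure set (borel G) -> \bar R}} (haarP : haar_measure haar).
Local Notation I := (ev (hint haar)).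
Local Notation corr := (hcorr haar).
Implicit Types (f a b : G -> R) (u : G -> R[i]).

Lemma ltc_real (z : R[i]) (e : R) : `|z| < real_complex R e ->
  `|complex.Re z| < e /\ `|complex.Im z| < e.
Proof.
move=> ze; split; rewrite -ltcR.
  exact: le_lt_trans (normc_ge_Re z) ze.
rewrite -normrN -ReiNIm; apply: (le_lt_trans (normc_ge_Re _)).
by rewrite normrM normCi mulr1.
Qed.

Lemma in_CcC_Re_Im u : in_CcC u ->
  in_Cc (fun x => complex.Re (u x)) /\ in_Cc (fun x => complex.Im (u x)).
Proof.
move=> [cu sK].
have u0 x : ~ tsupp u x -> u x = 0.
  move=> ux; apply/eqP/negPn/negP => ux0; apply: ux; exact: subset_closure.
have near (x : G) (e : R) : 0 < e -> \forall y \near x,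
    `|complex.Re (u x - u y)| < e /\ `|complex.Im (u x - u y)| < e.
  move=> e0; have := cu x => /cvgrPdist_lt/(_ (real_complex R e)).
  rewrite ltcR => /(_ e0); apply: filterS => y; exact: ltc_real.
split; apply/in_CcP; split.
- move=> x; apply/cvgrPdist_lt => e e0; apply: filterS (near x e e0) => y [+ _].
  by case: (u x) => ? ?; case: (u y) => ? ?.
- by exists (tsupp u) => // x /u0 ->.
- move=> x; apply/cvgrPdist_lt => e e0; apply: filterS (near x e e0) => y [_].
  by case: (u x) => ? ?; case: (u y) => ? ?.
- by exists (tsupp u) => // x /u0 ->.
Qed.

Lemma in_CcC_Complex a b : in_Cc a -> in_Cc b ->
  in_CcC (fun x => Complex (a x) (b x)).
Proof.
move=> /in_CcP[ca [K cK aK]] /in_CcP[cb [L cL bL]]; split; last first.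
  apply: (subclosed_compact _ (compactU cK cL)); first exact: closed_closure.
  have cKL : closed (K `|` L) by apply: compact_closedG; exact: compactU.
  rewrite [K `|` L](closure_id _).1 //; apply: closureS => x /=.
  by apply: contra_neqP => /not_orP[/aK -> /bL ->].
move=> x; apply/cvgrPdist_lt => -[e e'] /=; rewrite ltcE /= => /andP[/eqP -> e0].
have e2 : 0 < e / 2 by lra.
have /cvgrPdist_lt/(_ _ e2) na := ca x.
have /cvgrPdist_lt/(_ _ e2) nb := cb x.
near=> y.
have ay : `|a x - a y| < e / 2 by near: y.
have by_ : `|b x - b y| < e / 2 by near: y.
rewrite (complexE (Complex _ _ - _)) /=; apply: (le_lt_trans (ler_normD _ _)).
rewrite normrM normCi mul1r !normc_def /= !expr0n !addr0 !sqrtr_sqr.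
by rewrite ltcE /= addr0 eqxx /=; lra.
Unshelve. all: by end_near. Qed.

Lemma in_CcC_tilde_conv u x : in_CcC u ->
  let a y := complex.Re (u y) in let b y := complex.Im (u y) in
  convolution haar u (tilde u) x =
    Complex (corr a a x + corr b b x) (corr b a x - corr a b x).
Proof.
move=> Cu a b; have [Ca Cb] : in_Cc a /\ in_Cc b by exact: in_CcC_Re_Im.
have C f g : in_Cc f -> in_Cc g -> in_Cc (fun y => f y * g (y - x)).
  by move=> Cf Cg; apply: in_CcMr => //; case: (in_Cc_shift (- x) Cg).
have E f g : in_Cc f -> in_Cc g -> I (fun y => f y * g (y - x)) = corr f g x.
  move=> Cf Cg; rewrite -(hint_shift haarP x (C f g Cf Cg)).
  by rewrite /hcorr; congr ev; apply/funext => y; rewrite addrK addrC.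
have uE y : u y * tilde u (x - y) =
    Complex (a y * a (y - x) + b y * b (y - x)) (b y * a (y - x) - a y * b (y - x)).
  rewrite /tilde opprB /a /b; case: (u y) => p q; case: (u (y - x)) => r s /=.
  by apply/eqP; rewrite eq_complex /=; apply/andP; split; apply/eqP; ring.
rewrite /convolution; congr Complex.
  rewrite -!E // -(evD (hint_linear haarP)); [|exact: C..].
  rewrite hintE; last by apply: in_CcD; exact: C.
  by congr Rintegral; apply/funext => y; rewrite uE.
rewrite -!E // -(evB (hint_linear haarP)); [|exact: C..].
rewrite hintE; last by apply: in_CcB; exact: C.
by congr Rintegral; apply/funext => y; rewrite uE.
Qed.

(** Being >= 0 in the complex numbers includes a vanishing imaginary part. For u = a + i b the
    pairing with u * u~ has real part psi(a * a~) + psi(b * b~) and imaginary part psi(b * a~) -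
    psi(a * b~). *)
Lemma positive_typeP (psi : Cc R G -> R) : radon psi -> positive_type haar psi <->
  (forall a, in_Cc a -> 0 <= ev psi (corr a a)) /\
  (forall a b, in_Cc a -> in_Cc b -> ev psi (corr b a) = ev psi (corr a b)).
Proof.
move=> rpsi; have lpsi := rpsi.1.
have E u : in_CcC u -> let a y := complex.Re (u y) in let b y := complex.Im (u y) in
    cpairing (convolution haar u (tilde u)) psi =
    Complex (ev psi (corr a a) + ev psi (corr b b))
            (ev psi (corr b a) - ev psi (corr a b)).
  move=> Cu a b; have [Ca Cb] : in_Cc a /\ in_Cc b by exact: in_CcC_Re_Im.
  have C f g : in_Cc f -> in_Cc g -> in_Cc (corr f g) by exact: in_Cc_corr.
  rewrite /cpairing; congr Complex.
    rewrite -(evD lpsi (C _ _ Ca Ca) (C _ _ Cb Cb)) -(pairing_Cc rpsi).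
      by congr pairing; apply/funext => x; rewrite in_CcC_tilde_conv.
    by apply: in_CcD; exact: C.
  rewrite -(evB lpsi (C _ _ Cb Ca) (C _ _ Ca Cb)) -(pairing_Cc rpsi).
    by congr pairing; apply/funext => x; rewrite in_CcC_tilde_conv.
  by apply: in_CcB; exact: C.
split=> [pt|[pt1 pt2] u Cu]; last first.
  have [Ca Cb] := in_CcC_Re_Im Cu.
  by rewrite E // lecE /= pt2 // subrr eqxx addr_ge0 // pt1.
have H a b : in_Cc a -> in_Cc b -> 0 <= Complex (ev psi (corr a a) + ev psi (corr b b))
    (ev psi (corr b a) - ev psi (corr a b)).
  by move=> Ca Cb; have := pt _ (in_CcC_Complex Ca Cb);
    rewrite E //; exact: in_CcC_Complex.
split=> [a Ca|a b Ca Cb].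
  have := H a a Ca Ca; rewrite lecE /= => /andP[_]; lra.
have := H a b Ca Cb; rewrite lecE /= => /andP[+ _].
by rewrite subr_eq0 => /eqP.
Qed.

Lemma rpositive_definiteP f : rpositive_definite f <-> rpd f.
Proof.
have S n (c : 'I_n -> R[i]) (x : 'I_n -> G) :
    \sum_(k < n) \sum_(l < n) c k * conjc (c l) * real_complex R (f (x k - x l)) =
    Complex (\sum_(k < n) \sum_(l < n) (complex.Re (c k) * complex.Re (c l) +
        complex.Im (c k) * complex.Im (c l)) * f (x k - x l))
      (\sum_(k < n) \sum_(l < n) (complex.Im (c k) * complex.Re (c l) -
        complex.Re (c k) * complex.Im (c l)) * f (x k - x l)).
  have sumC (F : 'I_n -> R[i]) : \sum_i F i =
      Complex (\sum_i complex.Re (F i)) (\sum_i complex.Im (F i)).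
    by apply/eqP; rewrite eq_complex /= !raddf_sum /= !eqxx.
  rewrite sumC; congr Complex; apply: eq_bigr => k _; rewrite sumC /=;
    apply: eq_bigr => l _; case: (c k) => p q; case: (c l) => r s /=; ring.
split=> [pd|[fN pd] n c x].
  split=> [x|n c x].
    (* Coefficients 1 and i at the points x and 0 give the form the imaginary part f(-x) - f(x). *)
    pose c (i : 'I_2) : R[i] := if i == ord0 then 1 else 'i%C.
    pose y (i : 'I_2) := if i == ord0 then x else 0.
    have := pd 2%N c y; rewrite S lecE /= => /andP[+ _].
    rewrite !big_ord_recl !big_ord0 /c /y /= !subr0 !sub0r.
    by move=> /eqP h; apply/eqP; rewrite -subr_eq0; apply/eqP; lra.
  have := pd n (fun i => real_complex R (c i)) x; rewrite S lecE /= => /andP[_].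
  congr (0 <= _); apply: eq_bigr => k _; apply: eq_bigr => l _.
  by rewrite mulr0 addr0.
rewrite S lecE /=; apply/andP; split.
  set A := \sum_k _; suff : A = - A by move=> h; apply/eqP; lra.
  rewrite {1}/A exchange_big -sumrN; apply: eq_bigr => k _.
  rewrite -sumrN; apply: eq_bigr => l _.
  by rewrite -(fN (x l - x k)) opprB; ring.
have -> : \sum_(k < n) \sum_(l < n) (complex.Re (c k) * complex.Re (c l) +
        complex.Im (c k) * complex.Im (c l)) * f (x k - x l) =
   \sum_k \sum_l complex.Re (c k) * complex.Re (c l) * f (x k - x l) +
   \sum_k \sum_l complex.Im (c k) * complex.Im (c l) * f (x k - x l).
  rewrite -big_split; apply: eq_bigr => k _; rewrite -big_split.
  by apply: eq_bigr => l _ /=; ring.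
by rewrite addr_ge0 // pd.
Qed.

Lemma rpd_corr v : in_Cc v -> rpd (corr v v).
Proof.
move=> Cv; split=> [x|n c x]; first by rewrite corrN.
exact: corr_psd.
Qed.

End ComplexBridge.

(** * The decomposition mu = nu - kappa *)

Section Decomposition.
Context {R : realType} {G : topologicalZmodType} {lcaG : LCA G}.
Context {haar : {measure set (borel G) -> \bar R}} (haarP : haar_measure haar).
Local Notation I := (ev (hint haar)).
Local Notation corr := (hcorr haar).
Implicit Types (f g h u v w : G -> R) (K U : set G) (psi : Cc R G -> R).

Let lI : linear (hint haar) := hint_linear haarP.

Definition even_func psi := forall f, in_Cc f -> ev psi (fun x => f (- x)) = ev psi f.

Lemma corr_approx_id f v (d : R) x : in_Cc f -> in_Cc v -> (forall y, 0 <= v y) ->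
  (forall y, v y != 0 -> `|f (x + y) - f x| <= d) ->
  `|corr f v x - I v * f x| <= d * I v.
Proof.
move=> Cf Cv v0 fd; rewrite mulrC -(evZ lI (f x) Cv) -(evZ lI d Cv).
have C1 := [elaborate in_Cc_corr_integrand x Cf Cv].
have C2 := [elaborate in_CcZ (f x) Cv].
rewrite -(evB lI C1 C2); apply: (hint_norm_le haarP).
- exact: in_CcB.
- exact: in_CcZ.
move=> y; rewrite -mulrBl normrM (ger0_norm (v0 y)).
have [->|/fd fdy] := eqVneq (v y) 0; first by rewrite !mulr0.
by rewrite ler_wpM2r.
Qed.

(** For a bump v of small support, [corr f v] approximates f and [corr v f], its reflection,
    approximates f(-x), both up to the factor [I v]. The symmetry in [positive_typeP] gives them
    equal values under psi. *)
Lemma pos_type_even psi : radon psi -> positive_type haar psi -> even_func psi.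
Proof.
move=> rpsi /(positive_typeP haarP rpsi)[_ sym] f Cf; have lpsi := rpsi.1.
have [cf [K cK fK]] := (in_CcP _).1 Cf.
have [N [cN nN _]] := @compact_nbhs G _ 0 setT (filterT).
pose S := [set z.1 + z.2 | z in K `*` [set - y | y in N]].
have cS : compact S by apply: compact_add => //; exact: compact_opp.
pose T := S `|` [set - y | y in S].
have cT : compact T by apply: compactU => //; exact: compact_opp.
have [C C0 HC] := radon_bound rpsi cT.
have KS x : K x -> S x.
  move=> Kx; exists (x, 0) => /=; last by rewrite addr0.
  by split=> //=; exists 0; [exact: nbhs_singleton nN|rewrite oppr0].
apply/eqP; rewrite eq_sym -subr_eq0 -normr_eq0; apply/eqP/le_anti.
rewrite normr_ge0 andbT; apply/ler_addgt0Pl => e e0; rewrite addr0.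
pose d := e / (2 * C + 1).
have d0 : 0 < d by rewrite divr_gt0 //; lra.
have nf : nbhs (0 : G) [set h | forall y, `|f (y + h) - f y| < d].
  exact: unif_cont.
have [v [Cv v01 [W oW [W0 vW]] [M [cM MU vM]]]] := urysohn_Cc (R := R)
  (@compact_set1 _ (0 : G)) (@open_interior _ ([set h | forall y, `|f (y + h) - f y| < d]
    `&` N))
  (fun x (x0 : x = 0) => eq_ind_r (fun x => interior _ x) (filterI nf nN) x0).
have v0 y : 0 <= v y by have /andP[] := v01 y.
have vN y : v y != 0 -> (forall x, `|f (x + y) - f x| < d) /\ N y.
  move=> vy; have /MU/interior_subset[] // : M y.
  by apply: contra_neqP vy; exact: vM.
have Iv0 : 0 < I v.
  by apply: (hint_gt0 haarP (x := 0)) => //; rewrite vW //; exact: W0.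
have Cfv : in_Cc (corr f v) by exact: in_Cc_corr.
have Cvf : in_Cc (corr v f) by exact: in_Cc_corr.
have CIf : in_Cc (fun x => I v * f x) by exact: in_CcZ.
have CfN : in_Cc (fun x => f (- x)) by exact: in_Cc_opp.
have CIfN : in_Cc (fun x => I v * f (- x)) by exact: in_CcZ.
have b x : `|corr f v x - I v * f x| <= d * I v.
  by apply: corr_approx_id => // y /vN[/(_ x)/ltW].
have z x : ~ S x -> corr f v x - I v * f x = 0.
  move=> Sx; rewrite fK; last by move=> /KS.
  rewrite mulr0 subr0; apply: (corr_supp haarP fK (U := N)) => // y Ny.
  by apply/eqP/negPn/negP => /vN[_ /Ny].
have h1 : `|ev psi (corr f v) - I v * ev psi f| <= C * (d * I v).
  rewrite -(evZ lpsi _ Cf) -(evB lpsi Cfv CIf); apply: HC => //.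
    exact: in_CcB.
  by move=> x /not_orP[Sx _]; exact: z.
have h2 : `|ev psi (corr v f) - I v * ev psi (fun x => f (- x))| <= C * (d * I v).
  rewrite -(evZ lpsi _ CfN) -(evB lpsi Cvf CIfN).
  apply: HC; first exact: in_CcB.
    move=> x /not_orP[_ Sx]; rewrite -(corrN haarP x Cf Cv); apply: z => Snx.
    by apply: Sx; exists (- x) => //; rewrite opprK.
  by move=> x; rewrite -(corrN haarP x Cf Cv).
rewrite (sym f v Cf Cv) in h2.
have h3 : `|I v * (ev psi f - ev psi (fun x => f (- x)))| <= 2 * C * d * I v.
  move: h1 h2; rewrite !ler_norml => /andP[? ?] /andP[? ?]; apply/andP; split; lra.
move: h3; rewrite normrM (gtr0_norm Iv0) mulrC ler_pM2r // => /le_trans; apply.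
have : d * (2 * C + 1) = e by rewrite /d divfK // gt_eqF //; lra.
by move: d0; nra.
Qed.

Lemma rpdD f g : rpd f -> rpd g -> rpd (fun x => f x + g x).
Proof.
move=> [fN fp] [gN gp]; split=> [x|n c x]; first by rewrite fN gN.
rewrite (_ : \sum_i _ = \sum_i \sum_j c i * c j * f (x i - x j) +
  \sum_i \sum_j c i * c j * g (x i - x j)); first by rewrite addr_ge0.
rewrite -big_split; apply: eq_bigr => i _; rewrite -big_split.
by apply: eq_bigr => j _; rewrite mulrDr.
Qed.

Lemma rpdZ (a : R) f : 0 <= a -> rpd f -> rpd (fun x => a * f x).
Proof.
move=> a0 [fN fp]; split=> [x|n c x]; first by rewrite fN.
rewrite (_ : \sum_i _ = a * \sum_i \sum_j c i * c j * f (x i - x j)).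
  by rewrite mulr_ge0.
rewrite mulr_sumr; apply: eq_bigr => i _; rewrite mulr_sumr.
by apply: eq_bigr => j _; rewrite mulrCA.
Qed.

Lemma rpd0 : rpd (fun _ : G => 0 : R).
Proof.
split=> // n c x; rewrite big1 // => i _; rewrite big1 // => j _.
by rewrite mulr0.
Qed.

Lemma rpd_sum (T : Type) (s : seq T) (F : T -> G -> R) :
  (forall i, rpd (F i)) -> rpd (fun x => \sum_(i <- s) F i x).
Proof.
move=> pF; elim: s => [|i s IH].
  by under eq_fun do rewrite big_nil; exact: rpd0.
by under eq_fun do rewrite big_cons; exact: rpdD.
Qed.

(** This function is the autocorrelation of w - w(. + a). *)
Lemma rpd_corr_diff w (a : G) : in_Cc w ->
  rpd (fun x => 2 * corr w w x - corr w w (x + a) - corr w w (x - a)).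
Proof.
move=> Cw; have Cwa := [elaborate in_Cc_shift a Cw].
have Cd := [elaborate in_CcB Cw Cwa].
have := [elaborate rpd_corr haarP Cd]; rewrite (_ : corr _ _ = fun x =>
  2 * corr w w x - corr w w (x + a) - corr w w (x - a)) //.
apply/funext => x.
have wE : w = fun y => w (y + 0) by apply/funext => y; rewrite addr0.
have E1 : corr (fun y => w (y + a)) w x = corr w w (x + a).
  by rewrite {2}wE corr_shift // subr0.
have E2 : corr w (fun y => w (y + a)) x = corr w w (x - a).
  by rewrite {1}wE corr_shift // addr0.
have E3 : corr (fun y => w (y + a)) (fun y => w (y + a)) x = corr w w x.
  by rewrite corr_shift // addrK.
have C00 := [elaborate in_Cc_corr_integrand x Cw Cw].
have C10 := [elaborate in_Cc_corr_integrand x Cwa Cw].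
have C01 := [elaborate in_Cc_corr_integrand x Cw Cwa].
have C11 := [elaborate in_Cc_corr_integrand x Cwa Cwa].
transitivity (corr w w x - corr (fun y => w (y + a)) w x -
  (corr w (fun y => w (y + a)) x - corr (fun y => w (y + a)) (fun y => w (y + a)) x)).
  rewrite /hcorr -(evB lI C00 C10) -(evB lI C01 C11).
  rewrite -(evB lI (in_CcB C00 C10) (in_CcB C01 C11)).
  by congr ev; apply/funext => y; ring.
by rewrite E1 E2 E3; ring.
Qed.

(** The bump is an autocorrelation scaled to the value 2 at 0, which leaves a compact neighbourhood
    of 0 on which it is at least 1. *)
Lemma bump_exists U : nbhs (0 : G) U -> exists h K,
  [/\ in_Cc h, forall x, 0 <= h x, forall x, ~ U x -> h x = 0 &
      forall a, rpd (fun x => 2 * h x - h (x + a) - h (x - a))] /\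
  [/\ compact K, nbhs (0 : G) K & forall x, K x -> 1 <= h x].
Proof.
move=> nU; have [V nV VU] := nbhs0_sub nU.
have [v [Cv v01 [W oW [W0 vW]] [M [cM MV vM]]]] := urysohn_Cc (R := R)
  (@compact_set1 _ (0 : G)) (@open_interior _ V)
  (fun x (x0 : x = 0) => eq_ind_r (fun x => interior V x) nV x0).
have v0 y : 0 <= v y by have /andP[] := v01 y.
have Cc : in_Cc (corr v v) by exact: in_Cc_corr.
have c0 x : 0 <= corr v v x.
  apply: (ev_ge0 hint_ge0); first exact: in_Cc_corr_integrand.
  by move=> y; rewrite mulr_ge0.
have c00 : 0 < corr v v 0.
  apply: (hint_gt0 haarP (x := 0)); first exact: in_Cc_corr_integrand.
    by move=> y; rewrite mulr_ge0.
  by rewrite addr0 vW ?mulr1 //; exact: W0.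
have a0 : 0 < 2 / corr v v 0 by rewrite divr_gt0.
have : nbhs (0 : G) [set x | corr v v 0 / 2 < corr v v x].
  apply: (Cc.1 0 [set r | corr v v 0 / 2 < r]); apply: open_nbhs_nbhs.
  by split; [exact: open_gt|rewrite /=; lra].
move=> /compact_nbhs[K [cK nK KU]].
exists (fun x => 2 / corr v v 0 * corr v v x), K; split; split=> //.
- exact: in_CcZ.
- by move=> x; rewrite mulr_ge0 // ltW.
- move=> x Ux; rewrite (corr_supp haarP (K := V) (U := V) (x := x)) ?mulr0 //.
  + by move=> y Vy; apply: vM => /MV/interior_subset.
  + by move=> y Vy; apply: vM => /MV/interior_subset.
  + by move=> [[z1 z2] [/= V1 [z3 V3 <-]] E]; apply: Ux; rewrite -E; exact: VU.
- move=> a; have := [elaborate rpdZ (ltW a0) (rpd_corr_diff a Cv)].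
  by congr rpd; apply/funext => x; ring.
- by move=> x /KU /= cx; rewrite mulrAC ler_pdivlMr //; lra.
Qed.

(** Off U the bump vanishes, so 2 h - h_a - h_(-a) is nonpositive there; finitely many a make the
    sum at most -1 on the support of f, and the bound M of |f| scales it. *)
Lemma rpd_dominate U f : nbhs (0 : G) U -> in_Cc f -> exists h,
  [/\ in_Cc h, rpd h & forall x, ~ U x -> h x <= - `|f x|].
Proof.
move=> /bump_exists[h [K [[Ch h0 hU hd] [cK nK hK]]]] Cf.
have [cf [S cS fS]] := (in_CcP _).1 Cf.
have [M M0 fM] := in_Cc_bounded Cf.
have [|s [_ Ss]] := @compact_finite_cover G S (fun x => [set y | K (y - x)]) cS.
  by move=> x _; apply: (@addr_continuous G (- x) x K); rewrite /= subrr.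
pose k a x := 2 * h x - h (x + a) - h (x - a).
have Ck a : in_Cc (k a).
  by apply: in_CcB; [apply: in_CcB; [exact: in_CcZ|exact: in_Cc_shift]|
    exact: in_Cc_shift].
exists (fun x => M * \sum_(a <- s) k a x); split.
- by apply: in_CcZ; exact: in_Cc_sum.
- by apply: rpdZ; [exact: ltW|exact: rpd_sum].
move=> x Ux; have kle a : k a x <= 0.
  by rewrite /k hU //; have := h0 (x + a); have := h0 (x - a); lra.
have sle : \sum_(a <- s) k a x <= 0 by apply: sumr_le0.
have [Sx|Sx] := pselect (S x); last first.
  by rewrite fS // normr0 oppr0 pmulr_rle0.
have [a as_ Ka] := Ss _ Sx.
suff : \sum_(a <- s) k a x <= -1.
  by move=> s1; have := fM x; have := ler_wpM2l (ltW M0) s1; lra.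
rewrite (big_rem a) //=; have k1 : k a x <= -1.
  by rewrite /k hU //; have := h0 (x + a); have := hK _ Ka; lra.
have : \sum_(y <- rem a s) k y x <= 0 by apply: sumr_le0.
lra.
Qed.

Section Split.
Context {Omega : set G} (Osym : forall x, Omega x -> Omega (- x))
  (O0 : nbhs (0 : G) Omega).
Context {mu : Cc R G -> R} (tbmu : tb_measures mu) (evmu : even_func mu).
Hypothesis dualmu : forall f, in_Cc f -> rpd f ->
  (forall x, ~ Omega x -> f x <= 0) -> 0 <= ev mu f.

Let lmu : linear mu := ((tb_measuresP _).1 tbmu).1.

Definition sym_part f : G -> R := fun x => (f x + f (- x)) / 2.

Definition above f g := [/\ in_Cc g, forall x, ~ Omega x -> g x <= 0 &
  rpd (fun x => g x - sym_part f x)].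

Definition dual_gauge (f : Cc R G) : R := inf [set ev mu g | g in above f].

Lemma in_Cc_sym_part f : in_Cc f -> in_Cc (sym_part f).
Proof.
move=> Cf; apply: in_CcMr; last exact: cst_continuous.
by apply: in_CcD => //; exact: in_Cc_opp.
Qed.

Lemma dual_gauge_has_inf (f : Cc R G) : has_inf [set ev mu g | g in above f].
Proof.
have Cf := CcP f; have Cs := [elaborate in_Cc_sym_part Cf].
split.
  have [h [Ch ph hU]] := rpd_dominate O0 Cs.
  exists (ev mu (fun x => h x + sym_part f x)), (fun x => h x + sym_part f x) => //.
  split; first exact: in_CcD.
    move=> x /hU hx; have := ler_norm (sym_part f x); lra.
  by under eq_fun do rewrite addrK.
(* For g above f, the function g + h - f_sym is positive definite as (g - f_sym) + h and nonpositive
   off Omega as g + (h - f_sym); hence mu(g) is at least mu(f_sym - h). *)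
have [h [Ch ph hU]] := rpd_dominate O0 (in_CcN Cs).
have Chs := [elaborate in_CcB Ch Cs].
exists (- ev mu (fun x => h x - sym_part f x)) => _ [g [Cg gO pg] <-].
rewrite -subr_ge0 opprK -(evD lmu Cg Chs); apply: dualmu.
- exact: in_CcD.
- have := [elaborate rpdD pg ph]; congr rpd; apply/funext => x; ring.
- move=> x Ox; have := gO x Ox; have := hU x Ox; rewrite normrN.
  have := ler_norm (- sym_part f x); rewrite normrN; lra.
Qed.

Lemma dual_gauge_le (f : Cc R G) g : above f g -> dual_gauge f <= ev mu g.
Proof.
by move=> fg; apply: ge_inf; [exact: (dual_gauge_has_inf f).2|exists g].
Qed.

Lemma le_dual_gauge (f : Cc R G) (c : R) :
  (forall g, above f g -> c <= ev mu g) -> c <= dual_gauge f.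
Proof.
move=> H; apply: lb_le_inf; first exact: (dual_gauge_has_inf f).1.
by move=> _ [g fg <-]; exact: H.
Qed.

Lemma dual_gauge_sublinear : sublinear dual_gauge.
Proof.
split=> [f f'|a f a0].
  rewrite -lerBlDr; apply: le_dual_gauge => g [Cg gO pg]; rewrite lerBlDr -lerBlDl.
  apply: le_dual_gauge => g' [Cg' g'O pg']; rewrite lerBlDl -(evD lmu Cg Cg').
  apply: dual_gauge_le; split; first exact: in_CcD.
    by move=> x Ox; have := gO x Ox; have := g'O x Ox; lra.
  have := [elaborate rpdD pg pg']; congr rpd; apply/funext => x.
  have E y : Cc_fun (f + f') y = f y + f' y by [].
  by rewrite /sym_part !E; field.
rewrite -ler_pdivrMl //; apply: le_dual_gauge => g [Cg gO pg].
rewrite ler_pdivrMl // -(evZ lmu a Cg); apply: dual_gauge_le; split.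
- exact: in_CcZ.
- by move=> x Ox; rewrite pmulr_rle0 //; exact: gO.
have := [elaborate rpdZ (ltW a0) pg]; congr rpd; apply/funext => x.
have E y : Cc_fun (a *: f) y = a * f y by [].
by rewrite /sym_part !E; field.
Qed.

(* By Hahn-Banach there is nu below the gauge; nu is nonnegative on positive
   definite functions and nu <= mu on functions that are nonpositive off
   Omega. *)
Lemma cone_split : exists nu kappa : Cc R G -> R,
  [/\ tb_measures nu, tb_measures kappa & mu = nu - kappa] /\
  [/\ nonneg_measure kappa,
      forall f, in_Cc f -> (forall x, ~ Omega x -> f x = 0) -> ev kappa f = 0,
      even_func nu & forall f, in_Cc f -> rpd f -> 0 <= ev nu f].
Proof.
have [nu [lnu nup]] := hahn_banach dual_gauge_sublinear.
pose kappa : Cc R G -> R := fun f : Cc R G => nu f - mu f.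
have kE f : ev kappa f = ev nu f - ev mu f by [].
(* The zero function is above -f, since 0 minus the even part of -f is f. *)
have nu_pd f : in_Cc f -> rpd f -> 0 <= ev nu f.
  move=> Cf pf; rewrite -oppr_le0 -(evN lnu Cf).
  apply: (le_trans (nup _)); rewrite -(ev0 lmu); apply: dual_gauge_le.
  split=> //; first exact: in_Cc0.
  suff -> : (fun x => 0 - sym_part (toCc (fun x => - f x)) x) = f by [].
  apply/funext => x; rewrite /sym_part !toCcE; [|exact: in_CcN..].
  by rewrite (pf.1 x); field.
have nu_even : even_func nu.
  move=> f Cf; have CfN := [elaborate in_Cc_opp Cf].
  (* An odd function has even part 0, so the zero function is above it. *)
  have key g : in_Cc g -> (forall x, g (- x) = - g x) -> ev nu g <= 0.
    move=> Cg gN; apply: (le_trans (nup _)); rewrite -(ev0 lmu).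
    apply: dual_gauge_le; split=> //; first exact: in_Cc0.
    suff -> : (fun x => 0 - sym_part (toCc g) x) = (fun=> 0) by exact: rpd0.
    by apply/funext => x; rewrite /sym_part !toCcE // gN; field.
  have h1 : ev nu (fun x => f (- x) - f x) <= 0.
    by apply: key; [exact: in_CcB|move=> x; rewrite opprK opprB].
  have h2 : ev nu (fun x => f x - f (- x)) <= 0.
    by apply: key; [exact: in_CcB|move=> x; rewrite opprK opprB].
  rewrite (evB lnu) // in h1; rewrite (evB lnu) // in h2.
  by apply/eqP; rewrite eq_le; apply/andP; split; lra.
(* By symmetry of Omega the even part of g is above g, and by evenness of mu it has the value
   mu(g). *)
have k_le0 g : in_Cc g -> (forall x, ~ Omega x -> g x <= 0) -> ev kappa g <= 0.
  move=> Cg gO; rewrite kE subr_le0.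
  have Cs := [elaborate in_Cc_sym_part Cg]; have CgN := [elaborate in_Cc_opp Cg].
  have <- : ev mu (sym_part g) = ev mu g.
    rewrite (_ : sym_part g = fun x => 2^-1 * (g x + g (- x))); last first.
      by apply/funext => x; rewrite mulrC.
    by rewrite (evZ lmu) ?(evD lmu) ?evmu //; [field|exact: in_CcD].
  apply: (le_trans (nup _)); apply: dual_gauge_le; split=> //.
    move=> x Ox; have := gO x Ox; have : ~ Omega (- x).
      by move=> /Osym; rewrite opprK.
    by move=> /gO; rewrite /sym_part; lra.
  suff -> : (fun x => sym_part g x - sym_part (toCc g) x) = (fun=> 0) by exact: rpd0.
  by apply/funext => x; rewrite toCcE // subrr.
have k0 g : in_Cc g -> (forall x, ~ Omega x -> g x = 0) -> ev kappa g = 0.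
  move=> Cg gO; apply/eqP; rewrite eq_le k_le0 /=; [|by []|by move=> x /gO ->].
  have := [elaborate k_le0 _ (in_CcN Cg)]; rewrite kE (evN lnu Cg) (evN lmu Cg) => H.
  rewrite kE; suff : - ev nu g - - ev mu g <= 0 by lra.
  by apply: H => x /gO ->; rewrite oppr0.
have lk : linear kappa.
  move=> a f g; rewrite /kappa lnu lmu -[RHS]/(a * _ + _).
  by rewrite -2![_ *: _]/(a * _); ring.
have pk : nonneg_measure kappa.
  move=> f f0; have Cf := CcP f; rewrite -evE.
  have := [elaborate k_le0 _ (in_CcN Cf)]; rewrite kE (evN lnu Cf) (evN lmu Cf) => H.
  rewrite kE; suff : - ev nu f - - ev mu f <= 0 by lra.
  by apply: H => x _; rewrite oppr_le0.
have [_ bmu] := (tb_measuresP _).1 tbmu.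
(* nu (2 h - h_a - h_(-a)) >= 0 while kappa h = 0 for a bump h supported in
   Omega, so kappa h_a is bounded by values of mu on translates of h. *)
have bk : uniformly_bounded kappa.
  have [h [K [[Ch h0 hU hd] [cK nK hK]]]] := bump_exists O0.
  have [_ [S cS hS]] := (in_CcP _).1 Ch.
  have [M M0 hM] := in_Cc_bounded Ch.
  have [C C0 HC] := bmu S cS.
  (* The 4 is the sum of the absolute coefficients in [k]; mu is at most C M in absolute value on
     each translate of h. *)
  have hb a : ev kappa (fun x => h (x - a)) <= 4 * (C * M).
    pose k x := 2 * h x - h (x + a) - h (x - a).
    have C1 : in_Cc (fun x => 2 * h x) by exact: in_CcZ.
    have C2 := [elaborate in_Cc_shift a Ch]; have C3 := [elaborate in_Cc_shift (- a) Ch].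
    have C12 := [elaborate in_CcB C1 C2].
    have Ek psi : linear psi -> ev psi k =
        2 * ev psi h - ev psi (fun x => h (x + a)) - ev psi (fun x => h (x - a)).
      by move=> lpsi; rewrite (evB lpsi C12 C3) (evB lpsi C1 C2) (evZ lpsi _ Ch).
    have Ck : in_Cc k by exact: in_CcB.
    have nk : 0 <= ev nu k by apply: nu_pd => //; exact: hd.
    have kh : ev kappa h = 0 by exact: k0.
    have k1 : 0 <= ev kappa (fun x => h (x + a)) by exact: ev_ge0.
    have HCb b : `|ev mu (fun x => h (x - b))| <= C * M.
      apply: (HC b) => //; first exact: in_Cc_shift.
      by move=> y; exact: hS.
    have m1 := HCb 0; rewrite (_ : (fun x => h (x - 0)) = h) in m1; last first.
      by apply/funext => x; rewrite subr0.
    have m2 := HCb (- a); rewrite (_ : (fun x => h (x - - a)) = fun x => h (x + a)) in m2;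
      last by apply/funext => x; rewrite opprK.
    have m3 := HCb a.
    have := Ek _ lk; have := Ek _ lmu; have := kE k; rewrite kh.
    move: m1 m2 m3; rewrite !ler_norml => /andP[? ?] /andP[? ?] /andP[? ?] *.
    lra.
  move=> L cL.
  have [|s [_ Ls]] := @compact_finite_cover G L (fun x => [set y | K (y - x)]) cL.
    by move=> x _; apply: (@addr_continuous G (- x) x K); rewrite /= subrr.
  exists ((size s)%:R * (4 * (C * M))).
    by rewrite !mulr_ge0 // ltW.
  move=> x f e Cf fL fe; have e0 : 0 <= e by exact: le_trans (fe 0).
  pose H y := \sum_(a <- s) h (y - (a + x)).
  have Chs a : in_Cc (fun y => h (y - (a + x))) by exact: in_Cc_shift.
  have CH : in_Cc H by exact: in_Cc_sum.
  have H0 y : 0 <= H y by apply: sumr_ge0.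
  have fH y : `|f y| <= e * H y.
    have [Ly|/fL ->] := pselect (L (y - x)); last by rewrite normr0 mulr_ge0.
    have [a as_ Ka] := Ls _ Ly; apply: (le_trans (fe y)).
    rewrite -[leLHS]mulr1 ler_wpM2l // /H (big_rem a) //= -[leLHS]addr0.
    apply: lerD; last by apply: sumr_ge0.
    by apply: hK; rewrite opprD addrA addrAC.
  have CeH := [elaborate in_CcZ e CH].
  apply: (@le_trans _ _ (ev kappa (fun y => e * H y))).
    rewrite ler_norml -(evN lk CeH).
    by apply/andP; split; apply: ev_le => //; try exact: in_CcN;
      move=> y; have := fH y; rewrite ler_norml => /andP[].
  rewrite (evZ lk) // mulrC ler_wpM2r // (ev_sum lk) //.
  elim: (s) => [|a r IH]; first by rewrite big_nil mul0r.
  by rewrite big_cons /= -nat1r mulrDl mul1r lerD.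
have tbk : tb_measures kappa by apply/tb_measuresP.
exists nu, kappa; split; split=> //.
- apply/tb_measuresP; split=> // L cL.
  have [C C0 HC] := bmu L cL; have [C' C'0 HC'] := bk L cL.
  exists (C + C'); first by rewrite addr_ge0.
  move=> x f e Cf fL fe; have -> : ev nu f = ev mu f + ev kappa f by rewrite kE; ring.
  rewrite mulrDl; apply: (le_trans (ler_normD _ _)).
  by apply: lerD; [exact: (HC x)|exact: (HC' x)].
- by apply/funext => f; rewrite -[RHS]/(nu f - kappa f) /kappa; ring.
Qed.

End Split.
End Decomposition.

(** * The pairing on X and the dual cone *)

Section Duality.
Context {R : realType} {G : topologicalZmodType} {lcaG : LCA G}.
Context {haar : {measure set (borel G) -> \bar R}} (haarP : haar_measure haar).
Context {G0 Lambda L B : set G} (dataP : tiling_data haar G0 Lambda L B).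
Local Notation corr := (hcorr haar).
Local Notation X := (C_inf1 Lambda L B).
Implicit Types (f g h u v w : G -> R) (K U : set G) (psi : Cc R G -> R).

Lemma cutoff (K : set G) : compact K -> exists h : G -> R,
  [/\ in_Cc h, forall x, 0 <= h x <= 1 & forall x, K x -> h x = 1].
Proof.
move=> cK; have [h [Ch h01 [W oW [KW hW]] _]] := urysohn_Cc (R := R) cK openT
  (@subsetT _ _).
by exists h; split=> // x /KW/hW.
Qed.

(** Common cutoffs for two functions and all measures reduce linearity of [pairing] in either
    argument to linearity on C_c(G). *)
Lemma pairing_lim2 f g : X f -> X g -> exists phi : nat -> G -> R,
  [/\ forall n, in_Cc (phi n), forall n x, 0 <= phi n x <= 1 &
   forall psi, tb_measures psi ->
    (fun n => ev psi (fun x => f x * phi n x)) @ \oo --> pairing f psi /\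
    (fun n => ev psi (fun x => g x * phi n x)) @ \oo --> pairing g psi].
Proof.
move=> /(amalgam_approx dataP)[K [cK HK]] /(amalgam_approx dataP)[K' [cK' HK']].
have /choice[phi Hphi] n : exists h : G -> R, [/\ in_Cc h, forall x, 0 <= h x <= 1 &
   forall x, (K n `|` K' n) x -> h x = 1].
  by apply: cutoff; exact: compactU.
exists phi; split.
- by move=> n; have [] := Hphi n.
- by move=> n; have [_ + _] := Hphi n.
move=> psi tb; split; [apply: HK => // n|apply: HK' => // n];
  have [Cp p01 p1] := Hphi n; split=> // x Kx; rewrite p1 ?lerBlDr ?lerDl ?invr_ge0 //.
  by left.
by right.
Qed.

Lemma pairingB f psi psi' (a : R) : X f -> tb_measures psi -> tb_measures psi' ->
  pairing f (psi - (fun h : Cc R G => a * psi' h)) = pairing f psi - a * pairing f psi'.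
Proof.
move=> Xf tb tb'; have [phi [Cphi _ H]] := pairing_lim2 Xf Xf.
have [h _] := H _ (tb_measuresB a tb tb'); have [h1 _] := H _ tb.
have [h2 _] := H _ tb'.
apply: (cvg_unique _ h) => //.
by apply: cvgB => //; apply: cvgM => //; exact: cvg_cst.
Qed.

Lemma pairingZ f psi (a : R) : X f -> X (fun x => a * f x) -> tb_measures psi ->
  pairing (fun x => a * f x) psi = a * pairing f psi.
Proof.
move=> Xf Xaf tb; have [phi [Cphi _ H]] := pairing_lim2 Xf Xaf.
have [h1 h2] := H _ tb; apply: (cvg_unique _ h2) => //.
have -> : (fun n => ev psi (fun x => a * f x * phi n x)) =
    fun n => a * ev psi (fun x => f x * phi n x).
  apply/funext => n; rewrite -(evZ tb.1.1); last by apply: in_CcM => //; exact: Xf.1.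
  by congr ev; apply/funext => x; rewrite mulrA.
by apply: cvgM => //; exact: cvg_cst.
Qed.

Lemma amalgamZ f (a : R) : 0 < a -> X f -> X (fun x => a * f x).
Proof.
move=> a0 [cf nf]; split.
  by move=> x; apply: continuousM; [exact: cvg_cst|exact: cf].
apply: (@le_lt_trans _ _ (a%:E * norm_inf1 Lambda L B f)%E); last first.
  have nf0 : (0 <= norm_inf1 Lambda L B f)%E.
    by apply: esum_ge0 => p _; exact: (tile_sup_ge0 dataP).
  by rewrite lte_mul_pinfty ?lee_fin ?(ltW a0).
apply: ge_ereal_sup => _ [A [finA AL] <-].
apply: (@le_trans _ _ (\sum_(p \in A) (a%:E * tile_sup (B := B) f p))%E).
  apply: lee_fsum => // p _; apply: ge_ereal_sup => _ [b Bb <-].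
  rewrite normrM (gtr0_norm a0) EFinM lee_wpmul2l ?lee_fin ?(ltW a0) //.
  by apply: ereal_sup_ubound; exists b.
rewrite -ge0_mule_fsumr; last by move=> p; exact: (tile_sup_ge0 dataP).
by rewrite lee_wpmul2l ?lee_fin ?(ltW a0) //; apply: ereal_sup_ubound; exists A.
Qed.

Lemma pairing_positive_type f psi : X f -> rpd f -> tb_measures psi ->
  positive_type haar psi -> 0 <= pairing f psi.
Proof.
move=> Xf pf tb pt; have [pt1 _] := (positive_typeP haarP tb.1).1 pt.
have [K [cK HK]] := amalgam_approx dataP Xf.
(* The error 1 / (n + 2) is below 1 even at n = 0, as [folner] requires, and is within the tolerance
   1 / (n + 1) of [amalgam_approx]. *)
have /choice[v Hv] (n : nat) : exists v : G -> R, [/\ in_Cc v, forall x, 0 <= v x,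
    0 < corr v v 0 & forall x, K n x -> (1 - n.+2%:R^-1) * corr v v 0 <= corr v v x].
  apply: (folner haarP) => //; rewrite invr_gt0 ltr0n /= invf_lt1 ?ltr0n //.
  by rewrite ltr1n.
pose phi n x := (corr (v n) (v n) 0)^-1 * corr (v n) (v n) x.
have cv : (fun n => ev psi (fun x => f x * phi n x)) @ \oo --> pairing f psi.
  apply: HK => // n; have [Cv v0 c0 vK] := Hv n.
  have Cc : in_Cc (corr (v n) (v n)) by exact: in_Cc_corr.
  split; first exact: in_CcZ.
    move=> x; rewrite mulr_ge0 ?invr_ge0 ?(ltW c0) //=; last first.
      apply: (ev_ge0 hint_ge0); first exact: in_Cc_corr_integrand.
      by move=> y; rewrite mulr_ge0.
    rewrite /phi mulrC ler_pdivrMr // mul1r.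
    by apply: (le_trans (ler_norm _)); exact: (corr_le0 haarP).
  move=> x /vK vKx; rewrite /phi mulrC ler_pdivlMr //; apply: (le_trans _ vKx).
  by rewrite ler_pM2r // lerD2l lerN2 lef_pV2 ?posrE ?ltr0n // ler_nat.
rewrite -(cvg_lim _ cv) //; apply: limr_ge; first by apply/cvg_ex; eexists; exact: cv.
apply: nearW => n; have [Cv v0 c0 _] := Hv n.
have Cc : in_Cc (corr (v n) (v n)) by exact: in_Cc_corr.
have Cfc : in_Cc (fun x => f x * corr (v n) (v n) x) by apply: in_CcM => //; exact: Xf.1.
rewrite (_ : (fun x => f x * phi n x) =
  fun x => (corr (v n) (v n) 0)^-1 * (f x * corr (v n) (v n) x)); last first.
  by apply/funext => x; rewrite /phi mulrCA.
rewrite (evZ tb.1.1) // mulr_ge0 ?invr_ge0 ?(ltW c0) //.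
exact: (pos_type_mul_corr haarP tb.1 pt1 Xf.1).
Qed.

(** Minimality of the Jordan parts is applied to the trivial decomposition psi = psi - 0. *)
Lemma nonneg_measure_parts psi f K : radon psi -> nonneg_measure psi -> compact K ->
  in_Cc f -> (forall x, 0 <= f x) -> (forall x, K x -> 1 <= f x) ->
  (pos_part psi K <= (ev psi f)%:E)%E /\ neg_part psi K = 0%E.
Proof.
move=> rpsi ppsi cK Cf f0 fK.
pose z : Cc R G -> R := fun=> 0.
have lz : linear z by move=> a h h'; rewrite /z /= scaler0 addr0.
have pz : nonneg_measure z by move=> h _; exact: lexx.
have E (h : Cc R G) : psi h = psi h - z h by rewrite /z subr0.
have [h1 h2] := pos_neg_part_le rpsi rpsi.1 lz ppsi pz E cK Cf f0 fK.
split=> //; apply/eqP; rewrite eq_le measure_ge0 andbT.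
by apply: (le_trans h2).
Qed.

Lemma nonneg_neg_part0 psi K : radon psi -> nonneg_measure psi -> compact K ->
  neg_part psi K = 0%E.
Proof.
move=> rpsi ppsi cK; have [h [Ch h01 hK]] := cutoff cK.
apply: (nonneg_measure_parts rpsi ppsi cK Ch _ _).2.
- by move=> x; have /andP[] := h01 x.
- by move=> x /hK ->.
Qed.

Lemma measure_supp_sub psi (Theta : set G) : radon psi -> nonneg_measure psi ->
  (forall f, in_Cc f -> (forall x, Theta x -> f x = 0) -> ev psi f = 0) ->
  measure_supp psi `<=` closure Theta.
Proof.
move=> rpsi ppsi H x xs; apply: contrapT => nx.
have oU : open (~` closure Theta) by apply: closed_openC; exact: closed_closure.
have := xs _ oU nx; apply/negP; rewrite -leNgt /Defs.total_variation.
have [_ _ pin] := pos_part_radon rpsi; have [_ _ nin] := neg_part_radon rpsi.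
rewrite pin // nin // -[leRHS]adde0; apply: leeD;
  apply: ge_ereal_sup => _ [K [cK KU] <-]; last by rewrite nonneg_neg_part0.
have [f [Cf f01 [W oW [KW fW]] [M [cM MU fM]]]] := urysohn_Cc (R := R) cK oU KU.
rewrite -[0%E]/(0%:E) -(H f Cf).
  apply: (nonneg_measure_parts rpsi ppsi cK Cf _ _).1.
    by move=> y; have /andP[] := f01 y.
  by move=> y /KW/fW ->.
move=> y Ty; apply: fM => /MU; apply; exact: subset_closure.
Qed.

(** The complement of the closure is null, by inner regularity and finite covers by null open sets.
    If h is a cutoff equal to 1 where g is nonzero, the positive part of g - e h lives on a compact
    subset of that null set; so psi g <= e psi h, and e tends to 0. *)
Lemma ev_nonneg_le0 psi (Theta : set G) g : radon psi -> nonneg_measure psi ->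
  measure_supp psi `<=` closure Theta -> in_Cc g ->
  (forall x, Theta x -> g x <= 0) -> ev psi g <= 0.
Proof.
move=> rpsi ppsi ps Cg gT.
have [_ _ pin] := pos_part_radon rpsi.
have gcl x : closure Theta x -> g x <= 0.
  have cl : closed (g @^-1` [set r | r <= 0]).
    by apply: closed_comp; [move=> y _; exact: Cg.1|exact: closed_le].
  by rewrite closure_id in cl; move=> /(closureS gT); rewrite -cl.
pose U := ~` closure Theta.
have oU : open U by apply: closed_openC; exact: closed_closure.
have PU : pos_part psi (U : set (borel G)) = 0%E.
  rewrite pin //; apply/eqP; rewrite eq_le; apply/andP; split; last first.
    by apply: ereal_sup_ubound; exists set0; [split=> //; exact: compact0|].
  apply: ge_ereal_sup => _ [K [cK KU] <-].
  have /choice[V HV] (x : G) : exists V : set G,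
      [/\ open V, K x -> V x & Defs.total_variation psi V = 0%E].
    have [Kx|nKx] := pselect (K x); last first.
      exists set0; split=> //; first exact: open0.
      by rewrite /Defs.total_variation !measure0 adde0.
    have : ~ measure_supp psi x by move=> /ps; exact: KU.
    move=> /existsNP[V /not_implyP[oV /not_implyP[Vx /negP]]].
    rewrite -leNgt => TV; exists V; split=> //.
    by apply/eqP; rewrite eq_le TV /= /Defs.total_variation adde_ge0.
  have [|s [_ Ks]] := @compact_finite_cover G K V cK.
    by move=> x Kx; have [oV Vx _] := HV x; apply: open_nbhs_nbhs; split=> //; exact: Vx.
  apply: (@le_trans _ _ (Defs.total_variation psi K)).
    by rewrite /Defs.total_variation leeDl.
  apply: (le_trans (@total_variation_subadditive R G psi s V K (borel_compact cK) _ _)).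
  - by move=> x; apply: borel_open; have [] := HV x.
  - by move=> y /Ks[x xs Vy]; exists x.
  by rewrite big1_seq // => x _; have [] := HV x.
have [_ [K cK gK]] := (in_CcP _).1 Cg.
have [h [Ch h01 hK]] := cutoff cK.
have small (e : R) : 0 < e -> ev psi g <= e * ev psi h.
  move=> e0; pose Ke := K `&` [set x | e <= g x].
  have cKe : compact Ke.
    apply: compact_closedI => //; have cl : closed (g @^-1` [set r | e <= r]).
      by apply: closed_comp; [move=> y _; exact: Cg.1|exact: closed_ge].
    exact: cl.
  have KeU : Ke `<=` U.
    by move=> x [_ /= ex] /gcl; apply/negP; rewrite -ltNge; exact: lt_le_trans ex.
  have TK : Defs.total_variation psi Ke = 0%E.
    rewrite /Defs.total_variation (nonneg_neg_part0 rpsi ppsi cKe) adde0.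
    apply/eqP; rewrite eq_le measure_ge0 andbT -PU.
    by apply: le_measure; rewrite ?inE; [exact: borel_compact|exact: borel_open|].
  pose k x := Num.max (g x - e * h x) 0.
  have Cgh : in_Cc (fun x => g x - e * h x) by apply: in_CcB => //; exact: in_CcZ.
  have Ck : in_Cc k by apply: in_Cc_max => //; exact: in_Cc0.
  have kKe x : ~ Ke x -> k x = 0.
    move=> nK; rewrite /k max_r // subr_le0.
    have [Kx|nKx] := pselect (K x); last first.
      by rewrite gK // mulr_ge0 ?(ltW e0) //; have /andP[] := h01 x.
    rewrite hK // mulr1 leNgt; apply/negP => egx; apply: nK; split=> //.
    exact: ltW.
  have [M M0 kM] := in_Cc_bounded Ck.
  have k0 : ev psi k = 0.
    have := [elaborate ev_le_total_variation rpsi cKe Ck kKe kM].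
    by rewrite TK mule0 lee_fin normr_le0 => /eqP.
  rewrite -(evZ rpsi.1) // -subr_le0 -(evB rpsi.1) //; last exact: in_CcZ.
  rewrite -k0; apply: ev_le => //; first exact: rpsi.1.
  by move=> x; rewrite le_max lexx.
have h0 : 0 <= ev psi h by apply: (ev_ge0 ppsi) => // x; have /andP[] := h01 x.
apply/ler_addgt0Pl => e e0; rewrite addr0.
apply: (le_trans (small (e / (1 + ev psi h)) _)).
  by rewrite divr_gt0 // ltr_wpDr.
rewrite mulrAC ler_pdivrMr ?ltr_wpDr //.
by rewrite ler_wpM2l ?(ltW e0) // lerDr.
Qed.

Lemma pairing_le0 psi (Theta : set G) f : X f -> tb_measures psi ->
  nonneg_measure psi -> measure_supp psi `<=` closure Theta ->
  (forall x, Theta x -> f x <= 0) -> pairing f psi <= 0.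
Proof.
move=> Xf tb ppsi ps fT; have [phi [Cphi phi01 H]] := pairing_lim2 Xf Xf.
have [cv _] := H _ tb; rewrite -(cvg_lim _ cv) //.
apply: limr_le; first by apply/cvg_ex; eexists; exact: cv.
apply: nearW => n; apply: (ev_nonneg_le0 tb.1 ppsi ps).
  by apply: in_CcM => //; exact: Xf.1.
by move=> x /fT fx; have /andP[p0 _] := phi01 n x; rewrite mulr_le0_ge0.
Qed.

Lemma calM_dual_cone (Omega : set G) mu :
  calM haar (~` Omega) mu -> dual_cone (admissible_cone Lambda L B Omega) mu.
Proof.
move=> [tbmu [nu [kappa [[tbnu tbk E] [pk sk pt]]]]]; split=> //; rewrite E.
move=> f [Xf /rpositive_definiteP pf fO].
have -> : nu - kappa = nu - (fun h : Cc R G => 1 * kappa h).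
  by congr (_ - _); apply/funext => h; rewrite mul1r.
rewrite pairingB // mul1r subr_ge0; apply: (@le_trans _ _ 0).
  exact: (pairing_le0 Xf tbk pk sk).
exact: pairing_positive_type.
Qed.

(** Testing mu on the members of the cone in C_c(G) suffices for [cone_split]. Evenness of nu then
    supplies the symmetry that upgrades nonnegativity on real autocorrelations to positive type. *)
Lemma dual_cone_calM (Omega : set G) mu :
  (forall x, Omega x -> Omega (- x)) -> nbhs (0 : G) Omega -> even_func mu ->
  dual_cone (admissible_cone Lambda L B Omega) mu -> calM haar (~` Omega) mu.
Proof.
move=> Osym O0 evmu [tbmu dual]; split=> //.
have dualmu f : in_Cc f -> rpd f -> (forall x, ~ Omega x -> f x <= 0) -> 0 <= ev mu f.
  move=> Cf pf fO; rewrite -(pairing_Cc tbmu.1) //; apply: dual; split=> //.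
    exact: (Cc_amalgam dataP).
  exact/rpositive_definiteP.
have [nu [kappa [[tbnu tbk E] [pk k0 evnu nupd]]]] :=
  [elaborate cone_split haarP Osym O0 tbmu evmu dualmu].
exists nu, kappa; split; split=> //.
  apply: (measure_supp_sub tbk.1 pk) => f Cf; exact: k0.
apply/(positive_typeP haarP tbnu.1); split.
  by move=> u Cu; apply: nupd; [exact: in_Cc_corr|exact: (rpd_corr haarP)].
move=> a b Ca Cb; rewrite -evnu; last exact: in_Cc_corr.
by congr ev; apply/funext => x; rewrite (corrN haarP).
Qed.

Lemma even_measureP psi : radon psi -> even_measure psi <-> even_func psi.
Proof.
move=> rpsi; split=> H f.
  move=> Cf; have := H (toCc f); rewrite toCcE //.
  by rewrite !pairing_Cc //; exact: in_Cc_opp.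
have Cf := CcP f; rewrite !pairing_Cc //; last exact: in_Cc_opp.
exact: H.
Qed.

End Duality.

Theorem theorem5p3 (R : realType) (G : topologicalZmodType)
    (G_hausdorff : hausdorff_space G)
    (G_locally_compact : locally_compact [set: G])
    (haar : {measure set (borel G) -> \bar R})
    (haarP : haar_measure haar)
    (G0 Lambda L B : set G) (dataP : tiling_data haar G0 Lambda L B)
    (Omega : set G)
    (Omega_sym : Omega = [set - x | x in Omega])
    (Omega_nbhs : interior Omega 0)
    (rho sigma : Cc R G -> R) 
    (rho_tb : tb_measures rho) (sigma_tb : tb_measures sigma)
    (sigma_spd : strictly_positive_definite haar Lambda L B sigma)
    (rho_even : even_measure rho) :
  lp_dual_feasible (admissible_cone Lambda L B Omega) rho sigma =
    [set s : R | calM haar (~` Omega) (rho - (fun f => s * sigma f))] /\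
  alpha Lambda L B rho sigma Omega = omega haar rho sigma Omega.
Proof.
have lca : LCA G by split.
have Osym x : Omega x -> Omega (- x) by move=> Ox; rewrite Omega_sym; exists x.
have O0 : nbhs (0 : G) Omega by [].
have [_ sigma_pt sigma_pos] := sigma_spd.
have ev_rho : even_func rho by exact: (even_measureP rho_tb.1).1.
have ev_sigma := [elaborate pos_type_even haarP sigma_tb.1 sigma_pt].
pose mu s : Cc R G -> R := rho - (fun f : Cc R G => s * sigma f).
have tbmu s : tb_measures (mu s) by exact: tb_measuresB.
have feasibleP s : calM haar (~` Omega) (mu s) <->
    dual_cone (admissible_cone Lambda L B Omega) (mu s).
  split; first exact: (calM_dual_cone haarP dataP).
  apply: (dual_cone_calM haarP dataP Osym O0) => f Cf.
  have /= := ev_rho f Cf; have /= := ev_sigma f Cf.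
  by rewrite /ev /mu /= => e1 e2; rewrite -![LHS]/(_ - s * _) -![RHS]/(_ - s * _) e1 e2.
have pmu s f : C_inf1 Lambda L B f ->
    pairing f (mu s) = pairing f rho - s * pairing f sigma.
  by move=> Xf; exact: (pairingB dataP).
split; first by apply/seteqP; split=> s /feasibleP.
apply/eqP; rewrite eq_le; apply/andP; split; last first.
  (* Weak duality: for feasible s, the pairing of f with rho - s sigma is nonnegative and equals
     that of f with rho, minus s. *)
  apply: ge_ereal_sup => _ [s /feasibleP[_ sdual] <-].
  apply: le_ereal_inf_tmp => _ [f [Cf fs] <-]; rewrite lee_fin -subr_ge0.
  by have := sdual f Cf; rewrite pmu ?fs ?mulr1 //; case: Cf.
(* Every real s <= alpha is feasible, because a nonzero f in the cone, divided by its positive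
   pairing with sigma, competes in the primal problem. Quantifying over real s also covers infinite
   alpha; f = 0 is handled apart because it cannot be normalised. *)
have feasible s : (s%:E <= alpha Lambda L B rho sigma Omega)%E ->
    (s%:E <= omega haar rho sigma Omega)%E.
  move=> sa; apply: ereal_sup_ubound; exists s => //; apply/feasibleP.
  split=> // f [Xf pf fO]; rewrite pmu // subr_ge0.
  have [[x fx]|/forallNP f0] := pselect (exists x, f x != 0); last first.
    have -> : f = fun x => 0 * f x.
      apply/funext => x; have := f0 x; rewrite mul0r => /negP; rewrite negbK.
      by move=> /eqP.
    have X0 : C_inf1 Lambda L B (fun x => 0 * f x).
      rewrite (_ : (fun x => _) = fun=> 0); last by apply/funext => y; rewrite mul0r.
      exact: (Cc_amalgam dataP in_Cc0).
    by rewrite !(pairingZ dataP Xf X0) // !mul0r mulr0.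
  have c0 := sigma_pos f Xf pf (ex_intro _ x fx); set c := pairing f sigma in c0 *.
  have Xg : C_inf1 Lambda L B (fun x => c^-1 * f x).
    by apply: (amalgamZ dataP) => //; rewrite invr_gt0.
  have : (alpha Lambda L B rho sigma Omega <=
      (pairing (fun x => c^-1 * f x) rho)%:E)%E.
    apply: ereal_inf_lbound; exists (fun x => c^-1 * f x) => //; split; first split=> //.
    - apply/rpositive_definiteP/rpdZ; first by rewrite invr_ge0 ltW.
      exact/rpositive_definiteP.
    - by move=> y /fO fy; rewrite mulr_ge0_le0 // invr_ge0 ltW.
    by rewrite /= (pairingZ dataP) // mulVf // gt_eqF.
  move=> /(le_trans sa); rewrite lee_fin (pairingZ dataP) // mulrC.
  by rewrite ler_pdivlMr.
case: (alpha Lambda L B rho sigma Omega) feasible => [a H|H|_]; [|..|exact: leNye].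
  exact: H.
rewrite leye_eq; apply/eqP/eqyP => a _; exact/H/leey.
Qed.
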